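(* Let $\Omega\subset\mathbb{H}$ be an axially symmetric domain, $\lambda\in\mathbb{R}$ and $I\in\mathbb{S}$. If $g$ is slice-regular on $\Omega$ and $h:=-\Delta_4g$, then $h\in\mathcal{AM}(\Omega)$, and every slice-regular solution $\tilde f$ of the equation $\mathcal{D}_{I\lambda}\mathcal{D}_{-I\lambda}\tilde f=g$ on $\Omega$ gives a solution $f:=\Delta_4\tilde f$ of the equation $\mathcal{L}_{I\lambda}\mathcal{L}_{-I\lambda}f=\Delta_4g$, which is the Yukawa equation $\Delta_3f-\lambda^2f=h$. In particular, if $\lambda\neq0$ and $h=\sum_{n=0}^d\mathcal{P}_n(x)a_n$ ($a_n\in\mathbb{H}$) is an axially monogenic polynomial, then $$f:=-\Delta_4\,\mathcal{S}_{-I\lambda}\mathcal{S}_{I\lambda}(\widetilde\Delta h)$$ is an axially monogenic solution of the Yukawa equation $\Delta_3f-\lambda^2f=h$.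
   Context: $\mathbb{H}$ is the skew field of quaternions, with elements $x=x_0+x_1i+x_2j+x_3k$, $\mathbb{S}=\{J\in\mathbb{H}: J^2=-1\}$; $\Delta_4=\sum_{i=0}^3\partial^2/\partial x_i^2$ and $\Delta_3=\sum_{i=1}^3\partial^2/\partial x_i^2$. For an open set $D\subseteq\mathbb{C}$ invariant under complex conjugation, put $\Omega_D=\{\alpha+J\beta:\ \alpha+i\beta\in D,\ J\in\mathbb{S}\}\subseteq\mathbb{H}$. An axially symmetric domain is a connected open set $\Omega=\Omega_D$ of this form. A stem function on $D$ is a map $F=F_1+\imath F_2:D\to\mathbb{H}\otimes_{\mathbb{R}}\mathbb{C}$ ($F_1,F_2$ $\mathbb{H}$-valued, $\imath$ the central imaginary unit of the factor $\mathbb{C}$) with $F(\overline z)=\overline{F(z)}$, conjugation acting on the factor $\mathbb{C}$. It induces the slice function $f=\mathcal{I}(F):\Omega_D\to\mathbb{H}$, $f(\alpha+J\beta)=F_1(\alpha+i\beta)+JF_2(\alpha+i\beta)$. $\mathcal{S}^1(\Omega)$ is the set of slice functions induced by $C^1$ stem functions; the slice derivative is $\frac{\partial f}{\partial x}=\mathcal{I}(\frac{\partial F}{\partial z})$ with $\frac{\partial}{\partial z}=\frac12(\partial_\alpha-\imath\partial_\beta)$. $f$ is slice-regular if $F$ is holomorphic. For $\mu\in\mathbb{H}$, $\mathcal{D}_\mu f=\frac{\partial f}{\partial x}-f\mu$. The Cauchy-Riemann-Fueter operator is $\overline\partial=\frac12\left(\frac{\partial}{\partial x_0}+i\frac{\partial}{\partial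 x_1}+j\frac{\partial}{\partial x_2}+k\frac{\partial}{\partial x_3}\right)$ and its conjugate is $\partial=\frac12\left(\frac{\partial}{\partial x_0}-i\frac{\partial}{\partial x_1}-j\frac{\partial}{\partial x_2}-k\frac{\partial}{\partial x_3}\right)$ ($i,j,k$ acting by left multiplication). $\mathcal{AM}(\Omega)=\{f\in\mathcal{S}^1(\Omega):\overline\partial f=0\}$ is the space of axially monogenic functions, and $\mathcal{L}_\mu f=\partial f-f\mu$ for $f\in\mathcal{AM}(\Omega)$. $\mathcal{P}_n(x)=-\frac14\Delta_4(x^{n+2})$ for $n\in\mathbb{N}$; $\widetilde\Delta$ is the right $\mathbb{H}$-linear map $\widetilde\Delta\big(\sum_{n=0}^d\mathcal{P}_n(x)a_n\big)=-\frac14\sum_{n=0}^dx^{n+2}a_n$. For $\mu\in\mathbb{H}\setminus\{0\}$ and a polynomial $p(x)=\sum_{n=0}^dx^na_n$ ($a_n\in\mathbb{H}$), $\mathcal{S}_\mu p=\sum_{k=0}^dx^kb_k$ with $b_k=-\sum_{n=k}^d\frac{n!}{k!}a_n\mu^{k-n-1}$. *)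

(* Defs.v *)
From HB Require Import structures.
From mathcomp Require Import all_boot all_order all_algebra.
From mathcomp Require Import all_classical all_reals all_analysis.
From mathcomp Require Import ring lra.
Import Order.TTheory GRing.Theory Num.Theory.
Import numFieldNormedType.Exports.

Set Implicit Arguments.
Unset Strict Implicit.
Unset Printing Implicit Defensive.

Local Open Scope classical_set_scope.
Local Open Scope ring_scope.

(* The skew field of quaternions: the normed R-module 'rV[R]_4 of coordinate
   vectors (x0, x1, x2, x3), with the Hamilton product.  The library norm on
   'rV[R]_4 is the sup norm; only its topology is used. *)
Definition quat (R : realType) : Type := 'rV[R]_4.

HB.instance Definition _ (R : realType) := NormedModule.copy (quat R) 'rV[R]_4.

Section QuatAlgebra.
Context {R : realType}.
Implicit Types x y z : quat R.

Definition mkquat (a b c d : R) : quat R := \row_(k < 4) [:: a; b; c; d]`_k.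

Definition qone : quat R := mkquat 1 0 0 0.

Definition qmul x y : quat R :=
  let: (x0, x1, x2, x3) := (x 0 0, x 0 1, x 0 2, x 0 3) in
  let: (y0, y1, y2, y3) := (y 0 0, y 0 1, y 0 2, y 0 3) in
  mkquat (x0 * y0 - x1 * y1 - x2 * y2 - x3 * y3)
         (x0 * y1 + x1 * y0 + x2 * y3 - x3 * y2)
         (x0 * y2 - x1 * y3 + x2 * y0 + x3 * y1)
         (x0 * y3 + x1 * y2 - x2 * y1 + x3 * y0).

Definition qnorm2 x : R := \sum_(k < 4) x 0 k ^+ 2.

Definition qinv x : quat R :=
  (qnorm2 x)^-1 *: mkquat (x 0 0) (- x 0 1) (- x 0 2) (- x 0 3).

Lemma mkquatE (a b c d : R) :
  ((mkquat a b c d 0 0 = a) * (mkquat a b c d 0 1 = b) *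
   (mkquat a b c d 0 2 = c) * (mkquat a b c d 0 3 = d))%type.
Proof. by rewrite !mxE. Qed.

Lemma quatP x y : x 0 0 = y 0 0 -> x 0 1 = y 0 1 ->
  x 0 2 = y 0 2 -> x 0 3 = y 0 3 -> x = y.
Proof.
move=> e0 e1 e2 e3; apply/rowP => k.
have : k \in [:: 0; 1; 2; 3 : 'I_4] by case: k => [[|[|[|[|k]]]] //].
by rewrite !inE => /or4P[] /eqP->.
Qed.

Lemma quatDE x y k : (x + y) 0 k = x 0 k + y 0 k. Proof. by rewrite mxE. Qed.
Lemma quatNE x k : (- x) 0 k = - x 0 k. Proof. by rewrite mxE. Qed.
Lemma quatZE (a : R) x k : (a *: x) 0 k = a * x 0 k. Proof. by rewrite mxE. Qed.
Lemma quat0E k : (0 : quat R) 0 k = 0. Proof. by rewrite mxE. Qed.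

Lemma qmulA : associative qmul.
Proof. by move=> x y z; apply: quatP; rewrite /qmul !mkquatE; ring. Qed.
Lemma qmul1r : left_id qone qmul.
Proof. by move=> x; apply: quatP; rewrite /qmul !mkquatE; ring. Qed.
Lemma qmulr1 : right_id qone qmul.
Proof. by move=> x; apply: quatP; rewrite /qmul !mkquatE; ring. Qed.
Lemma qmulDl : left_distributive qmul +%R.
Proof. by move=> x y z; apply: quatP; rewrite /qmul !(mkquatE, quatDE); ring. Qed.
Lemma qmulDr : right_distributive qmul +%R.
Proof. by move=> x y z; apply: quatP; rewrite /qmul !(mkquatE, quatDE); ring. Qed.
Lemma qone_neq0 : qone != 0.
Proof.
apply/eqP => /(congr1 (fun x : quat R => x 0 0)).
by rewrite mkquatE quat0E; apply/eqP/oner_neq0.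
Qed.

HB.instance Definition _ := GRing.Zmodule_isNzRing.Build (quat R)
  qmulA qmul1r qmulr1 qmulDl qmulDr qone_neq0.

Lemma quatME x y : x * y = qmul x y. Proof. by []. Qed.
Lemma quat1E : 1 = qone :> quat R. Proof. by []. Qed.

Lemma qscaleAl (a : R) x y : a *: (x * y) = (a *: x) * y.
Proof.
by rewrite !quatME; apply: quatP; rewrite quatZE /qmul !(mkquatE, quatZE); ring.
Qed.
HB.instance Definition _ := GRing.Lmodule_isLalgebra.Build R (quat R) qscaleAl.

Lemma qscaleAr (a : R) x y : a *: (x * y) = x * (a *: y).
Proof.
by rewrite !quatME; apply: quatP; rewrite quatZE /qmul !(mkquatE, quatZE); ring.
Qed.
HB.instance Definition _ := GRing.Lalgebra_isAlgebra.Build R (quat R) qscaleAr.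

Lemma qnorm2E x :
  qnorm2 x = x 0 0 ^+ 2 + x 0 1 ^+ 2 + x 0 2 ^+ 2 + x 0 3 ^+ 2.
Proof.
rewrite /qnorm2 !big_ord_recr big_ord0 /= add0r.
by congr (x 0 _ ^+ 2 + x 0 _ ^+ 2 + x 0 _ ^+ 2 + x 0 _ ^+ 2); apply: val_inj.
Qed.

Lemma qnorm2_neq0 x : x != 0 -> qnorm2 x != 0.
Proof.
apply: contra => /eqP; rewrite /qnorm2 => /eqP.
rewrite psumr_eq0 => [/allP x0|k _]; last exact: sqr_ge0.
apply/eqP/rowP => k; rewrite mxE; apply/eqP; rewrite -sqrf_eq0.
by apply: (implyP (x0 k _)); rewrite ?mem_index_enum.
Qed.

Lemma qmulVr : {in [pred x | x != 0], left_inverse 1 qinv *%R}.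
Proof.
move=> x; rewrite inE => /qnorm2_neq0; rewrite qnorm2E => nx.
by rewrite quat1E quatME; apply: quatP; rewrite /qmul /qinv qnorm2E
  !(mkquatE, quatZE); field.
Qed.

Lemma qmulrV : {in [pred x | x != 0], right_inverse 1 qinv *%R}.
Proof.
move=> x; rewrite inE => /qnorm2_neq0; rewrite qnorm2E => nx.
by rewrite quat1E quatME; apply: quatP; rewrite /qmul /qinv qnorm2E
  !(mkquatE, quatZE); field.
Qed.

Lemma qunitP x y : y * x = 1 /\ x * y = 1 -> [pred x | x != 0] x.
Proof. by case=> yx _; apply/eqP => x0; move/eqP: yx; rewrite x0 mulr0 eq_sym oner_eq0. Qed.

Lemma qinv_out : {in [predC [pred x | x != 0]], qinv =1 id}.
Proof.
move=> x; rewrite !inE negbK => /eqP ->.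
by apply: quatP; rewrite /qinv !(quatZE, mkquatE, quat0E); ring.
Qed.

HB.instance Definition _ := GRing.NzRing_hasMulInverse.Build (quat R)
  qmulVr qmulrV qunitP qinv_out.

End QuatAlgebra.

Section SliceFunctions.
Context {R : realType}.
Local Notation H := (quat R).
Local Notation C := (R * R)%type.
Implicit Types (D : set C) (F : C -> H * H) (f g h : H -> H) (mu : H).

(* A complex number alpha + i beta is the pair (alpha, beta), an element
   w1 + iota w2 of the complexified quaternions is the pair (w1, w2). *)
Definition conjC (z : C) : C := (z.1, - z.2).
Definition conjHC (w : H * H) : H * H := (w.1, - w.2).
Definition iotaM (w : H * H) : H * H := (- w.2, w.1).

Definition imag_units : set H := [set J | J * J = -1].

Definition circularization D : set H :=
  [set x | exists alpha beta J,
     [/\ D (alpha, beta), imag_units J & x = alpha%:A + J * beta%:A]].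

Definition axially_symmetric_domain D :=
  [/\ open D, (forall z, D z -> D (conjC z)),
      open (circularization D) & connected (circularization D)].

Definition stem D F := forall z, D z -> F (conjC z) = conjHC (F z).

Definition d_alpha F : C -> H * H := 'D_((1, 0) : C) F.
Definition d_beta F : C -> H * H := 'D_((0, 1) : C) F.

Definition C1_on D F := forall z, D z ->
  [/\ derivable F z (1, 0), derivable F z (0, 1),
      {for z, continuous (d_alpha F)} & {for z, continuous (d_beta F)}].

Definition d_z F (z : C) : H * H := 2^-1 *: (d_alpha F z - iotaM (d_beta F z)).
Definition d_zbar F (z : C) : H * H := 2^-1 *: (d_alpha F z + iotaM (d_beta F z)).

Definition induces D F f := forall alpha beta J,
  D (alpha, beta) -> imag_units J ->
  f (alpha%:A + J * beta%:A) = (F (alpha, beta)).1 + J * (F (alpha, beta)).2.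

(* S^1(Omega_D).  Functions on Omega_D are represented by functions on all of H
   whose values outside the open set Omega_D are irrelevant. *)
Definition slice_C1 D f := exists F, [/\ stem D F, C1_on D F & induces D F f].

Definition slice_regular D f := exists F,
  [/\ stem D F, C1_on D F, (forall z, D z -> d_zbar F z = 0) & induces D F f].

(* The function I(F), evaluated with the representation x = alpha + J beta in
   which beta = |Im x| >= 0.  When x is real, J is not determined and is taken
   to be 0; the second component of a stem function vanishes there. *)
Definition slice_fun F (x : H) : H :=
  let alpha := x 0 0 in
  let v := x - alpha%:A in
  let beta := Num.sqrt (qnorm2 v) in
  (F (alpha, beta)).1 + (beta^-1 *: v) * (F (alpha, beta)).2.

(* The C^1 stem function inducing f, which is unique on D. *)
Definition stem_of D f : C -> H * H :=
  xget (fun=> 0) [set F | [/\ stem D F, C1_on D F & induces D F f]].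

Definition slice_derivative D f : H -> H := slice_fun (d_z (stem_of D f)).

Definition Dop D mu f : H -> H := fun x => slice_derivative D f x - f x * mu.

(* qbasis 0, 1, 2, 3 are the quaternions 1, i, j, k. *)
Definition qbasis (n : 'I_4) : H := delta_mx 0 n.

Definition partial (n : 'I_4) f : H -> H := 'D_(qbasis n) f.

Definition laplacian4 f (x : H) : H := \sum_(n < 4) partial n (partial n f) x.
Definition laplacian3 f (x : H) : H :=
  \sum_(n < 4 | n != 0) partial n (partial n f) x.

Definition cr_fueter f (x : H) : H :=
  2^-1 *: (partial 0 f x + \sum_(n < 4 | n != 0) qbasis n * partial n f x).
Definition conj_cr_fueter f (x : H) : H :=
  2^-1 *: (partial 0 f x - \sum_(n < 4 | n != 0) qbasis n * partial n f x).

Definition axially_monogenic D f :=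
  slice_C1 D f /\ forall x, circularization D x -> cr_fueter f x = 0.

Definition Lop mu f : H -> H := fun x => conj_cr_fueter f x - f x * mu.

(* Classical solutions: the second derivatives in the equation must exist. *)
Definition yukawa_solution D (lambda : R) h f :=
  forall x, circularization D x ->
    (forall n, n != 0 -> derivable f x (qbasis n) /\
                         derivable (partial n f) x (qbasis n)) /\
    laplacian3 f x - lambda ^+ 2 *: f x = h x.

(* A polynomial with coefficients a_n is stored as an element of {poly H}, and
   evaluated with its coefficients on the right, unlike horner. *)
Definition right_eval (p : {poly H}) (x : H) : H :=
  \sum_(n < size p) x ^+ n * p`_n.

Definition axial_monomial n : H -> H :=
  fun x => - 4^-1 *: laplacian4 (fun y => y ^+ n.+2) x.

Definition axial_eval (a : {poly H}) (x : H) : H :=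
  \sum_(n < size a) axial_monomial n x * a`_n.

(* The map Delta-tilde, from the coefficients of h = axial_eval a to the
   polynomial with coefficients -a_n/4 in degree n + 2.  It is well defined on
   functions since the axial monomials are right linearly independent. *)
Definition lap_tilde (a : {poly H}) : {poly H} :=
  \sum_(n < size a) (- 4^-1 *: a`_n)%:P * 'X^(n.+2).

Definition Sop mu (p : {poly H}) : {poly H} :=
  \poly_(k < size p)
    - \sum_(k <= n < size p) (n`!%:R / k`!%:R) *: (p`_n * mu ^- (n.+1 - k)).

Lemma qnorm2Z (a : R) (x : H) : qnorm2 (a *: x) = a ^+ 2 * qnorm2 x.
Proof. by rewrite !qnorm2E !quatZE; ring. Qed.

Lemma imag_unitsP (J : H) : imag_units J -> J 0 0 = 0 /\ qnorm2 J = 1.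
Proof.
rewrite /imag_units /= quatME => JJ.
have e k : (qmul J J) 0 k = (-1 : H) 0 k by rewrite JJ.
have := (e 0, e 1, e 2, e 3).
rewrite quat1E /qmul !quatNE !mkquatE oppr0 qnorm2E.
move: (J 0 0) (J 0 1) (J 0 2) (J 0 3) => a b c d [[[e0 e1] e2] e3].
have z u : a * u = 0 -> a != 0 -> u = 0.
  by move=> /eqP; rewrite mulf_eq0 => /orP[->|/eqP].
have [a0|a0] := eqVneq a 0.
  by split=> //; rewrite a0 in e0 *; lra.
have b0 : b = 0 by apply: z => //; lra.
have c0 : c = 0 by apply: z => //; lra.
have d0 : d = 0 by apply: z => //; lra.
have := sqr_ge0 a; rewrite expr2.
have -> : a * a = -1 by rewrite -e0 b0 c0 d0; ring.
by rewrite oppr_ge0 ler10.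
Qed.

Lemma slice_funE D F : stem D F -> induces D F (slice_fun F).
Proof.
move=> sF alpha beta J Dz /imag_unitsP[J0 J1].
rewrite -scalerAr mulr1 /slice_fun.
have -> : (alpha%:A + beta *: J) 0 0 = alpha.
  by rewrite quatDE !quatZE quat1E mkquatE J0; ring.
rewrite addrAC subrr add0r qnorm2Z J1 mulr1 sqrtr_sqr.
have := sF _ Dz; rewrite /conjC /conjHC /=.
have [b0|b0|->] := ltgtP beta 0; last first.
- rewrite oppr0 normr0 invr0 !scale0r mul0r.
  move/(congr1 snd) => /= /eqP; rewrite -subr_eq0 opprK -mulr2n -scaler_nat.
  by rewrite scaler_eq0 pnatr_eq0 /= => /eqP ->; rewrite mulr0.
- by rewrite scalerA gtr0_norm ?mulVf ?scale1r ?gt_eqF.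
rewrite scalerA ltr0_norm // => -> /=.
by rewrite invrN mulNr mulVf ?lt_eqF// scaleN1r mulNr mulrN opprK.
Qed.

End SliceFunctions.

(* Main.v *)
Require Import Defs.
From HB Require Import structures.
From mathcomp Require Import all_boot all_order all_algebra.
From mathcomp Require Import all_classical all_reals all_analysis.
From mathcomp Require Import ring lra.
Import Order.TTheory GRing.Theory Num.Theory.
Import numFieldNormedType.Exports.

Set Implicit Arguments.
Unset Strict Implicit.
Unset Printing Implicit Defensive.

Local Open Scope classical_set_scope.
Local Open Scope ring_scope.

(* A slice-regular f = I(F), F holomorphic, is smooth up to the real axis, and its Laplacian is again a
   slice function: Delta_4 I(F) = I(K F) with K F = -2 F'_2/beta + iota 2 (F'_1/beta - F_2/beta^2), where
   K commutes with d/dalpha and produces axially monogenic stems.  On slice-regular functions the slice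
   derivative is d/dx_0, and on the kernel of the Cauchy-Riemann-Fueter operator its conjugate is d/dx_0
   too; so D_mu and L_mu are both d/dx_0 minus right multiplication by mu and are intertwined by Delta_4.
   Finally L_{I lambda} L_{-I lambda} f = d^2f/dx_0^2 + lambda^2 f = -(Delta_3 f - lambda^2 f), because
   monogenic functions are harmonic.
   Two regularity facts are needed.  A C^1 solution of the Cauchy-Riemann equations has a C^1 derivative:
   F' is the mean over a small circle of F e^{-it}/r, which can be differentiated under the integral.
   At the real axis, F_2/beta is the average of F'_1(alpha, t beta) against t^k dt, with k = 0 for
   holomorphic and k = 2 for monogenic stems. *)

(** * Directional derivatives as one-variable derivatives *)

Section DirectionalDerivatives.
Context {R : realType}.

(** The work is done on stems because a slice function carries the factor Im x/|Im x|, singular on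
    the real axis. Off the axis every identity is rational in beta and linear in F and its
    derivatives; on the axis the parity imposed by the stem symmetry (F_1 even, F_2 odd in beta)
    cancels the poles. An axially monogenic function is only known to have a C^1 stem F, and no
    regularity theorem for monogenic functions is invoked: the second derivatives of f come from
    L_{-I lambda} f being axially monogenic too, which makes dF/dalpha a C^1 stem. Noncommutativity
    does no harm: mu multiplies on the right, where it commutes with J and with all derivations, and
    (I lambda)^2 = -lambda^2 is real, so the cross terms of the two factors cancel. For polynomials,
    S_mu is a right inverse of D_mu and Delta_4 undoes Delta-tilde; the outer minus sign of f
    reflects h = -Delta_4 g. Values outside Omega are arbitrary, so derivatives are always compared
    through equality near a point. *)

Lemma is_derive_line (V W : normedModType R) (f : V -> W) x v (s : R) df :
  is_derive (s *: v + x) v f df <-> is_derive s 1 (fun t => f (t *: v + x)) df.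
Proof.
have E : (fun h : R => h^-1 *: ((f \o shift (s *: v + x)) (h *: v) - f (s *: v + x)))
  = (fun h => h^-1 *: (((fun t => f (t *: v + x)) \o shift s) (h *: 1) - f (s *: v + x))).
  by apply/funext => h /=; rewrite [h *: 1]mulr1 scalerDl addrA.
by split=> -[dr <-]; apply: DeriveDef; rewrite /derivable /derive ?E// -E.
Qed.

Lemma is_derive_line0 (V W : normedModType R) (f : V -> W) x v df :
  is_derive x v f df <-> is_derive (0 : R) 1 (fun t => f (t *: v + x)) df.
Proof. by rewrite -is_derive_line scale0r add0r. Qed.

Lemma is_derive_comp1 (V W : normedModType R) (h : R -> W) (g : V -> R) x v (dg : R) (dh : W) :
  is_derive x v g dg -> is_derive (g x) 1 h dh ->
  is_derive x v (h \o g) (dg *: dh).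
Proof.
move=> /(@is_derive_line0 V R) [/derivable1_diffP dg0 dg1].
rewrite -[X in g X]add0r -[X in g (X + x)](scale0r v).
move=> [/derivable1_diffP dh0 dh1].
apply/is_derive_line0.
pose k := fun t => g (t *: v + x).
have dk := @differentiable_comp _ _ _ _ k h 0 dg0 dh0.
apply: DeriveDef; first exact/derivable1_diffP.
rewrite (deriveE _ dk) (@diff_comp _ _ _ _ k h 0 dg0 dh0).
change ('d h (k 0) ('d k 0 1) = dg *: dh).
have -> : 'd k 0 1 = dg *: (1 : R).
  by rewrite -(deriveE _ dg0) dg1 [RHS]mulr1.
by rewrite linearZ -(deriveE _ dh0) dh1.
Qed.

Lemma is_derive_unique (V W : normedModType R) (f : V -> W) x v df1 df2 :
  is_derive x v f df1 -> is_derive x v f df2 -> df1 = df2.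
Proof. by move=> [_ <-] [_ <-]. Qed.

End DirectionalDerivatives.

Lemma continuous_pairing (S T U : topologicalType) (f : S -> T) (g : S -> U) x :
  {for x, continuous f} -> {for x, continuous g} ->
  {for x, continuous (fun y => (f y, g y))}.
Proof. exact: cvg_pair. Qed.

(** * Integrals depending on a parameter: continuity and differentiation *)

Section ParamIntegral.
Context {R : realType}.
Local Notation mu := (@lebesgue_measure R).

(** A tube lemma: joint continuity at each point of the compact segment makes the estimate uniform
    in [t]. *)
Lemma near_uniform_segment (T : topologicalType) (G : T -> R -> R) z0 (a b : R) :
  (forall t, t \in `[a, b] -> {for (z0, t), continuous (fun p : T * R => G p.1 p.2)}) ->
  forall e, 0 < e -> \forall z \near z0, forall t, t \in `[a, b] ->
    `|G z t - G z0 t| < e.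
Proof.
move=> cG e e0.
have /compact_near_coveringP H := @segment_compact R a b.
apply: (H _ (nbhs z0) (fun z t => `|G z t - G z0 t| < e)).
move=> t tab.
have e2 : 0 < e / 2 by rewrite divr_gt0.
have /cvgrPdist_lt/(_ _ e2) := cG t tab.
move=> [[A B] /= [nA nB] AB].
exists (B, A); first by [].
move=> [t' z] /= [Bt' Az].
have /= h1 := AB (z, t') (conj Az Bt').
have /= h2 := AB (z0, t') (conj (nbhs_singleton nA) Bt').
rewrite [e]splitr -(subrKA (G z0 t)).
apply: le_lt_trans (ler_normD _ _) _.
by rewrite distrC ltrD.
Qed.

Lemma continuous_section (T : topologicalType) (G : T -> R -> R) z (t : R) :
  {for (z, t), continuous (fun p : T * R => G p.1 p.2)} ->
  {for t, continuous (G z)}.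
Proof.
move=> cG; apply: (@continuous_comp _ _ _ (fun t => (z, t)) (fun p => G p.1 p.2)) => //.
by apply: continuous_pairing; [exact: cvg_cst|exact: cvg_id].
Qed.

Lemma integrable_continuous (f : R -> R) (a b : R) :
  (forall t, t \in `[a, b] -> {for t, continuous f}) ->
  mu.-integrable `[a, b] (EFin \o f).
Proof.
move=> cf; apply: continuous_compact_integrable; first exact: segment_compact.
by apply: continuous_in_subspaceT => t /set_mem /=; exact: cf.
Qed.

Lemma continuous_param_integral (T : topologicalType) (G : T -> R -> R) z0 (a b : R) :
  a <= b ->
  (\forall z \near z0, forall t, t \in `[a, b] ->
     {for (z, t), continuous (fun p : T * R => G p.1 p.2)}) ->
  {for z0, continuous (fun z => \int[mu]_(t in `[a, b]) G z t)}.
Proof.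
move=> ab cG.
apply/cvgrPdist_le => e e0.
(* The added 1 keeps the denominator positive when [a = b]. *)
have e1 : 0 < e / (b - a + 1) by rewrite divr_gt0// ltr_wpDl// subr_ge0.
have U := near_uniform_segment (nbhs_singleton cG) e1.
near=> z.
have iz y : (forall t, t \in `[a, b] ->
     {for (y, t), continuous (fun p : T * R => G p.1 p.2)}) ->
   mu.-integrable `[a, b] (EFin \o G y).
  by move=> h; apply: integrable_continuous => t /h /continuous_section.
have i0 := iz _ (nbhs_singleton cG).
have i1 : mu.-integrable `[a, b] (EFin \o G z) by apply: iz; near: z.
rewrite -RintegralB//.
have i2 : mu.-integrable `[a, b] (EFin \o (fun t => G z0 t - G z t)).
  exact: (integrableB _ i0 i1).
apply: (le_trans (le_normr_Rintegral _ i2)) => //.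
have h1 : \int[mu]_(t in `[a, b]) `|G z0 t - G z t| <=
   \int[mu]_(t in `[a, b]) (cst (e / (b - a + 1)) t).
  apply: le_Rintegral => //.
  - exact: (integrable_norm i2).
  - by apply: integrable_continuous => t _; exact: cvg_cst.
  - move=> t tab; rewrite distrC /cst; apply/ltW.
    by move: t tab; near: z.
apply: (le_trans h1); rewrite Rintegral_cst//.
have -> : fine (mu `[a, b]%classic) = b - a.
  by rewrite lebesgue_measure_itv /= lte_fin; case: ltgtP ab => // -> _; rewrite subrr.
have : 0 <= b - a by rewrite subr_ge0.
move: (b - a) => c c0; rewrite mulrAC -mulrA ler_piMr ?ltW//.
by rewrite ltr_pdivrMr ?mul1r ?ltrDl // ltr_wpDl.
Unshelve. all: by end_near. Qed.

Lemma is_derive_param_integral1 (G G' : R -> R -> R) (s0 a b : R) :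
  (\forall s \near s0, forall t, t \in `[a, b] ->
     [/\ {for (s, t), continuous (fun p : R * R => G p.1 p.2)},
         {for (s, t), continuous (fun p : R * R => G' p.1 p.2)} &
         is_derive s 1 (G^~ t) (G' s t)]) ->
  is_derive s0 1 (fun s => \int[mu]_(t in `[a, b]) G s t)
    (\int[mu]_(t in `[a, b]) G' s0 t).
Proof.
move=> near_h.
have h0 := nbhs_singleton near_h.
have cG' t : t \in `[a, b] -> {for t, continuous (G' s0)}.
  by move=> /h0 [_ /continuous_section].
have U := near_uniform_segment (fun t tab => let: And3 _ c _ := h0 t tab in c) ltr01.
have [M Mb] : exists M, forall t, t \in `[a, b] -> `|G' s0 t| <= M.
  have cw : {within `[a, b], continuous (G' s0)}.
    by apply: continuous_in_subspaceT => t /set_mem /=; exact: cG'.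
  have [M [_ HM]] := compact_bounded (continuous_compact cw (@segment_compact _ a b)).
  by exists (M + 1) => t tab; apply: HM; rewrite ?ltrDl//; exists t.
have [e e0 He] : exists2 e, 0 < e & forall s, `|s0 - s| < e -> (forall t, t \in `[a, b] ->
     [/\ {for (s, t), continuous (fun p : R * R => G p.1 p.2)},
         {for (s, t), continuous (fun p : R * R => G' p.1 p.2)} &
         is_derive s 1 (G^~ t) (G' s t)] /\ `|G' s t - G' s0 t| < 1).
  have : \forall s \near s0, (forall t, t \in `[a, b] ->
     [/\ {for (s, t), continuous (fun p : R * R => G p.1 p.2)},
         {for (s, t), continuous (fun p : R * R => G' p.1 p.2)} &
         is_derive s 1 (G^~ t) (G' s t)] /\ `|G' s t - G' s0 t| < 1).
    near=> s => t tab; split; first by move: t tab; near: s.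
    by move: t tab; near: s.
  by move=> /nbhs_ballP[e /= e0 He]; exists e => // s /He.
have He' s : `]s0 - e, s0 + e[%classic s -> `|s0 - s| < e.
  by rewrite /= in_itv/= => /andP[h1 h2]; rewrite ltr_norml; apply/andP; split; lra.
have D1 s t : `]s0 - e, s0 + e[%classic s -> t \in `[a, b] ->
    partial1of2 G s t = G' s t.
  by move=> /He' /He h tab; rewrite partial1of2E; have [[_ _ []]] := h t tab.
have Is0 : `]s0 - e, s0 + e[%classic s0 by rewrite /= in_itv/=; lra.
have int1 s : `]s0 - e, s0 + e[%classic s -> mu.-integrable `[a, b] (EFin \o G s).
  move=> /He' /He h; apply: integrable_continuous => t /h [[c _ _] _].
  exact: continuous_section c.
have der1 s t : `]s0 - e, s0 + e[%classic s -> `[a, b]%classic t -> derivable (G^~ t) s 1.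
  by move=> /He' /He h tab; have [[_ _ []]] := h t tab.
(* The dominating constant: a bound for [G' s0] on the segment, plus 1 for the variation in [s]. The
   absolute value makes it nonnegative even if the segment is empty and [M] says nothing. *)
have int2 : mu.-integrable `[a, b] (EFin \o cst (`|M| + 1)).
  by apply: integrable_continuous => t _; exact: cvg_cst.
have bnd s t : `]s0 - e, s0 + e[%classic s -> `[a, b]%classic t ->
    `|partial1of2 G s t| <= cst (`|M| + 1) t.
  move=> sI tab; rewrite D1//= -(subrK (G' s0 t) (G' s t)).
  apply: (le_trans (ler_normD _ _)); rewrite addrC lerD//.
    exact: (le_trans (Mb _ tab) (ler_norm _)).
  by apply/ltW; have [] := He _ (He' _ sI) t tab.
have c0 (t : R) : 0 <= cst (`|M| + 1) t :> R by rewrite /cst addr_ge0.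
apply: DeriveDef.
  exact: (derivable_under_integral _ Is0 int1 der1 c0 int2 bnd).
rewrite -derive1E (differentiation_under_integral _ Is0 int1 der1 c0 int2 bnd)//.
by apply: eq_Rintegral => t /set_mem tab; exact: D1.
Unshelve. all: by end_near. Qed.

Lemma is_derive_param_integral (V : normedModType R) (G G' : V -> R -> R)
    (z0 v : V) (a b : R) :
  (\forall z \near z0, forall t, t \in `[a, b] ->
     [/\ {for (z, t), continuous (fun p : V * R => G p.1 p.2)},
         {for (z, t), continuous (fun p : V * R => G' p.1 p.2)} &
         is_derive z v (G^~ t) (G' z t)]) ->
  is_derive z0 v (fun z => \int[mu]_(t in `[a, b]) G z t)
    (\int[mu]_(t in `[a, b]) G' z0 t).
Proof.
move=> near_h; apply/is_derive_line0.
(* Restricting the parameter to the line through [z0] in direction [v] leaves the one-variable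
   case. *)
pose l s := s *: v + z0.
have cl s : {for s, continuous l}.
  apply: continuousD; last exact: cvg_cst.
  exact: scalel_continuous.
have l0 : l 0 = z0 by rewrite /l scale0r add0r.
rewrite -[in G' z0]l0.
apply: (@is_derive_param_integral1 (fun s t => G (l s) t) (fun s t => G' (l s) t)).
rewrite -l0 in near_h.
have := cl 0 _ near_h; rewrite nbhs_filterE /=.
apply: filterS => s h t tab; have [c1 c2 d] := h t tab.
have cc (K : V -> R -> R) : {for (l s, t), continuous (fun p : V * R => K p.1 p.2)} ->
   {for (s, t), continuous (fun p : R * R => K (l p.1) p.2)}.
  move=> cK; apply: (@continuous_comp _ _ _ (fun p => (l p.1, p.2)) (fun p => K p.1 p.2)) => //.
  apply: continuous_pairing; last exact: cvg_snd.
  by apply: cvg_comp; [exact: cvg_fst|exact: cl].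
split; [exact: cc|exact: cc|].
by apply/(@is_derive_line R V R (G^~ t)).
Qed.

End ParamIntegral.

(** * Differentiability of C^1 functions of two real variables *)

Section PlaneCalculus.
Context {R : realType}.
Local Notation C := (R * R)%type.

Lemma mean_value_bound (f df : R -> R) (a h c e : R) :
  (forall s, `|s - a| <= `|h| -> is_derive s 1 f (df s)) ->
  (forall s, `|s - a| <= `|h| -> `|df s - c| <= e) ->
  `|f (a + h) - f a - h * c| <= e * `|h|.
Proof.
move=> dfs bnd.
have key (x y : R) : x <= y -> (forall s, s \in `[x, y] -> is_derive s 1 f (df s)) ->
    (forall s, s \in `[x, y] -> `|df s - c| <= e) ->
    `|f y - f x - (y - x) * c| <= e * (y - x).
  move=> xy d b.
  have [|t tab ->] := MVT_segment xy (fun s sxy => d s (subset_itv_oo_cc sxy)).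
    apply: derivable_within_continuous => s sxy.
    by have [] := d s sxy.
  rewrite [(y - x) * c]mulrC -mulrBl normrM (ger0_norm (_ : 0 <= y - x)) ?subr_ge0//.
  by apply: ler_wpM2r; rewrite ?subr_ge0// b.
have inball (s : R) : (s \in `[a, a + h]) || (s \in `[a + h, a]) -> `|s - a| <= `|h|.
  rewrite !in_itv/= => /orP[] /andP[h1 h2].
    by rewrite !ger0_norm; lra.
  by rewrite !ler0_norm; lra.
have [h0|h0] := leP 0 h.
  have := key a (a + h); rewrite [a + h - a]addrC addKr (ger0_norm h0); apply.
  - by rewrite lerDl.
  - by move=> s sI; apply: dfs; apply: inball; rewrite sI.
  - by move=> s sI; apply: bnd; apply: inball; rewrite sI.
have := key (a + h) a.
rewrite opprD addrA subrr add0r (ltr0_norm h0) mulNr opprK.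
rewrite -normrN !opprD !opprK [- f a + _]addrC; apply.
- by rewrite gerDl ltW.
- by move=> s sI; apply: dfs; apply: inball; rewrite sI orbT.
- by move=> s sI; apply: bnd; apply: inball; rewrite sI orbT.
Qed.

Lemma is_derive_sectionl (W : normedModType R) (u : C -> W) (a b : R) du :
  is_derive (a, b) (1, 0) u du <-> is_derive a 1 (fun s => u (s, b)) du.
Proof.
have -> : (fun s => u (s, b)) = (fun s => u (s *: (1, 0) + (0, b))).
  by apply/funext => s; congr u; congr pair => /=; rewrite ?[s *: 1]mulr1 ?scaler0 ?addr0 ?add0r.
rewrite -is_derive_line.
have -> // : (a *: (1, 0) + (0, b) : C) = (a, b).
by congr pair; rewrite /= ?[a *: 1]mulr1 ?scaler0 ?addr0 ?add0r.
Qed.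

Lemma is_derive_sectionr (W : normedModType R) (u : C -> W) (a b : R) du :
  is_derive (a, b) (0, 1) u du <-> is_derive b 1 (fun s => u (a, s)) du.
Proof.
have -> : (fun s => u (a, s)) = (fun s => u (s *: (0, 1) + (a, 0))).
  by apply/funext => s; congr u; congr pair => /=; rewrite ?[s *: 1]mulr1 ?scaler0 ?addr0 ?add0r.
rewrite -is_derive_line.
have -> // : (b *: (0, 1) + (a, 0) : C) = (a, b).
by congr pair; rewrite /= ?[b *: 1]mulr1 ?scaler0 ?addr0 ?add0r.
Qed.

(** The increment is split into a horizontal step at height [z.2 + h.2] and a vertical step at
    abscissa [z.1], each controlled by the mean value theorem. Differentiability is what the chain
    rule along curves requires; partial derivatives alone would not do. *)
Lemma C1_is_diff (u p q : C -> R) (z : C) :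
  (\forall w \near z, is_derive (w : C) (1, 0) u (p w)) ->
  (\forall w \near z, is_derive (w : C) (0, 1) u (q w)) ->
  {for z, continuous p} -> {for z, continuous q} ->
  is_diff z u (fun h : C => h.1 * p z + h.2 * q z).
Proof.
move=> du1 du2 cp cq.
pose L (h : C) := h.1 * p z + h.2 * q z.
have linL : linear L.
  by move=> k x y; rewrite /L /= -[_ *: (_ + _ : R)]/(_ * _) -[_ *: x.1]/(_ * _) -[_ *: x.2]/(_ * _); ring.
pose LM := GRing.isLinear.Build _ _ _ _ _ linL.
pose LL : {linear C -> R} := HB.pack L LM.
have cL : continuous L.
  move=> x; apply: cvgD; apply: cvgM; [exact: cvg_fst|exact: cvg_cst|exact: cvg_snd|exact: cvg_cst].
have O (e : R) : 0 < e -> \forall h \near (0 : C), `|u (h + z) - (u z + L h)| <= e * `|h|.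
  move=> e0.
  have e2 : 0 < e / 2 by rewrite divr_gt0.
  move/cvgrPdist_le/(_ _ e2) : cp => cp.
  move/cvgrPdist_le/(_ _ e2) : cq => cq.
  have : \forall w \near z, [/\ is_derive (w : C) (1, 0) u (p w), is_derive (w : C) (0, 1) u (q w),
      `|p z - p w| <= e / 2 & `|q z - q w| <= e / 2].
    by near=> w; split; near: w.
  move=> /nbhs_ballP[d /= d0 Hd].
  apply/nbhs_ballP; exists d => //= h [/= h1 h2].
  rewrite /= -ball_normE /= sub0r normrN in h1.
  rewrite /= -ball_normE /= sub0r normrN in h2.
  rewrite /L.
  have D w : `|w.1 - z.1| <= `|h.1| -> `|w.2 - z.2| <= `|h.2| ->
    [/\ is_derive (w : C) (1, 0) u (p w), is_derive (w : C) (0, 1) u (q w),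
      `|p z - p w| <= e / 2 & `|q z - q w| <= e / 2].
    move=> w1 w2; apply: Hd; split; rewrite -ball_normE /= distrC.
      exact: le_lt_trans w1 h1.
    exact: le_lt_trans w2 h2.
  have e22 : `|z.2 + h.2 - z.2| <= `|h.2| by rewrite [z.2 + _]addrC addrK.
  have e11 : `|z.1 - z.1| <= `|h.1| by rewrite subrr normr0.
  have S1 : `|u (z.1 + h.1, z.2 + h.2) - u (z.1, z.2 + h.2) - h.1 * p z| <= e / 2 * `|h.1|.
    apply: (mean_value_bound (f := fun s => u (s, z.2 + h.2)) (df := fun s => p (s, z.2 + h.2))).
      move=> s sh; apply/is_derive_sectionl.
      by have [? _ _ _] := D (s, z.2 + h.2) sh e22.
    move=> s sh; rewrite distrC.
    by have [_ _ ? _] := D (s, z.2 + h.2) sh e22.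
  have S2 : `|u (z.1, z.2 + h.2) - u (z.1, z.2) - h.2 * q z| <= e / 2 * `|h.2|.
    apply: (mean_value_bound (f := fun s => u (z.1, s)) (df := fun s => q (z.1, s))).
      move=> s sh; apply/is_derive_sectionr.
      by have [_ ? _ _] := D (z.1, s) e11 sh.
    move=> s sh; rewrite distrC.
    by have [_ _ _ ?] := D (z.1, s) e11 sh.
  have hn : `|h| = Num.max `|h.1| `|h.2| by [].
  have N1 : `|h.1| <= `|h| by rewrite hn le_max lexx.
  have N2 : `|h.2| <= `|h| by rewrite hn le_max lexx orbT.
  have -> : h + z = (z.1 + h.1, z.2 + h.2) by rewrite addrC.
  have -> : u z = u (z.1, z.2) by rewrite -surjective_pairing.
  have -> : u (z.1 + h.1, z.2 + h.2) - (u (z.1, z.2) + (h.1 * p z + h.2 * q z)) =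
    (u (z.1 + h.1, z.2 + h.2) - u (z.1, z.2 + h.2) - h.1 * p z) +
    (u (z.1, z.2 + h.2) - u (z.1, z.2) - h.2 * q z) by ring.
  apply: (le_trans (ler_normD _ _)); rewrite [e]splitr mulrDl.
  apply: lerD.
    by apply: (le_trans S1); apply: ler_wpM2l => //; exact: ltW.
  by apply: (le_trans S2); apply: ler_wpM2l => //; exact: ltW.
have E := (@eqaddoP _ C R C _ (u \o shift z) (cst (u z) + L) id).2 O.
have dE : 'd u z = LL :> (C -> R) by apply: (@diff_unique _ C R u LL z cL E).
apply: DiffDef; last by rewrite dE.
by apply/diff_locallyP; rewrite dE; split.
Unshelve. all: by end_near. Qed.

Lemma is_derive_curve (u p q : C -> R) (a b : R -> R) (t a' b' : R) :
  (\forall w \near (a t, b t), is_derive (w : C) (1, 0) u (p w)) ->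
  (\forall w \near (a t, b t), is_derive (w : C) (0, 1) u (q w)) ->
  {for (a t, b t), continuous p} -> {for (a t, b t), continuous q} ->
  is_derive t 1 a a' -> is_derive t 1 b b' ->
  is_derive t 1 (fun s => u (a s, b s)) (a' * p (a t, b t) + b' * q (a t, b t)).
Proof.
move=> h1 h2 h3 h4 [/derivable1_diffP da <-] [/derivable1_diffP db <-].
have [du dE] := C1_is_diff h1 h2 h3 h4.
have dab := differentiable_pair da db.
have dk := @differentiable_comp _ _ _ _ (fun s => (a s, b s)) u t dab du.
apply: DeriveDef; first exact/derivable1_diffP.
rewrite (deriveE _ dk) (@diff_comp _ _ _ _ (fun s => (a s, b s)) u t dab du).
change ('d u (a t, b t) ('d (fun s => (a s, b s)) t 1) =
  'D_1 a t * p (a t, b t) + 'D_1 b t * q (a t, b t)).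
by rewrite dE (diff_pair da db) /= -!deriveE.
Qed.

End PlaneCalculus.

(** * Cauchy's formula on circles for real pairs u, v *)

Section CauchyRiemann.
Context {R : realType}.
Local Notation C := (R * R)%type.
Local Notation mu := (@lebesgue_measure R).

Lemma scalE (a b : R) : a *: b = a * b. Proof. by []. Qed.

Lemma oppfE (u : C -> R) z : (- u) z = - u z. Proof. by []. Qed.

Implicit Types (U : set C) (u v : C -> R) (z w : C).

(* The Cauchy-Riemann equations for u + i v with derivative u' + i v'. *)
Definition holo U u v u' v' := forall z, U z ->
  [/\ is_derive z (1, 0) u (u' z), is_derive z (0, 1) u (- v' z),
      is_derive z (1, 0) v (v' z) & is_derive z (0, 1) v (u' z)] /\
  ({for z, continuous u'} /\ {for z, continuous v'}).

(** Multiplication by -i: -i(u + iv) = v - iu. Facts proved for the real part [u] thereby transfer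
    to [v]. *)
Lemma holo_conj U u v u' v' :
  holo U u v u' v' -> holo U v (- u) v' (- u').
Proof.
move=> h z /h [[d1 d2 d3 d4] [c1 c2]]; split; [split => //|split => //].
- by rewrite fctE opprK.
- exact: is_deriveN.
- by rewrite -[v' z]opprK; exact: is_deriveN.
- exact: continuousN.
Qed.

Lemma holo_continuous U u v u' v' z : open U ->
  holo U u v u' v' -> U z -> {for z, continuous u}.
Proof.
move=> oU h Uz; apply: differentiable_continuous.
have nU : \forall w \near z, U w by exact: open_nbhs_nbhs.
have [_ [c1 c2]] := h z Uz.
suff [] : is_diff z u (fun k : C => k.1 * u' z + k.2 * (- v' z)) by [].
apply: (@C1_is_diff _ u u' (fun w => - v' w)) => //.
- by apply: filterS nU => w /h [[]].
- by apply: filterS nU => w /h [[]].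
- exact: continuousN.
Qed.

Definition circle_pt (w : C) (r t : R) : C := w + (r * cos t, r * sin t).

Lemma continuous_circle_pt (T : topologicalType) (w : T -> C) (r t : T -> R) x :
  {for x, continuous w} -> {for x, continuous r} -> {for x, continuous t} ->
  {for x, continuous (fun y => circle_pt (w y) (r y) (t y))}.
Proof.
move=> cw cr ct; apply: continuousD => //.
apply: continuous_pairing; apply: continuousM => //.
  exact: (continuous_comp ct (@continuous_cos R _)).
exact: (continuous_comp ct (@continuous_sin R _)).
Qed.

Lemma ball_circle_pt w (e r t : R) : `|r| < e -> ball w e (circle_pt w r t).
Proof.
move=> re; split; rewrite -ball_normE /ball_ /= opprD addrA subrr add0r normrN normrM.
  by apply: le_lt_trans re; rewrite ler_piMr// ler_norml cos_geN1 cos_le1.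
by apply: le_lt_trans re; rewrite ler_piMr// ler_norml sin_geN1 sin_le1.
Qed.

(** The right side is the real part of e^{it} F', where F' = u' + i v'. *)
Lemma is_derive_radius U u v u' v' w (r t : R) : open U -> holo U u v u' v' ->
  U (circle_pt w r t) ->
  is_derive r 1 (fun r => u (circle_pt w r t))
    (cos t * u' (circle_pt w r t) - sin t * v' (circle_pt w r t)).
Proof.
move=> oU h Uz; rewrite -mulrN.
have nU : \forall z \near circle_pt w r t, U z by exact: open_nbhs_nbhs.
have [_ [c1 c2]] := h _ Uz.
apply: (@is_derive_curve _ u u' (fun z => - v' z) (fun r => w.1 + r * cos t) (fun r => w.2 + r * sin t)).
- by apply: filterS nU => z /h [[]].
- by apply: filterS nU => z /h [[]].
- exact: c1.
- exact: continuousN c2.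
- by apply: is_derive_eq; rewrite !scalE; ring.
- by apply: is_derive_eq; rewrite !scalE; ring.
Qed.

(** The right side is the real part of i r e^{it} F'. *)
Lemma is_derive_angle U u v u' v' w (r t : R) : open U -> holo U u v u' v' ->
  U (circle_pt w r t) ->
  is_derive t 1 (fun t => u (circle_pt w r t))
    (- (r * sin t) * u' (circle_pt w r t) - (r * cos t) * v' (circle_pt w r t)).
Proof.
move=> oU h Uz; rewrite -[- (r * cos t * _)]mulrN.
have nU : \forall z \near circle_pt w r t, U z by exact: open_nbhs_nbhs.
have [_ [c1 c2]] := h _ Uz.
apply: (@is_derive_curve _ u u' (fun z => - v' z) (fun t => w.1 + r * cos t) (fun t => w.2 + r * sin t)).
- by apply: filterS nU => z /h [[]].
- by apply: filterS nU => z /h [[]].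
- exact: c1.
- exact: continuousN c2.
- by apply: is_derive_eq; rewrite !scalE; ring.
- by apply: is_derive_eq; rewrite !scalE; ring.
Qed.

(* Let Phi(s) be the integral over the circle of radius s and M(s) that of u'.  Then
   Phi' = M by Cauchy-Riemann, and Phi(s) = s M(s) by integrating d/dt (u sin t - v cos t).
   So M is constant, equal to M(0). *)
Lemma cauchy_circle U u v u' v' w (e r : R) : open U -> holo U u v u' v' ->
  (forall z, ball w e z -> U z) -> 0 < r < e ->
  \int[mu]_(t in `[0, pi *+ 2])
     (u (circle_pt w r t) * cos t + v (circle_pt w r t) * sin t) =
  (pi *+ 2 * r) * u' w.
Proof.
move=> oU h wU /andP[r0 re].
have h' := holo_conj h.
have pi2 : 0 < pi *+ 2 :> R by rewrite pmulrn_lgt0// pi_gt0.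
pose P (s t : R) := u (circle_pt w s t) * cos t + v (circle_pt w s t) * sin t.
pose Phi (s : R) := \int[mu]_(t in `[0, pi *+ 2]) P s t.
pose M (s : R) := \int[mu]_(t in `[0, pi *+ 2]) u' (circle_pt w s t).
have US (s t : R) : `|s| < e -> U (circle_pt w s t) by move=> /ball_circle_pt/wU.
have cc (s t : R) : {for (s, t), continuous (fun p : R * R => circle_pt w p.1 p.2)}.
  by apply: continuous_circle_pt; [exact: cvg_cst|exact: cvg_fst|exact: cvg_snd].
have cf (f : C -> R) (s t : R) : (forall z, U z -> {for z, continuous f}) -> `|s| < e ->
    {for (s, t), continuous (fun p : R * R => f (circle_pt w p.1 p.2))}.
  by move=> cf se; apply: (continuous_comp (cc s t)); apply: cf; exact: US.
have cu := cf _ _ _ (fun z => @holo_continuous _ _ _ _ _ z oU h).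
have cv := cf _ _ _ (fun z => @holo_continuous _ _ _ _ _ z oU h').
have cu' := cf _ _ _ (fun z Uz => (h z Uz).2.1).
have ccos (s t : R) : {for (s, t), continuous (fun p : R * R => cos p.2)}.
  by apply: continuous_comp; [exact: cvg_snd|exact: continuous_cos].
have csin (s t : R) : {for (s, t), continuous (fun p : R * R => sin p.2)}.
  by apply: continuous_comp; [exact: cvg_snd|exact: continuous_sin].
have cP (s t : R) : `|s| < e -> {for (s, t), continuous (fun p : R * R => P p.1 p.2)}.
  by move=> se; apply: continuousD; apply: continuousM; [exact: cu|exact: ccos|exact: cv|exact: csin].
have near_e (s : R) : `|s| < e -> \forall x \near s, `|x| < e.
  move=> se; near=> x.
  rewrite -(subrK s x) (le_lt_trans (ler_normD _ _))//.
  rewrite -ltrBrDr distrC; near: x; apply: cvgr_dist_lt => //.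
  by rewrite subr_gt0.
have dPhi (s : R) : `|s| < e -> is_derive s 1 Phi (M s).
  move=> /near_e se; apply: (@is_derive_param_integral1 _ P (fun s t => u' (circle_pt w s t))).
  apply: filterS se => x xe t _; split; [exact: cP|exact: cu'|].
  have du := is_derive_radius oU h (US x t xe).
  have dv := is_derive_radius oU h' (US x t xe).
  rewrite /P; apply: is_derive_eq.
  by rewrite !scalE oppfE -[RHS]mul1r -(cos2Dsin2 t); ring.
have rM (s : R) : `|s| < e -> Phi s = s * M s.
  move=> se.
  have iP : mu.-integrable `[0, pi *+ 2] (EFin \o P s).
    by apply: integrable_continuous => t _; apply: (continuous_section (cP s t se)).
  have iM : mu.-integrable `[0, pi *+ 2] (EFin \o (fun t => s * u' (circle_pt w s t))).
    apply: integrable_continuous => t _; apply: continuousM; first exact: cvg_cst.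
    exact: (continuous_section (G := fun s t => u' (circle_pt w s t)) (cu' s t se)).
  have iM' : mu.-integrable `[0, pi *+ 2] (EFin \o (fun t => u' (circle_pt w s t))).
    apply: integrable_continuous => t _.
    exact: (continuous_section (G := fun s t => u' (circle_pt w s t)) (cu' s t se)).
  apply/eqP; rewrite -subr_eq0 /M -RintegralZl// -RintegralB//; apply/eqP.
  pose F (t : R) := u (circle_pt w s t) * sin t - v (circle_pt w s t) * cos t.
  have dF (t : R) : is_derive t 1 F (P s t - s * u' (circle_pt w s t)).
    have du := is_derive_angle oU h (US s t se).
    have dv := is_derive_angle oU h' (US s t se).
    rewrite /F; apply: is_derive_eq.
    rewrite !scalE oppfE.
    rewrite -[X in _ = _ - X]mul1r -(cos2Dsin2 t) /P; ring.
  rewrite /Rintegral (@continuous_FTC2 _ _ F)//.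
  - rewrite /F cos2pi sin2pi cos0 sin0 /circle_pt cos2pi sin2pi cos0 sin0.
    by rewrite -EFinB /= subrr.
  - apply: continuous_in_subspaceT => t _.
    apply: continuousB; first by apply: (continuous_section (cP s t se)).
    apply: continuousM; first exact: cvg_cst.
    exact: (continuous_section (G := fun s t => u' (circle_pt w s t)) (cu' s t se)).
  - have cF : continuous F.
      move=> t; apply: differentiable_continuous; apply/derivable1_diffP.
      by have [] := dF t.
    split; first by move=> t _; have [] := dF t.
      by apply: cvg_at_right_filter; exact: cF.
    by apply: cvg_at_left_filter; exact: cF.
  - by move=> t _; rewrite derive1E; have [] := dF t.
have cM (s : R) : `|s| < e -> {for s, continuous M}.
  move=> /near_e se; apply: continuous_param_integral; first exact: ltW.
  by apply: filterS se => x xe t _; exact: cu'.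
have dM (s : R) : 0 < s < e -> is_derive s 1 M 0.
  move=> /andP[s0 se].
  have se' : `|s| < e by rewrite gtr0_norm.
  have s_neq0 : s != 0 by rewrite gt_eqF.
  have dP := dPhi s se'.
  have dI : is_derive s 1 (fun x : R => x^-1) (- s ^- 2 *: 1) by exact: is_deriveV.
  (* [M] is not known to be differentiable, but near [s] it equals Phi(x)/x, whose derivative M/s -
     Phi/s^2 vanishes since Phi(s) = s M(s). *)
  have : is_derive s 1 (fun x : R => Phi x * x^-1) 0.
    apply: is_derive_eq; rewrite !scalE rM//.
    by field.
  apply: near_eq_is_derive.
  have : \forall x \near s, x \in `]0, e[ by apply: near_in_itvoo; rewrite in_itv/= s0.
  apply: filterS => x; rewrite in_itv/= => /andP[x0 xe].
  by rewrite rM ?gtr0_norm// mulrAC divff ?mul1r// gt_eqF.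
rewrite -/(Phi r) rM ?gtr0_norm//.
have -> : M r = M 0.
  have [| |c _] := @MVT _ M (fun=> 0) 0 r r0.
  - by move=> x; rewrite in_itv/= => /andP[x0 xr]; apply: dM; rewrite x0 (lt_trans xr).
  - apply: continuous_in_subspaceT => x /set_mem /=; rewrite in_itv/= => /andP[x0 xr].
    by apply: cM; rewrite ger0_norm// (le_lt_trans xr).
  by rewrite mul0r => /eqP; rewrite subr_eq0 => /eqP.
have -> : M 0 = \int[mu]_(t in `[0, pi *+ 2]) cst (u' w) t.
  by apply: eq_Rintegral => t _; rewrite /circle_pt !mul0r addr0.
rewrite Rintegral_cst//.
have -> : fine (mu `[0, pi *+ 2]%classic) = pi *+ 2.
  by rewrite lebesgue_measure_itv /= lte_fin pi2 -EFinB subr0.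
by move: (pi *+ 2) => x; ring.
Unshelve. all: by end_near. Qed.

End CauchyRiemann.

(** * Derivatives of holomorphic functions are again C^1 *)

Section HoloSmooth.
Context {R : realType}.
Local Notation C := (R * R)%type.
Local Notation mu := (@lebesgue_measure R).

Lemma near_eq_continuous (T V : topologicalType) (f g : T -> V) x :
  (\near x, g x = f x) -> {for x, continuous f} -> {for x, continuous g}.
Proof.
move=> e cf; rewrite /prop_for /continuous_at (nbhs_singleton e).
by apply: cvg_trans cf; apply: near_eq_cvg; apply: filterS e => y ->.
Qed.

Lemma is_derive_translate (V W : normedModType R) (f : V -> W) (w c v : V) df :
  is_derive (w + c) v f df -> is_derive w v (fun y => f (y + c)) df.
Proof.
have E : (fun h : R => h^-1 *: ((f \o shift (w + c)) (h *: v) - f (w + c)))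
  = (fun h => h^-1 *: (((fun y => f (y + c)) \o shift w) (h *: v) - f (w + c))).
  by apply/funext => h /=; rewrite addrA.
by move=> -[dr <-]; apply: DeriveDef; rewrite /derivable /derive -?E.
Qed.

Lemma holo_local (U : set C) (u v u' v' : C -> R) z0 : open U -> holo U u v u' v' -> U z0 ->
  exists u'' v'', \forall w \near z0,
  [/\ is_derive (w : C) (1, 0) u' (u'' w), is_derive (w : C) (0, 1) u' (- v'' w),
      is_derive (w : C) (1, 0) v' (v'' w) & is_derive (w : C) (0, 1) v' (u'' w)] /\
  ({for w, continuous u''} /\ {for w, continuous v''}).
Proof.
move=> oU h Uz0.
have [e e0 eU] : exists2 e : R, 0 < e & ball z0 e `<=` U.
  by have /nbhs_ballP[e e0 eU] := open_nbhs_nbhs (conj oU Uz0); exists e.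
(* Centres [w] within 2r of [z0] have their balls of radius 2r inside the ball of radius 4r = e; the
   circles of integration have radius r. *)
pose r : R := e / 4.
have r0 : 0 < r by rewrite divr_gt0.
have er : e = r + r + (r + r) by rewrite /r; field.
have wU w : ball z0 (r + r) w -> forall z, ball w (r + r) z -> U z.
  by move=> zw z wz; apply: eU; rewrite er; exact: ball_triangle zw wz.
have pi2 : 0 < pi *+ 2 :> R by rewrite pmulrn_lgt0// pi_gt0.
have rr : 0 < r < r + r by rewrite r0 ltrDl.
pose k : R := (pi *+ 2 * r)^-1.
have k0 : pi *+ 2 * r != 0 by rewrite mulf_neq0// gt_eqF.
(* The real part of the mean of (f + ig) e^{-it}/r over the circle. Cauchy's formula reads u' = S u
   v and, after multiplication by -i, v' = S v (-u). *)
pose S (f g : C -> R) w := k * \int[mu]_(t in `[0, pi *+ 2])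
     (f (circle_pt w r t) * cos t + g (circle_pt w r t) * sin t).
have nB : \forall w \near z0, ball z0 (r + r) w.
  by apply: nbhsx_ballx; rewrite addr_gt0.
have oB : open (ball z0 (r + r)) by apply: ball_open; rewrite addr_gt0.
have h' := holo_conj h.
have uS w : ball z0 (r + r) w -> u' w = S u v w.
  by move=> /wU Bw; rewrite /S (cauchy_circle oU h Bw rr) /k mulKf.
have vS w : ball z0 (r + r) w -> v' w = S v (- u) w.
  by move=> /wU Bw; rewrite /S (cauchy_circle oU h' Bw rr) /k mulKf.
pose cU f := forall z, U z -> {for z, continuous (f : C -> R)}.
have cG f g : cU f -> cU g -> forall w (t : R), ball z0 (r + r) w -> {for (w, t),
    continuous (fun p : C * R => f (circle_pt p.1 r p.2) * cos p.2 + g (circle_pt p.1 r p.2) * sin p.2)}.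
  move=> cf cg w t Bw.
  have cc : {for (w, t), continuous (fun p : C * R => circle_pt p.1 r p.2)}.
    by apply: continuous_circle_pt; [exact: cvg_fst|exact: cvg_cst|exact: cvg_snd].
  have Uc : U (circle_pt w r t).
    by apply: (wU _ Bw); apply: ball_circle_pt; rewrite gtr0_norm ?ltrDl.
  apply: continuousD; apply: continuousM.
  - exact: (continuous_comp cc (cf _ Uc)).
  - by apply: continuous_comp; [exact: cvg_snd|exact: continuous_cos].
  - exact: (continuous_comp cc (cg _ Uc)).
  - by apply: continuous_comp; [exact: cvg_snd|exact: continuous_sin].
have cS f g : cU f -> cU g -> forall w, ball z0 (r + r) w -> {for w, continuous (S f g)}.
  move=> cf cg w Bw; apply: continuousM; first exact: cvg_cst.
  apply: (@continuous_param_integral _ C (fun w t => f (circle_pt w r t) * cos t + g (circle_pt w r t) * sin t)).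
    exact: ltW.
  have : \forall z \near w, ball z0 (r + r) z by exact: open_nbhs_nbhs.
  by apply: filterS => z Bz t _; exact: cG.
have dS d f g f1 g1 : cU f -> cU g -> cU f1 -> cU g1 ->
    (forall z, U z -> is_derive (z : C) d f (f1 z)) ->
    (forall z, U z -> is_derive (z : C) d g (g1 z)) ->
    forall w, ball z0 (r + r) w -> is_derive (w : C) d (S f g) (S f1 g1 w).
  move=> cf cg cf1 cg1 df dg w Bw.
  apply: is_deriveZ.
  apply: (@is_derive_param_integral _ _
    (fun w t => f (circle_pt w r t) * cos t + g (circle_pt w r t) * sin t)
    (fun w t => f1 (circle_pt w r t) * cos t + g1 (circle_pt w r t) * sin t)).
  have : \forall z \near w, ball z0 (r + r) z by exact: open_nbhs_nbhs.
  apply: filterS => z Bz t _; split; [exact: cG|exact: cG|].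
  have Uc : U (circle_pt z r t).
    by apply: (wU _ Bz); apply: ball_circle_pt; rewrite gtr0_norm ?ltrDl.
  have d1 := is_derive_translate (df _ Uc).
  have d2 := is_derive_translate (dg _ Uc).
  by rewrite /circle_pt; apply: is_derive_eq; rewrite !scalE; ring.
have cu : cU u by move=> z; exact: holo_continuous oU h.
have cv : cU v by move=> z; exact: holo_continuous oU h'.
have cu' : cU u' by move=> z /h[_ []].
have cv' : cU v' by move=> z /h[_ []].
have cN f : cU f -> cU (- f) by move=> cf z Uz; exact: continuousN (cf z Uz).
have SN f g : cU f -> cU g -> forall w, ball z0 (r + r) w -> S (- f) (- g) w = - S f g w.
  move=> cf cg w Bw; rewrite /S -mulrN; congr (k * _).
  rewrite -[RHS]mulN1r -RintegralZl//; last first.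
    by apply: integrable_continuous => t _;
      exact: (continuous_section (G := fun w t => f (circle_pt w r t) * cos t + g (circle_pt w r t) * sin t) (cG f g cf cg w t Bw)).
  by apply: eq_Rintegral => t _; rewrite !oppfE; ring.
(* Differentiating under the integral replaces (u, v) by (u', v') for d/dalpha and by (-v', u') for
   d/dbeta, so the second derivative is the same mean applied to F'. *)
exists (S u' v'), (S v' (- u')).
have : \forall w \near z0, \forall z \near w, ball z0 (r + r) z.
  by apply: filterS nB => w Bw; exact: open_nbhs_nbhs.
apply: filterS => w nw; have Bw := nbhs_singleton nw.
have eu : \near w, S u v w = u' w by apply: filterS nw => z /uS ->.
have ev : \near w, S v (- u) w = v' w by apply: filterS nw => z /vS ->.
have d1 z (Uz : U z) : is_derive z (1, 0) u (u' z) by have [[]] := h z Uz.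
have d2 z (Uz : U z) : is_derive z (0, 1) u ((- v') z) by have [[]] := h z Uz.
have d3 z (Uz : U z) : is_derive z (1, 0) v (v' z) by have [[]] := h z Uz.
have d4 z (Uz : U z) : is_derive z (0, 1) v (u' z) by have [[]] := h z Uz.
have d5 z (Uz : U z) : is_derive z (1, 0) (- u) ((- u') z) by have [[]] := h' z Uz.
have d6 z (Uz : U z) : is_derive z (0, 1) (- u) (v' z) by have [[]] := h' z Uz.
split; first split.
- exact: (near_eq_is_derive eu (dS _ _ _ _ _ cu cv cu' cv' d1 d3 w Bw)).
- apply: (near_eq_is_derive eu); rewrite -(SN _ _ cv' (cN _ cu') w Bw) opprK.
  exact: (dS _ _ _ _ _ cu cv (cN _ cv') cu' d2 d4 w Bw).
- exact: (near_eq_is_derive ev (dS _ _ _ _ _ cv (cN _ cu) cv' (cN _ cu') d3 d5 w Bw)).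
- exact: (near_eq_is_derive ev (dS _ _ _ _ _ cv (cN _ cu) cu' cv' d4 d6 w Bw)).
split; first exact: (cS _ _ cu' cv' w Bw).
exact: (cS _ _ cv' (cN _ cu') w Bw).
Qed.

(** Replaces the locally found second derivatives by functions defined everywhere, so that the
    result can be iterated. *)
Lemma holo_derive (U : set C) (u v u' v' : C -> R) : open U -> holo U u v u' v' ->
  holo U u' v' ('D_((1, 0) : C) u') ('D_((1, 0) : C) v').
Proof.
move=> oU h z Uz.
have [u'' [v'' near_h]] := holo_local oU h Uz.
have [[[a1 a2] [b1 b2] [c1 c2] [d1 d2]] [k1 k2]] := nbhs_singleton near_h.
split; first by rewrite a2 c2; split.
split; [move: k1|move: k2]; apply: near_eq_continuous.
  by apply: filterS near_h => w [[[]]].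
by apply: filterS near_h => w [[_ _ []]].
Qed.

End HoloSmooth.

(** * Derivatives and continuity of quaternion-valued maps, by coordinates *)

Section QuaternionCalculus.
Context {R : realType}.
Local Notation H := (quat R).

Lemma qmul_coord0 (x y : H) :
  (x * y) 0 0 = x 0 0 * y 0 0 - x 0 1 * y 0 1 - x 0 2 * y 0 2 - x 0 3 * y 0 3.
Proof. by rewrite quatME /qmul mkquatE. Qed.

Lemma qmul_coord1 (x y : H) :
  (x * y) 0 1 = x 0 0 * y 0 1 + x 0 1 * y 0 0 + x 0 2 * y 0 3 - x 0 3 * y 0 2.
Proof. by rewrite quatME /qmul mkquatE. Qed.

Lemma qmul_coord2 (x y : H) :
  (x * y) 0 2 = x 0 0 * y 0 2 - x 0 1 * y 0 3 + x 0 2 * y 0 0 + x 0 3 * y 0 1.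
Proof. by rewrite quatME /qmul mkquatE. Qed.

Lemma qmul_coord3 (x y : H) :
  (x * y) 0 3 = x 0 0 * y 0 3 + x 0 1 * y 0 2 - x 0 2 * y 0 1 + x 0 3 * y 0 0.
Proof. by rewrite quatME /qmul mkquatE. Qed.

Lemma qone_coord (k : 'I_4) : (1 : H) 0 k = (k == 0)%:R.
Proof.
rewrite quat1E; move: k.
have h : forall k : 'I_4, k \in [:: 0; 1; 2; 3 : 'I_4] by case=> [[|[|[|[|k]]]] //].
by move=> k; have := h k; rewrite !inE => /or4P[] /eqP->; rewrite mkquatE.
Qed.

Definition qmulE := (qmul_coord0, qmul_coord1, qmul_coord2, qmul_coord3).
Definition qE := (@quatDE R, @quatNE R, @quatZE R, @quat0E R, qone_coord, qmulE).

Lemma qbasisE (n k : 'I_4) : qbasis n 0 k = (k == n)%:R :> R.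
Proof. by rewrite mxE eqxx. Qed.

Lemma ord4P (P : 'I_4 -> Prop) : P 0 -> P 1 -> P 2 -> P 3 -> forall k, P k.
Proof.
move=> p0 p1 p2 p3 k.
have : k \in [:: 0; 1; 2; 3 : 'I_4] by case: k => [[|[|[|[|k]]]] //].
by rewrite !inE => /or4P[] /eqP->.
Qed.

Lemma sum_imag (V : nmodType) (F : 'I_4 -> V) :
  \sum_(n < 4 | n != 0) F n = F 1 + F 2 + F 3.
Proof.
rewrite big_mkcond !big_ord_recr big_ord0 /= !add0r.
by congr (F _ + F _ + F _); apply: val_inj.
Qed.

Lemma sum_quat (V : nmodType) (F : 'I_4 -> V) :
  \sum_(n < 4) F n = F 0 + \sum_(n < 4 | n != 0) F n.
Proof. by rewrite (bigD1 0). Qed.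

Section OneMap.
Variable V : normedModType R.
Implicit Types (f g : V -> H) (c : V -> R) (x v : V).

Lemma is_derive_coordP f x v (df : H) :
  is_derive x v f df <-> forall k, is_derive x v (fun y => f y 0 k) (df 0 k).
Proof.
split=> [[dr <-] k|h].
  have dk := (derivable_mxP f x v).1 dr 0 k.
  apply: DeriveDef => //.
  by rewrite (derive_mx dr) mxE.
have dr : derivable f x v.
  by apply/derivable_mxP => i k; rewrite ord1; have [] := h k.
apply: DeriveDef => //.
apply/rowP => k; have [_ <-] := h k.
by rewrite (derive_mx dr) mxE.
Qed.

Lemma is_derive_qmul f g x v df dg :
  is_derive x v f df -> is_derive x v g dg ->
  is_derive x v (fun y => f y * g y) (df * g x + f x * dg).
Proof.
move=> /is_derive_coordP hf /is_derive_coordP hg; apply/is_derive_coordP.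
have [[[f0 f1] f2] f3] := (hf 0, hf 1, hf 2, hf 3).
have [[[g0 g1] g2] g3] := (hg 0, hg 1, hg 2, hg 3).
apply: ord4P.
- rewrite (_ : (fun y => _) = (fun y => f y 0 0 * g y 0 0 - f y 0 1 * g y 0 1
    - f y 0 2 * g y 0 2 - f y 0 3 * g y 0 3)); last by apply/funext => y; rewrite qE.
  by apply: is_derive_eq; rewrite !qE !scalE; ring.
- rewrite (_ : (fun y => _) = (fun y => f y 0 0 * g y 0 1 + f y 0 1 * g y 0 0
    + f y 0 2 * g y 0 3 - f y 0 3 * g y 0 2)); last by apply/funext => y; rewrite qE.
  by apply: is_derive_eq; rewrite !qE !scalE; ring.
- rewrite (_ : (fun y => _) = (fun y => f y 0 0 * g y 0 2 - f y 0 1 * g y 0 3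
    + f y 0 2 * g y 0 0 + f y 0 3 * g y 0 1)); last by apply/funext => y; rewrite qE.
  by apply: is_derive_eq; rewrite !qE !scalE; ring.
- rewrite (_ : (fun y => _) = (fun y => f y 0 0 * g y 0 3 + f y 0 1 * g y 0 2
    - f y 0 2 * g y 0 1 + f y 0 3 * g y 0 0)); last by apply/funext => y; rewrite qE.
  by apply: is_derive_eq; rewrite !qE !scalE; ring.
Qed.

Lemma is_derive_qscale c f x v dc df :
  is_derive x v c dc -> is_derive x v f df ->
  is_derive x v (fun y => c y *: f y) (dc *: f x + c x *: df).
Proof.
move=> hc /is_derive_coordP hf; apply/is_derive_coordP => k.
have fk := hf k.
rewrite (_ : (fun y => _) = (fun y => c y * f y 0 k)); last by apply/funext => y; rewrite qE.
by apply: is_derive_eq; rewrite !qE !scalE; ring.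
Qed.

Lemma continuous_coordP (T : topologicalType) (f : T -> H) (x : T) :
  {for x, continuous f} <-> forall k, {for x, continuous (fun y => f y 0 k)}.
Proof.
split=> [cf k|h].
  exact: (continuous_comp cf (@coord_continuous _ _ _ 0 k _)).
apply/cvgrPdist_le => e e0.
near=> y; rewrite /Num.Def.normr/= mx_normrE (bigmax_le _ (ltW e0))//= => -[i k] _.
rewrite !mxE/= ord1; move: k; near: y; apply: filter_forall => k.
by have /cvgrPdist_le/(_ _ e0) := h k.
Unshelve. all: by end_near. Qed.

Lemma continuous_qmulr (T : topologicalType) (f : T -> H) (q : H) (x : T) :
  {for x, continuous f} -> {for x, continuous (fun y => f y * q)}.
Proof.
move=> /continuous_coordP h; apply/continuous_coordP.
have cm k (c : R) : {for x, continuous (fun y => f y 0 k * c)}.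
  exact: (continuousM (h k) (cvg_cst c)).
apply: ord4P.
- rewrite (_ : (fun y => _) = (fun y => f y 0 0 * q 0 0 - f y 0 1 * q 0 1
    - f y 0 2 * q 0 2 - f y 0 3 * q 0 3)); last by apply/funext => y; rewrite qE.
  exact: (continuousB (continuousB (continuousB (cm _ _) (cm _ _)) (cm _ _)) (cm _ _)).
- rewrite (_ : (fun y => _) = (fun y => f y 0 0 * q 0 1 + f y 0 1 * q 0 0
    + f y 0 2 * q 0 3 - f y 0 3 * q 0 2)); last by apply/funext => y; rewrite qE.
  exact: (continuousB (continuousD (continuousD (cm _ _) (cm _ _)) (cm _ _)) (cm _ _)).
- rewrite (_ : (fun y => _) = (fun y => f y 0 0 * q 0 2 - f y 0 1 * q 0 3
    + f y 0 2 * q 0 0 + f y 0 3 * q 0 1)); last by apply/funext => y; rewrite qE.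
  exact: (continuousD (continuousD (continuousB (cm _ _) (cm _ _)) (cm _ _)) (cm _ _)).
- rewrite (_ : (fun y => _) = (fun y => f y 0 0 * q 0 3 + f y 0 1 * q 0 2
    - f y 0 2 * q 0 1 + f y 0 3 * q 0 0)); last by apply/funext => y; rewrite qE.
  exact: (continuousD (continuousB (continuousD (cm _ _) (cm _ _)) (cm _ _)) (cm _ _)).
Qed.

End OneMap.

Lemma is_derive_pairP (V W1 W2 : normedModType R) (F : V -> W1 * W2) x v dF :
  is_derive x v F dF <->
  is_derive x v (fun y => (F y).1) dF.1 /\ is_derive x v (fun y => (F y).2) dF.2.
Proof.
pose q (G : V -> W1 * W2) := fun h : R => h^-1 *: ((G \o shift x) (h *: v) - G x).
split=> [[/cvg_ex [l cl] dE]|[[/cvg_ex [l1 cl1] dE1] [/cvg_ex [l2 cl2] dE2]]].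
  have lE : l = dF by rewrite -dE; apply/esym/cvg_lim.
  rewrite -{}lE {dE dF}.
  have c1 : (q F h).1 @[h --> 0^'] --> l.1 by apply: (cvg_comp _ _ cl); exact: cvg_fst.
  have c2 : (q F h).2 @[h --> 0^'] --> l.2 by apply: (cvg_comp _ _ cl); exact: cvg_snd.
  split; apply: DeriveDef.
  - by apply/cvg_ex; exists l.1.
  - exact: cvg_lim c1.
  - by apply/cvg_ex; exists l.2.
  - exact: cvg_lim c2.
have lE1 : l1 = dF.1 by rewrite -dE1; apply/esym/cvg_lim.
have lE2 : l2 = dF.2 by rewrite -dE2; apply/esym/cvg_lim.
have := cvg_pair cl1 cl2; rewrite lE1 lE2 => c.
have cc : (h^-1 *: ((F \o shift x) (h *: v) - F x)) @[h --> 0^'] --> dF.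
  by case: dF c {dE1 dE2 lE1 lE2} => a b c; exact: c.
apply: DeriveDef; first by apply/cvg_ex; exists dF.
exact: cvg_lim cc.
Qed.

End QuaternionCalculus.

(** * Polar representation of quaternions and symmetry of stems *)

Section SliceGeometry.
Context {R : realType}.
Local Notation H := (quat R).
Local Notation C := (R * R)%type.
Implicit Types (D : set C) (F A B : C -> H * H) (f : H -> H) (x : H) (z : C).

Definition imq x : H := x - (x 0 0)%:A.
Definition imnorm x : R := Num.sqrt (qnorm2 (imq x)).
Definition pol x : C := (x 0 0, imnorm x).

Lemma imq0 x : imq x 0 0 = 0.
Proof. by rewrite !qE mulr1 subrr. Qed.

Lemma imqE x (n : 'I_4) : n != 0 -> imq x 0 n = x 0 n.
Proof. by move=> n0; rewrite !qE (negbTE n0) mulr0 subr0. Qed.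

Lemma qnorm2_imq x : qnorm2 (imq x) = x 0 1 ^+ 2 + x 0 2 ^+ 2 + x 0 3 ^+ 2.
Proof. by rewrite qnorm2E imq0 !imqE// expr0n add0r. Qed.

Lemma qnorm2_imq_ge0 x : 0 <= qnorm2 (imq x).
Proof. by rewrite qnorm2_imq !addr_ge0 ?sqr_ge0. Qed.

Lemma imnorm_sqr x : imnorm x ^+ 2 = qnorm2 (imq x).
Proof. by rewrite sqr_sqrtr ?qnorm2_imq_ge0. Qed.

Lemma imnorm_eq0 x : imnorm x = 0 -> imq x = 0.
Proof.
move=> r0; apply/eqP/negP => /negP/qnorm2_neq0.
by rewrite -imnorm_sqr r0 expr0n eqxx.
Qed.

Lemma imag_unitsI (J : H) : J 0 0 = 0 -> qnorm2 J = 1 -> imag_units J.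
Proof.
rewrite qnorm2E => J0; rewrite J0 expr0n add0r => J1.
apply: quatP; rewrite !qE J0 -?J1 /=; ring.
Qed.

Lemma imag_unit_neq0 (J : H) : imag_units J -> J != 0.
Proof.
by move=> /imag_unitsP[_ J1]; apply/eqP => J0;
  move: J1; rewrite J0 qnorm2E !qE expr0n !addr0 => /eqP; rewrite eq_sym oner_eq0.
Qed.

Lemma imag_units_qbasis (n : 'I_4) : n != 0 -> imag_units (qbasis n : H).
Proof.
move=> n0; apply: imag_unitsI.
  by rewrite qbasisE eq_sym (negbTE n0).
by rewrite qnorm2E !qbasisE; elim/ord4P: n n0 => //= _; ring.
Qed.

Lemma imag_units_opp (J : H) : imag_units J -> imag_units (- J).
Proof. by rewrite /imag_units /= mulrNN. Qed.

(** The unit J of x. At a real x it is 0, as 0^-1 = 0, which agrees with the convention of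
    [slice_fun]. *)
Definition dirq x : H := (imnorm x)^-1 *: imq x.

Lemma imag_units_dirq x : imnorm x != 0 -> imag_units (dirq x).
Proof.
move=> r0; apply: imag_unitsI; first by rewrite qE imq0 mulr0.
by rewrite qnorm2Z -imnorm_sqr exprVn mulVf// expf_neq0.
Qed.

Lemma dirqE x : imnorm x != 0 -> dirq x * (imnorm x)%:A = imq x.
Proof. by move=> r0; rewrite -scalerAr mulr1 scalerA divff// scale1r. Qed.

Lemma polar_decomp x : exists2 J, imag_units J & x = (x 0 0)%:A + J * (imnorm x)%:A.
Proof.
have [r0|r0] := eqVneq (imnorm x) 0.
  exists (qbasis 1); first exact: imag_units_qbasis.
  by rewrite r0 scale0r mulr0 addr0; apply/eqP; rewrite -subr_eq0 -/(imq x) imnorm_eq0.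
exists (dirq x); first exact: imag_units_dirq.
by rewrite dirqE// addrC subrK.
Qed.

Lemma pol_polar (a b : R) (J : H) : imag_units J -> pol (a%:A + J * b%:A) = (a, `|b|).
Proof.
move=> /imag_unitsP[J0 J1]; rewrite -scalerAr mulr1 /pol /imnorm /imq.
have -> : (a%:A + b *: J) 0 0 = a by rewrite !qE J0 /=; ring.
by rewrite addrAC subrr add0r qnorm2Z J1 mulr1 sqrtr_sqr.
Qed.

Definition conj_closed D := forall z, D z -> D (conjC z).

Lemma circularizationP D x : conj_closed D -> circularization D x <-> D (pol x).
Proof.
move=> cD; split=> [[a [b [J [Dab uJ ->]]]]|Dx].
  rewrite pol_polar//; have [b0|b0] := leP 0 b; first by rewrite ger0_norm.
  by rewrite ltr0_norm//; exact: cD Dab.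
have [J uJ xE] := polar_decomp x.
by exists (x 0 0), (imnorm x), J.
Qed.

Lemma slice_fun_pol F x : slice_fun F x = (F (pol x)).1 + dirq x * (F (pol x)).2.
Proof. by []. Qed.

Lemma induces_slice_fun D F f x : stem D F -> induces D F f ->
  circularization D x -> f x = slice_fun F x.
Proof.
move=> sF iF [a [b [J [Dab uJ ->]]]].
by rewrite iF// (slice_funE sF).
Qed.

(** The values F_1 + J F_2 and F_1 - J F_2 at J and -J determine both components. *)
Lemma stem_unique D F G f : conj_closed D -> stem D F -> stem D G ->
  induces D F f -> induces D G f -> forall z, D z -> F z = G z.
Proof.
move=> cD sF sG iF iG [a b] Dz.
have [J uJ] : exists J : H, imag_units J by exists (qbasis 1); exact: imag_units_qbasis.
have e1 := iF a b J Dz uJ; rewrite (iG a b J Dz uJ) in e1.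
have e2 := iF a b (- J) Dz (imag_units_opp uJ).
rewrite (iG a b (- J) Dz (imag_units_opp uJ)) !mulNr in e2.
have E1 : (F (a, b)).1 = (G (a, b)).1.
  apply: (@scalerI _ _ (2 : R)); rewrite ?pnatr_eq0//.
  rewrite !scaler_nat !mulr2n -[X in X + _ = _](addrK (J * (F (a, b)).2)) -e1.
  rewrite -addrA [- _ + _]addrC -e2 addrACA subrr addr0 //.
have E2 : (F (a, b)).2 = (G (a, b)).2.
  move: e1; rewrite E1 => /addrI /(congr1 (fun y => - J * y)).
  by rewrite !mulrA mulNr uJ opprK !mul1r.
by case: (F _) (G _) E1 E2 => ? ? [? ?] /= -> ->.
Qed.

Lemma stem_real D F (a : R) : stem D F -> D (a, 0) -> (F (a, 0)).2 = 0.
Proof.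
move=> sF /sF; rewrite /conjC /= oppr0 => /(congr1 snd)/= /eqP.
by rewrite -subr_eq0 opprK -mulr2n -scaler_nat scaler_eq0 pnatr_eq0 /= => /eqP.
Qed.

Lemma is_derive_conjHC z v F dF : is_derive z v F dF ->
  is_derive z v (fun z => conjHC (F z)) (conjHC dF).
Proof.
by move=> /is_derive_pairP[h1 h2]; apply/is_derive_pairP; split => //; exact: is_deriveN.
Qed.

Lemma is_derive_iotaM z v F dF : is_derive z v F dF ->
  is_derive z v (fun z => iotaM (F z)) (iotaM dF).
Proof.
by move=> /is_derive_pairP[h1 h2]; apply/is_derive_pairP; split => //; exact: is_deriveN.
Qed.

Lemma near_stem D F z : open D -> stem D F -> D z ->
  \forall w \near z, F (conjC w) = conjHC (F w).
Proof.
move=> oD sF Dz; have : \forall w \near z, D w by exact: open_nbhs_nbhs.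
by apply: filterS.
Qed.

Lemma stem_alpha D F A : open D -> conj_closed D -> stem D F ->
  (forall z, D z -> is_derive z (1, 0) F (A z)) -> stem D A.
Proof.
move=> oD cD sF dF z Dz.
apply: (@is_derive_unique _ _ _ (fun w => F (conjC w)) z (1, 0)).
  apply/is_derive_line0; have /is_derive_line0 := dF _ (cD _ Dz).
  congr is_derive; apply/funext => t; congr F; congr pair => /=.
  by rewrite scaler0 !add0r.
apply: near_eq_is_derive (is_derive_conjHC (dF _ Dz)).
by have := near_stem oD sF Dz; apply: filterS => w ->.
Qed.

(** Conjugation reverses beta, so the chain rule adds a sign to the symmetry of F; consequently the
    first component of dF/dbeta is odd in beta. *)
Lemma stem_beta D F B : open D -> conj_closed D -> stem D F ->
  (forall z, D z -> is_derive z (0, 1) F (B z)) ->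
  forall z, D z -> B (conjC z) = - conjHC (B z).
Proof.
move=> oD cD sF dF z Dz; apply/esym/eqP; rewrite eqr_oppLR; apply/eqP.
apply: (@is_derive_unique _ _ _ (fun w => F (conjC w)) z (0, 1)).
  apply: near_eq_is_derive (is_derive_conjHC (dF _ Dz)).
  by have := near_stem oD sF Dz; apply: filterS => w ->.
apply/is_derive_line0; have /is_derive_line0 d0 := dF _ (cD _ Dz).
have dN := @is_deriveNid R R 0 1.
have d0' : is_derive (- 0 : R) 1 (fun t => F (t *: ((0, 1) : C) + conjC z)) (B (conjC z)).
  by rewrite oppr0.
have := is_derive_comp1 dN d0'; rewrite scaleN1r.
congr is_derive; apply/funext => t /=; congr F; congr pair => /=.
  by rewrite /= !scaler0.
by rewrite /= opprD !scalE mulNr.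
Qed.

Lemma stem_beta_real D F B (a : R) : open D -> conj_closed D -> stem D F ->
  (forall z, D z -> is_derive z (0, 1) F (B z)) -> D (a, 0) -> (B (a, 0)).1 = 0.
Proof.
move=> oD cD sF dF Da; have := stem_beta oD cD sF dF Da.
rewrite /conjC /= oppr0 => /(congr1 fst)/= /eqP.
by rewrite -subr_eq0 opprK -mulr2n -scaler_nat scaler_eq0 pnatr_eq0 /= => /eqP.
Qed.

(** The derivatives are named rather than written [d_alpha F], [d_beta F], so that they can be given
    by closed formulas known only on [D]. *)
Definition stem_C1 D F A B := forall z, D z ->
  [/\ is_derive z (1, 0) F (A z), is_derive z (0, 1) F (B z),
      {for z, continuous A} & {for z, continuous B}].

Lemma C1_on_stem D F : C1_on D F -> stem_C1 D F (d_alpha F) (d_beta F).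
Proof. by move=> h z /h[d1 d2 c1 c2]; split => //; exact: derivableP. Qed.

Lemma stem_C1_eq D F A B G : open D -> stem_C1 D F A B ->
  (forall z, D z -> F z = G z) -> stem_C1 D G A B.
Proof.
move=> oD h E z Dz; have [d1 d2 c1 c2] := h z Dz.
have nD : \forall w \near z, F w = G w.
  have : \forall w \near z, D w by exact: open_nbhs_nbhs.
  by apply: filterS => w /E.
by split => //; apply: near_eq_is_derive nD _.
Qed.

Lemma stem_C1_on D F A B : open D -> stem_C1 D F A B -> C1_on D F.
Proof.
move=> oD h z Dz; have [[d1 e1] [d2 e2] c1 c2] := h z Dz.
have nD : \forall w \near z, D w by exact: open_nbhs_nbhs.
split; [exact: d1|exact: d2| |].
  by apply: near_eq_continuous c1; apply: filterS nD => w /h[[]].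
by apply: near_eq_continuous c2; apply: filterS nD => w /h[_ []].
Qed.

End SliceGeometry.

(** * Partial derivatives and the Laplacian of a + Im(x) b *)

Section AxialDerivatives.
Context {R : realType}.
Local Notation H := (quat R).
Local Notation C := (R * R)%type.
Implicit Types (D : set C) (F A B : C -> H * H) (f : H -> H) (x : H) (z : C).

(** Only the values on the line matter; this allows freezing [x 0 0] when differentiating in an
    imaginary direction. *)
Lemma is_derive_eq_line (V W : normedModType R) (f g : V -> W) (x v : V) (df : W) :
  (forall t : R, f (t *: v + x) = g (t *: v + x)) ->
  is_derive x v f df -> is_derive x v g df.
Proof.
move=> E /is_derive_line0 h; apply/is_derive_line0.
by move: h; congr is_derive; apply/funext => t.
Qed.

Lemma is_derive_coord x (v : H) (k : 'I_4) : is_derive x v (fun y : H => y 0 k) (v 0 k).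
Proof. by move/is_derive_coordP: (@is_derive_id _ H x v). Qed.

Lemma qline_coord (n k : 'I_4) (t : R) x :
  (t *: qbasis n + x : H) 0 k = (if k == n then t else 0) + x 0 k.
Proof. by rewrite !qE qbasisE; case: (k == n); rewrite ?mulr1 ?mulr0. Qed.

Lemma is_derive_imq x (n : 'I_4) : n != 0 -> is_derive x (qbasis n) (@imq R) (qbasis n).
Proof.
move=> n0; apply/is_derive_coordP => k.
have dk := is_derive_coord x (qbasis n) k.
have [->|k0] := eqVneq k 0.
  rewrite qbasisE eq_sym (negbTE n0).
  rewrite (_ : (fun y => _) = cst 0); last by apply/funext => y; rewrite imq0.
  exact: is_derive_cst.
by move: dk; congr is_derive; apply/funext => y; rewrite imqE.
Qed.

Lemma is_derive_imnorm x (n : 'I_4) : n != 0 -> imnorm x != 0 ->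
  is_derive x (qbasis n) (@imnorm R) (x 0 n / imnorm x).
Proof.
move=> n0 r0.
have d1 := is_derive_coord x (qbasis n) 1.
have d2 := is_derive_coord x (qbasis n) 2.
have d3 := is_derive_coord x (qbasis n) 3.
have dq : is_derive x (qbasis n) (fun y : H => qnorm2 (imq y)) (2 * x 0 n).
  rewrite (_ : (fun y => _) = (fun y : H => y 0 1 ^+ 2 + y 0 2 ^+ 2 + y 0 3 ^+ 2)); last first.
    by apply/funext => y; rewrite qnorm2_imq.
  apply: is_derive_eq; rewrite !qbasisE !scalE.
  by elim/ord4P: n n0 {d1 d2 d3} => //= _; ring.
have ds : is_derive (qnorm2 (imq x)) 1 Num.sqrt (2 * Num.sqrt (qnorm2 (imq x)))^-1.
  apply: is_derive1_sqrt; rewrite lt_def qnorm2_imq_ge0 andbT.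
  by rewrite -imnorm_sqr expf_neq0.
have := is_derive_comp1 dq ds.
congr is_derive; rewrite scalE -/(imnorm x).
by rewrite invfM mulrACA mulfV ?mul1r ?pnatr_eq0.
Qed.

Lemma continuous_pol x : {for x, continuous (@pol R)}.
Proof.
apply: continuous_pairing; first exact: coord_continuous.
apply: (@continuous_comp _ _ _ (fun y : H => qnorm2 (imq y)) Num.sqrt); last exact: sqrt_continuous.
rewrite (_ : (fun y => _) = (fun y : H => y 0 1 ^+ 2 + y 0 2 ^+ 2 + y 0 3 ^+ 2)); last first.
  by apply/funext => y; rewrite qnorm2_imq.
have cX (k : 'I_4) : {for x, continuous (fun y : H => y 0 k ^+ 2)}.
  exact: (continuous_comp (@coord_continuous _ _ _ 0 k x) (@exprn_continuous R 2 _)).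
by apply: continuousD; [apply: continuousD|]; exact: cX.
Qed.

Lemma is_derive_pol (W : normedModType R) (a : C -> W) x (n : 'I_4) da :
  n != 0 -> imnorm x != 0 -> is_derive (pol x) (0, 1) a da ->
  is_derive x (qbasis n) (fun y => a (pol y)) ((x 0 n / imnorm x) *: da).
Proof.
move=> n0 r0 /is_derive_sectionr da0.
apply: (@is_derive_eq_line _ _ (fun y => a (x 0 0, imnorm y))).
  by move=> t; rewrite /pol qline_coord eq_sym (negbTE n0) add0r.
exact: (is_derive_comp1 (is_derive_imnorm n0 r0) da0).
Qed.

(** Im x replaces the unit J, so this factor is linear in x and the division by beta is absorbed
    into [b]. *)
Definition axial (a b : C -> H) (y : H) : H := a (pol y) + imq y * b (pol y).

Lemma is_derive_axial (a b : C -> H) x (n : 'I_4) da db :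
  n != 0 -> imnorm x != 0 ->
  is_derive (pol x) (0, 1) a da -> is_derive (pol x) (0, 1) b db ->
  is_derive x (qbasis n) (axial a b)
   ((x 0 n / imnorm x) *: da + (qbasis n * b (pol x) + imq x * ((x 0 n / imnorm x) *: db))).
Proof.
move=> n0 r0 ha hb; apply: is_deriveD; first exact: is_derive_pol.
by apply: is_derive_qmul; [exact: is_derive_imq|exact: is_derive_pol].
Qed.

Lemma is_derive_axial0 (a b : C -> H) x da db :
  is_derive (pol x) (1, 0) a da -> is_derive (pol x) (1, 0) b db ->
  is_derive x (qbasis 0) (axial a b) (da + imq x * db).
Proof.
have E t : imq (t *: qbasis 0 + x : H) = imq x.
  apply: quatP; rewrite ?imq0 ?imqE// qline_coord add0r //.
have Ep t : pol (t *: qbasis 0 + x : H) = t *: (1, 0) + pol x.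
  rewrite /pol qline_coord eqxx /imnorm E; congr pair.
    by rewrite /= scalE mulr1.
  by rewrite /= scaler0 add0r.
move=> /is_derive_line0 ha /is_derive_line0 hb; apply/is_derive_line0.
rewrite (_ : (fun t => _) = (fun t : R => a (t *: (1, 0) + pol x) + imq x * b (t *: (1, 0) + pol x))); last first.
  by apply/funext => t; rewrite /axial Ep E.
apply: is_deriveD.
have := is_derive_qmul (@is_derive_cst _ R H (imq x) 0 1) hb.
by rewrite mul0r add0r.
Qed.

Lemma slice_fun_axial F x : slice_fun F x = axial (fun z => (F z).1) (fun z => z.2^-1 *: (F z).2) x.
Proof. by rewrite slice_fun_pol /axial /dirq -scalerAl scalerAr. Qed.

(** Moving in the direction x_0 changes neither Im x nor its norm, so this is valid on the real axis
    as well. *)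
Lemma partial0_slice_fun F A x : is_derive (pol x) (1, 0) F (A (pol x)) ->
  is_derive x (qbasis 0) (slice_fun F) (slice_fun A x).
Proof.
move=> /is_derive_pairP[h1 h2].
rewrite (_ : slice_fun F = axial (fun z => (F z).1) (fun z => z.2^-1 *: (F z).2)); last first.
  by apply/funext => y; rewrite slice_fun_axial.
rewrite slice_fun_axial; apply: is_derive_axial0 => //.
apply/is_derive_sectionl; move/is_derive_sectionl: h2 => h2.
exact: (@is_deriveZ _ _ _ (fun s => (F (s, imnorm x)).2) (imnorm x)^-1 _ _ _ h2).
Qed.

Lemma imq_sum x : imq x = x 0 1 *: qbasis 1 + x 0 2 *: qbasis 2 + x 0 3 *: qbasis 3.
Proof. by apply: quatP; rewrite !(imq0, imqE)// !qE !qbasisE /=; ring. Qed.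

(** Writing the beta-derivatives as beta a1 and beta b1 cancels the quotient x_n/beta coming from
    the norm: df/dx_n = x_n (a1 + Im(x) b1) + e_n b. In the sum over three directions 3 counts the
    directions, and 5 = 3 + 2 includes the two mixed terms e_n x_n b1, which add up to 2 Im(x)
    b1. *)
Lemma axial_second (f : H -> H) (a b a1 b1 : C -> H) x a1' b1' :
  imnorm x != 0 ->
  (\forall y \near x, f y = axial a b y) ->
  (\forall z \near pol x, is_derive (z : C) (0, 1) a (z.2 *: a1 z)) ->
  (\forall z \near pol x, is_derive (z : C) (0, 1) b (z.2 *: b1 z)) ->
  is_derive (pol x) (0, 1) a1 a1' -> is_derive (pol x) (0, 1) b1 b1' ->
  (forall n : 'I_4, n != 0 -> derivable f x (qbasis n) /\ derivable (partial n f) x (qbasis n)) /\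
  laplacian3 f x = (3 *: a1 (pol x) + imnorm x *: a1') +
     imq x * (5 *: b1 (pol x) + imnorm x *: b1').
Proof.
move=> r0 nf na nb da1 db1.
have nr : \forall y \near x, imnorm y != 0.
  have : \forall z \near pol x, z.2 != 0.
    have c2 : {for pol x, continuous (fun z : C => z.2)} by exact: cvg_snd.
    have : \forall u \near imnorm x, u != 0 by apply: open_nbhs_nbhs; split => //; exact: open_neq.
    exact: c2.
  exact: continuous_pol.
have nd : \forall y \near x, forall n : 'I_4, n != 0 -> is_derive (y : H) (qbasis n) f
   (y 0 n *: (a1 (pol y) + imq y * b1 (pol y)) + qbasis n * b (pol y)).
  have nxy : \forall y \near x, \forall w \near y, f w = axial a b w by apply: near_join.
  have na' := @continuous_pol x _ na; have nb' := @continuous_pol x _ nb.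
  near=> y => n n0.
  have ry : imnorm y != 0 by near: y.
  have ey : \forall w \near y, axial a b w = f w.
    have : \forall w \near y, f w = axial a b w by near: y.
    by apply: filterS => w ->.
  apply: near_eq_is_derive ey _.
  have day : is_derive (pol y) (0, 1) a ((pol y).2 *: a1 (pol y)) by near: y; exact: na'.
  have dby : is_derive (pol y) (0, 1) b ((pol y).2 *: b1 (pol y)) by near: y; exact: nb'.
  have := is_derive_axial n0 ry day dby.
  congr is_derive; rewrite !scalerA /= divfK// -scalerAr scalerDr -addrA; congr (_ + _).
  exact: addrC.
have d2 (n : 'I_4) : n != 0 -> is_derive x (qbasis n) (partial n f)
   (a1 (pol x) + imq x * b1 (pol x) +
    (x 0 n ^+ 2 / imnorm x) *: (a1' + imq x * b1') + (2 * x 0 n) *: (qbasis n * b1 (pol x))).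
  move=> n0.
  have np : \forall y \near x, (y : H) 0 n *: axial a1 b1 y + qbasis n * b (pol y) = partial n f y.
    by apply: filterS nd => y /(_ n n0) [_ <-].
  apply: (near_eq_is_derive np).
  have dA := is_derive_axial n0 r0 da1 db1.
  have db := is_derive_pol n0 r0 (nbhs_singleton nb).
  have dS := is_derive_qscale (is_derive_coord x (qbasis n) n) dA.
  have dM := is_derive_qmul (@is_derive_cst _ H H (qbasis n) x (qbasis n)) db.
  have := is_deriveD dS dM; congr is_derive.
  have -> : (x 0 n / imnorm x) *: ((pol x).2 *: b1 (pol x)) = x 0 n *: b1 (pol x).
    by rewrite scalerA /= divfK.
  rewrite qbasisE eqxx mul0r /axial -!scalerAr.
  move: (imq x * b1') (imq x * b1 _) (qbasis n * _) => u1 u2 u3.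
  move: (a1 _) (x 0 n) (imnorm x)^-1 => u4 c1 c2.
  by apply/rowP => k; rewrite !mxE /=; ring.
split.
  move=> n n0; split; last by have [] := d2 n n0.
  by have [] := nbhs_singleton nd n n0.
have -> : laplacian3 f x = \sum_(n < 4 | n != 0) 'D_(qbasis n) (partial n f) x by [].
rewrite (eq_bigr _ (fun n n0 => @derive_val _ _ _ _ _ _ _ (d2 n n0))) sum_imag.
have Es (n : 'I_4) : (2 * x 0 n) *: (qbasis n * b1 (pol x)) =
    2 *: ((x 0 n *: qbasis n) * b1 (pol x)) by rewrite -scalerAl scalerA.
rewrite !Es.
(* The weights x_n^2/beta of [a1'] and [b1'] sum to beta. *)
have rE : imnorm x = x 0 1 ^+ 2 / imnorm x + x 0 2 ^+ 2 / imnorm x + x 0 3 ^+ 2 / imnorm x.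
  by rewrite -!mulrDl -qnorm2_imq -imnorm_sqr expr2 mulfK.
have E : imq x * b1 (pol x) = (x 0 1 *: qbasis 1) * b1 (pol x) +
    (x 0 2 *: qbasis 2) * b1 (pol x) + (x 0 3 *: qbasis 3) * b1 (pol x).
  by rewrite -!mulrDl -imq_sum.
rewrite mulrDr -!scalerAr.
move: E rE.
move: (imq x * b1 (pol x)) (imq x * b1') => u w.
move: (_ * b1 (pol x)) (_ * b1 (pol x)) (_ * b1 (pol x)) => e1 e2 e3 ->.
move: (_ / _) (_ / _) (_ / _) => c1 c2 c3 ->.
move: (a1 (pol x)) => p.
by apply/rowP => k; rewrite !mxE; ring.
Unshelve. all: by end_near. Qed.

End AxialDerivatives.

(** * The Cauchy-Riemann-Fueter operator on slice functions *)

Section SliceFueter.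
Context {R : realType}.
Local Notation H := (quat R).
Local Notation C := (R * R)%type.
Implicit Types (D : set C) (F A B : C -> H * H) (f : H -> H) (x : H) (z : C).

Lemma real_quat x : imnorm x = 0 -> x = (x 0 0)%:A.
Proof. by move=> /imnorm_eq0/eqP; rewrite subr_eq0 => /eqP. Qed.

(** From a real point, x + s e_n stays in the plane of the unit e_n for both signs of s, thanks to
    the stem symmetry. Along this line the slice function is as smooth as F, although |s| is not
    smooth at 0. *)
Lemma slice_fun_line D F x (s : R) (n : 'I_4) : stem D F -> D (x 0 0, s) ->
  n != 0 -> imnorm x = 0 ->
  slice_fun F (s *: qbasis n + x) = (F (x 0 0, s)).1 + qbasis n * (F (x 0 0, s)).2.
Proof.
move=> sF Ds n0 r0; rewrite -(slice_funE sF Ds (imag_units_qbasis n0)).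
by rewrite -scalerAr mulr1 addrC {1}(real_quat r0).
Qed.

Lemma partial_real D F B x (s : R) (n : 'I_4) : open D -> stem D F -> D (x 0 0, s) ->
  n != 0 -> imnorm x = 0 -> is_derive (x 0 0, s) (0, 1) F (B (x 0 0, s)) ->
  is_derive (s *: qbasis n + x) (qbasis n) (slice_fun F)
    ((B (x 0 0, s)).1 + qbasis n * (B (x 0 0, s)).2).
Proof.
move=> oD sF Ds n0 r0 /is_derive_pairP[/is_derive_sectionr h1 /is_derive_sectionr h2].
apply/is_derive_line.
have near_s : \forall t \near s, (F (x 0 0, t)).1 + qbasis n * (F (x 0 0, t)).2 =
    slice_fun F (t *: qbasis n + x).
  have : \forall t \near s, D (x 0 0, t).
    have c : {for s, continuous (fun t : R => (x 0 0, t))}.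
      by apply: continuous_pairing; [exact: cvg_cst|exact: cvg_id].
    exact: (c _ (open_nbhs_nbhs (conj oD Ds))).
  by apply: filterS => t Dt; rewrite (slice_fun_line sF).
apply: (near_eq_is_derive near_s).
apply: is_deriveD => //.
have := is_derive_qmul (@is_derive_cst _ R H (qbasis n) s 1) h2.
by rewrite mul0r add0r.
Qed.

Lemma is_derive_quot F B z : z.2 != 0 -> is_derive z (0, 1) F (B z) ->
  is_derive z (0, 1) (fun z => z.2^-1 *: (F z).2)
    (z.2^-1 *: (B z).2 - z.2 ^- 2 *: (F z).2).
Proof.
case: z => a b /= b0 /is_derive_pairP[_ /is_derive_sectionr h]; apply/is_derive_sectionr.
have dI : is_derive b 1 (fun s : R => s^-1) (- b ^- 2 *: 1) by exact: is_deriveV.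
have := is_derive_qscale dI h; congr is_derive => /=.
by rewrite scalE mulr1 scaleNr addrC.
Qed.

Lemma partial_nonreal F B x (n : 'I_4) : n != 0 -> imnorm x != 0 ->
  is_derive (pol x) (0, 1) F (B (pol x)) ->
  is_derive x (qbasis n) (slice_fun F)
    ((x 0 n / imnorm x) *: (B (pol x)).1 + (qbasis n * ((imnorm x)^-1 *: (F (pol x)).2) +
      imq x * ((x 0 n / imnorm x) *: ((imnorm x)^-1 *: (B (pol x)).2 - (imnorm x) ^- 2 *: (F (pol x)).2)))).
Proof.
move=> n0 r0 dF.
rewrite (_ : slice_fun F = axial (fun z => (F z).1) (fun z => z.2^-1 *: (F z).2)); last first.
  by apply/funext => y; rewrite slice_fun_axial.
apply: is_derive_axial => //; last exact: is_derive_quot.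
by case/is_derive_pairP : dF.
Qed.

Lemma qbasis_sqr (n : 'I_4) : n != 0 -> qbasis n * qbasis n = -1 :> H.
Proof. exact: imag_units_qbasis. Qed.

Lemma imq_sqr x : imq x * imq x = - (imnorm x ^+ 2)%:A.
Proof.
rewrite imnorm_sqr qnorm2_imq; by apply: quatP; rewrite !qE /=; ring.
Qed.

(** The three products e_n e_n contribute -3 F_2/beta, and the radial derivative of F_2/beta gives
    one F_2/beta back; hence the coefficient 2. *)
Lemma cr_fueter_nonreal F A B x : imnorm x != 0 ->
  is_derive (pol x) (1, 0) F (A (pol x)) -> is_derive (pol x) (0, 1) F (B (pol x)) ->
  cr_fueter (slice_fun F) x = 2^-1 *:
    (((A (pol x)).1 - (B (pol x)).2 - (2 / imnorm x) *: (F (pol x)).2)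
     + dirq x * ((A (pol x)).2 + (B (pol x)).1)).
Proof.
move=> r0 dA dB; rewrite /cr_fueter; congr (_ *: _).
have [_ E0] := partial0_slice_fun dA.
rewrite /partial E0 (eq_bigr _ (fun n n0 => congr1 (fun y => qbasis n * y)
  (@derive_val _ _ _ _ _ _ _ (partial_nonreal n0 r0 dB)))) {E0}.
rewrite slice_fun_pol; move: (A (pol x)) (B (pol x)) (F (pol x)) => [a1 a2] [b1 b2] [f1 f2] /=.
set w := (imnorm x)^-1 *: b2 - _.
under eq_bigr => n n0 do rewrite !mulrDr mulrA (qbasis_sqr n0).
rewrite !big_split /=.
have E (g : H) : \sum_(n < 4 | n != 0) qbasis n * ((x 0 n / imnorm x) *: g) = dirq x * g.
  rewrite sum_imag /dirq imq_sum -!scalerAr !scalerAl -!mulrDl; congr (_ * _).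
  by rewrite !scalerDr !scalerA ![_ / imnorm x]mulrC.
have E' (g : H) : \sum_(n < 4 | n != 0) qbasis n * (imq x * ((x 0 n / imnorm x) *: g)) = dirq x * (imq x * g).
  by under eq_bigr do rewrite -scalerAr; exact: E.
rewrite E E' mulrA sum_imag !mulN1r.
have -> : dirq x * imq x = - (imnorm x)%:A.
  by rewrite /dirq -scalerAl imq_sqr scalerN scalerA expr2 mulKf.
have -> : - (imnorm x)%:A * w = - (imnorm x *: w) by rewrite mulNr -scalerAl mul1r.
rewrite /w scalerBr !scalerA divff// expr2 invfM mulVKf//.
rewrite mulrDr; move: (dirq x * a2) (dirq x * b1) => u v.
by apply/rowP => k; rewrite !mxE; ring.
Qed.

(** By parity A_2 and B_1 vanish on the axis, and each imaginary direction contributes e_n e_n B_2 =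
    -B_2. *)
Lemma cr_fueter_real D F A B x : open D -> conj_closed D -> stem D F ->
  stem_C1 D F A B -> imnorm x = 0 -> D (pol x) ->
  cr_fueter (slice_fun F) x = 2^-1 *: ((A (pol x)).1 - 3 *: (B (pol x)).2).
Proof.
move=> oD cD sF hF r0 Dx; have [dA dB _ _] := hF _ Dx.
have pE : pol x = (x 0 0, 0) by rewrite /pol r0.
rewrite pE in dA dB Dx *.
rewrite /cr_fueter; congr (_ *: _).
have sA : stem D A by apply: stem_alpha oD cD sF _ => z /hF[].
have A0 := stem_real sA Dx.
have B0 : (B (x 0 0, 0)).1 = 0.
  by apply: (stem_beta_real oD cD sF) Dx => z /hF[].
have dA' : is_derive (pol x) (1, 0) F (A (pol x)) by rewrite pE.
have [_ E0] := partial0_slice_fun dA'.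
have d (n : 'I_4) : n != 0 -> is_derive x (qbasis n) (slice_fun F)
    ((B (x 0 0, 0)).1 + qbasis n * (B (x 0 0, 0)).2).
  by move=> n0; have := partial_real oD sF Dx n0 r0 dB; rewrite scale0r add0r.
rewrite /partial E0 (eq_bigr _ (fun n n0 => congr1 (fun y => qbasis n * y)
  (@derive_val _ _ _ _ _ _ _ (d n n0)))) {E0}.
rewrite slice_fun_pol pE A0 mulr0 addr0 B0 sum_imag !add0r !mulrA !qbasis_sqr// !mulN1r.
by apply/rowP => k; rewrite !mxE; ring.
Qed.

Lemma near_partial f g x : (\near x, f x = g x) -> forall n, \near x, partial n f x = partial n g x.
Proof.
move=> fg n; have : \forall y \near x, \forall w \near y, f w = g w by apply: near_join.
by apply: filterS => y; exact: near_eq_derive.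
Qed.

Lemma near_cr_fueter f g x : (\near x, f x = g x) -> cr_fueter f x = cr_fueter g x.
Proof.
move=> fg; have E n := nbhs_singleton (near_partial fg n).
by rewrite /cr_fueter E; congr (_ *: (_ + _)); apply: eq_bigr => n _; rewrite E.
Qed.

Lemma near_laplacian4 f g x : (\near x, f x = g x) -> laplacian4 f x = laplacian4 g x.
Proof.
move=> fg; apply: eq_bigr => n _.
by apply: near_eq_derive; exact: near_partial.
Qed.

Lemma near_laplacian3 f g x : (\near x, f x = g x) -> laplacian3 f x = laplacian3 g x.
Proof.
move=> fg; apply: eq_bigr => n _.
by apply: near_eq_derive; exact: near_partial.
Qed.

(* The sum of the Cauchy-Riemann-Fueter operator and its conjugate is d/dx_0. *)
Lemma conj_cr_fueter_monogenic f x : cr_fueter f x = 0 -> conj_cr_fueter f x = partial 0 f x.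
Proof.
rewrite /cr_fueter /conj_cr_fueter => /eqP; rewrite scaler_eq0 invr_eq0 pnatr_eq0 /=.
rewrite addrC addr_eq0 => /eqP ->; rewrite opprK.
by move: (partial 0 f x) => p; apply/rowP => k; rewrite !mxE; field.
Qed.

End SliceFueter.

(** * Weighted averages between the real axis and a point *)

Section AxisAverages.
Context {R : realType}.
Local Notation C := (R * R)%type.
Local Notation mu := (@lebesgue_measure R).
Implicit Types (v w : C -> R) (z : C).

(** Represents quotients by beta in a form that is regular at beta = 0; the weight t^k matches the
    equation satisfied by the numerator. *)
Definition axis_avg (k : nat) w z : R :=
  \int[mu]_(t in `[0, 1]) (t ^+ k * w (z.1, t * z.2)).

Lemma near_ball (x y : C) (e : R) : ball x e y -> \forall z \near y, ball x e z.
Proof.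
by move=> xy; apply: open_nbhs_nbhs; split => //; exact: ball_open.
Qed.

(** The ball of the product norm is a square, so it contains the vertical segment from each of its
    points to the axis. *)
Lemma ball_axis (a e t : R) z : t \in `[0, 1] -> ball ((a, 0) : C) e z -> ball ((a, 0) : C) e (z.1, t * z.2).
Proof.
rewrite in_itv/= => /andP[t0 t1] [z1]; rewrite -ball_normE /ball_ /= sub0r normrN => z2.
split => //; rewrite -ball_normE /ball_ /= sub0r normrN normrM (ger0_norm t0).
by apply: le_lt_trans z2; rewrite ler_piMl.
Qed.

Lemma continuous_avg_integrand k w z (t : R) : {for (z.1, t * z.2), continuous w} ->
  {for (z, t), continuous (fun p : C * R => p.2 ^+ k * w (p.1.1, p.2 * p.1.2))}.
Proof.
move=> cw; apply: continuousM.
  apply: (@continuous_comp _ _ _ (fun p : C * R => p.2) (fun s => s ^+ k)); first exact: cvg_snd.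
  exact: exprn_continuous.
apply: (@continuous_comp _ _ _ (fun p : C * R => (p.1.1, p.2 * p.1.2)) w); last exact: cw.
have c1 : {for (z, t), continuous (fun p : C * R => p.1)} by exact: cvg_fst.
have c2 : {for (z, t), continuous (fun p : C * R => p.2)} by exact: cvg_snd.
apply: continuous_pairing.
  by apply: (continuous_comp c1); exact: cvg_fst.
apply: continuousM; first exact: c2.
by apply: (continuous_comp c1); exact: cvg_snd.
Qed.

Lemma axis_avg_continuous k w (a e : R) :
  (forall z, ball ((a, 0) : C) e z -> {for z, continuous w}) ->
  forall z, ball ((a, 0) : C) e z -> {for z, continuous (axis_avg k w)}.
Proof.
move=> cw z Bz.
apply: (@continuous_param_integral _ C (fun z t => t ^+ k * w (z.1, t * z.2))) => //.
have : \forall y \near z, ball ((a, 0) : C) e y by exact: near_ball.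
by apply: filterS => y By t t01; apply: continuous_avg_integrand; apply: cw; exact: (ball_axis t01 By).
Qed.

Lemma axis_avg_derivel k w w' (a e : R) :
  (forall z, ball ((a, 0) : C) e z -> {for z, continuous w} /\ {for z, continuous w'} /\
     is_derive z (1, 0) w (w' z)) ->
  forall z, ball ((a, 0) : C) e z -> is_derive z (1, 0) (axis_avg k w) (axis_avg k w' z).
Proof.
move=> hw z Bz.
apply: (@is_derive_param_integral _ C (fun z t => t ^+ k * w (z.1, t * z.2))
   (fun z t => t ^+ k * w' (z.1, t * z.2))).
have : \forall y \near z, ball ((a, 0) : C) e y by exact: near_ball.
apply: filterS => y By t t01; have [c1 [c2 d]] := hw _ (ball_axis t01 By).
split; [exact: continuous_avg_integrand|exact: continuous_avg_integrand|].
case: y By c1 c2 d => y1 y2 /= By c1 c2 /is_derive_sectionl d; apply/is_derive_sectionl.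
Qed.

(** The chain rule on w(alpha, t beta) yields one more factor t, which raises the weight. *)
Lemma axis_avg_deriver k w w' (a e : R) :
  (forall z, ball ((a, 0) : C) e z -> {for z, continuous w} /\ {for z, continuous w'} /\
     is_derive z (0, 1) w (w' z)) ->
  forall z, ball ((a, 0) : C) e z -> is_derive z (0, 1) (axis_avg k w) (axis_avg k.+1 w' z).
Proof.
move=> hw z Bz.
apply: (@is_derive_param_integral _ C (fun z t => t ^+ k * w (z.1, t * z.2))
   (fun z t => t ^+ k.+1 * w' (z.1, t * z.2))).
have : \forall y \near z, ball ((a, 0) : C) e y by exact: near_ball.
apply: filterS => y By t t01; have [c1 [c2 d]] := hw _ (ball_axis t01 By).
split; [exact: continuous_avg_integrand|exact: continuous_avg_integrand|].
case: y By c1 c2 d => y1 y2 /= By c1 c2 /is_derive_sectionr d; apply/is_derive_sectionr.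
have dm : is_derive y2 1 (fun s => t * s) t.
  by apply: is_derive_eq; rewrite scalE mulr1.
have dc := is_derive_comp1 dm d.
have := @is_deriveZ _ _ _ (fun s => w (y1, t * s)) (t ^+ k) _ _ _ dc.
by congr is_derive; rewrite !scalE exprSr mulrA.
Qed.

(* d/dt (t^k v(b, t s)) = s t^k w(b, t s) *)
Lemma axis_quotient k v w v' (a e : R) :
  (forall z, ball ((a, 0) : C) e z -> {for z, continuous w} /\
    is_derive z (0, 1) v (v' z)) ->
  (forall z, ball ((a, 0) : C) e z -> z.2 = 0 -> v z = 0) ->
  (forall z, ball ((a, 0) : C) e z -> z.2 != 0 -> z.2 * v' z = z.2 * w z - k%:R * v z) ->
  forall z, ball ((a, 0) : C) e z -> v z = z.2 * axis_avg k w z.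
Proof.
move=> hw v0 ode [b s] Bz /=.
have [s0|s0] := eqVneq s 0; first by rewrite s0 in Bz *; rewrite mul0r v0.
pose g (t : R) := t ^+ k * w (b, t * s).
pose G (t : R) := t ^+ k * v (b, t * s).
have cg (t : R) : t \in `[0, 1] -> {for t, continuous g}.
  move=> t01; have [c _] := hw _ (ball_axis t01 Bz).
  exact: (@continuous_section R C (fun y t => t ^+ k * w (y.1, t * y.2)) (b, s) t (continuous_avg_integrand c)).
have dv (t : R) : t \in `[0, 1] -> is_derive t 1 (fun t => v (b, t * s)) (s * v' (b, t * s)).
  move=> t01; have [_ /is_derive_sectionr d] := hw _ (ball_axis t01 Bz).
  have dm : is_derive t 1 (fun u => u * s) s.
    by apply: is_derive_eq; rewrite !scalE; ring.
  exact: is_derive_comp1 dm d.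
have dG (t : R) : t \in `[0, 1] -> is_derive t 1 G
    (k%:R * t ^+ k.-1 * v (b, t * s) + t ^+ k * (s * v' (b, t * s))).
  move=> t01; have d := dv t t01.
  have dX : is_derive t 1 (fun u : R => u ^+ k) (k%:R * t ^+ k.-1 * 1).
    have := @is_deriveX _ _ (fun u : R => u) k t 1 1 (@is_derive_id _ _ t 1).
    by rewrite exprfctE.
  have := is_deriveM dX d; congr is_derive.
  by rewrite !scalE; ring.
have igr : mu.-integrable `[0, 1] (EFin \o g) by apply: integrable_continuous.
have cG (t : R) : t \in `[0, 1] -> {for t, continuous G}.
  by move=> t01; apply: differentiable_continuous; apply/derivable1_diffP; have [] := dG t t01.
rewrite /axis_avg -RintegralZl//= /Rintegral (@continuous_FTC2 _ _ G)//.
- have t01 : (0 : R) \in `[0, 1] by rewrite in_itv/= lexx ler01.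
  have B0 := ball_axis t01 Bz.
  rewrite /= mul0r in B0.
  by rewrite /G !mul1r expr1n mul1r mul0r (v0 _ B0)// mulr0 sube0.
- apply: continuous_in_subspaceT => t /set_mem /= t01.
  apply: (@continuousM _ _ (fun=> s) g t); [exact: cvg_cst|exact: cg].
- split.
  + by move=> t t01; have [] := dG t (subset_itv_oo_cc t01).
  + by apply: cvg_at_right_filter; apply: cG; rewrite in_itv/= lexx ler01.
  + by apply: cvg_at_left_filter; apply: cG; rewrite in_itv/= lexx ler01.
- move=> t t01; rewrite derive1E; have [_ ->] := dG t (subset_itv_oo_cc t01).
  have t0 : t != 0 by move: t01; rewrite in_itv/= => /andP[/gt_eqF->].
  have ts : t * s != 0 by rewrite mulf_neq0.
  have := ode _ (ball_axis (subset_itv_oo_cc t01) Bz) ts; rewrite /= => E.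
  (* The equation is available for t s v', so both sides are multiplied by t. This also turns
     t^(k-1) into t^k; for k = 0 the term has coefficient 0. *)
  apply: (mulfI t0).
  have -> : t * (k%:R * t ^+ k.-1 * v (b, t * s) + t ^+ k * (s * v' (b, t * s))) =
     k%:R * (t * t ^+ k.-1) * v (b, t * s) + t ^+ k * (t * s * v' (b, t * s)) by ring.
  have -> : k%:R * (t * t ^+ k.-1) = k%:R * t ^+ k :> R.
    by case: (k) => [|k']; rewrite ?mul0r//= exprS.
  by rewrite E; ring.
Qed.

(** Carries identities proved off the real axis to the axis by continuity. *)
Lemma continuous_punctured_eq (U : normedModType R) (f g : R -> U) (a : R) :
  {for a, continuous f} -> {for a, continuous g} ->
  (\forall s \near a, s != a -> f s = g s) -> f a = g a.
Proof.
move=> cf cg fg.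
have c1 : f s @[s --> a^'] --> f a by apply: cvg_trans cf; apply: cvg_app; exact: cvg_within.
have c2 : g s @[s --> a^'] --> g a by apply: cvg_trans cg; apply: cvg_app; exact: cvg_within.
have c3 : f s @[s --> a^'] --> g a.
  by apply: cvg_trans c2; apply: near_eq_cvg; apply: filterS fg => s h sa; rewrite h.
exact: (cvg_unique _ c1 c3).
Qed.

End AxisAverages.

(** * Monogenic functions through their stems; harmonicity off the real axis *)

Section MonogenicStems.
Context {R : realType}.
Local Notation H := (quat R).
Local Notation C := (R * R)%type.
Implicit Types (D : set C) (F A B : C -> H * H) (f : H -> H) (x : H) (z : C).

(* The components of the equation dbar I(F) = 0, for A = dF/dalpha and B = dF/dbeta;
   on the real axis F_2/beta becomes its limit B_2. *)
Definition mono_stem D F A B := forall z, D z ->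
  (z.2 != 0 -> (A z).1 - (B z).2 - (2 / z.2) *: (F z).2 = 0 /\ (A z).2 + (B z).1 = 0) /\
  (z.2 = 0 -> (A z).1 = 3 *: (B z).2).

(** [pol] only sees beta >= 0. For beta > 0 the points with units J and -J separate the two
    components; beta < 0 follows from the symmetry of F, A and B, and beta = 0 from the formula on
    the axis. *)
Lemma mono_stemP D F A B : open D -> conj_closed D -> stem D F -> stem_C1 D F A B ->
  (forall x, circularization D x -> cr_fueter (slice_fun F) x = 0) <-> mono_stem D F A B.
Proof.
move=> oD cD sF hF.
have dF z (Dz : D z) : is_derive z (1, 0) F (A z) by have [] := hF z Dz.
have dF' z (Dz : D z) : is_derive z (0, 1) F (B z) by have [] := hF z Dz.
have sA := stem_alpha oD cD sF dF.
have sB := stem_beta oD cD sF dF'.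
have half (u : H) : 2^-1 *: u = 0 -> u = 0.
  by move/eqP; rewrite scaler_eq0 invr_eq0 pnatr_eq0 => /eqP.
split=> h.
- have pos a b : D (a, b) -> 0 < b ->
      (A (a, b)).1 - (B (a, b)).2 - (2 / b) *: (F (a, b)).2 = 0 /\ (A (a, b)).2 + (B (a, b)).1 = 0.
    move=> Dab b0.
    pose J : H := qbasis 1.
    have uJ : imag_units J by exact: imag_units_qbasis.
    have key J' : imag_units J' ->
       (A (a, b)).1 - (B (a, b)).2 - (2 / b) *: (F (a, b)).2 + J' * ((A (a, b)).2 + (B (a, b)).1) = 0.
      move=> uJ'; pose x := a%:A + J' * b%:A.
      have px : pol x = (a, b) by rewrite pol_polar// gtr0_norm.
      have nx : imnorm x = b by move: px => [_].
      have Ox : circularization D x by exists a, b, J'.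
      have dx : dirq x = J'.
        have [x0 _] := imag_unitsP uJ'.
        rewrite /dirq nx /imq; have -> : x 0 0 = a by move: px => [].
        by rewrite /x addrAC subrr add0r -scalerAr mulr1 scalerA mulVf ?scale1r// gt_eqF.
      have Dp : D (pol x) by rewrite px.
      have nz : imnorm x != 0 by rewrite nx gt_eqF.
      have := h x Ox; rewrite (cr_fueter_nonreal nz (dF _ Dp) (dF' _ Dp)) px nx dx.
      exact: half.
    have k1 := key J uJ; have k2 := key (- J) (imag_units_opp uJ).
    move: k1 k2; set u := _ - _ - _; set w := _ + (B _).1 => k1.
    have -> : u = - (J * w) by apply/eqP; rewrite -addr_eq0 k1.
    rewrite mulNr -opprD => /eqP; rewrite oppr_eq0 -mulr2n -scaler_nat scaler_eq0 pnatr_eq0 /=.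
    move=> /eqP Jw; rewrite Jw oppr0; split => //.
    have -> : w = - (J * (J * w)) by rewrite mulrA uJ mulN1r opprK.
    by rewrite Jw mulr0 oppr0.
  case=> a b Dab /=; split=> [b0|b0].
    have [bp|bn|b00] := ltgtP b 0; last by rewrite b00 eqxx in b0.
      have Dc : D (a, - b) := cD _ Dab.
      have bp' : 0 < - b by rewrite oppr_gt0.
      have := pos a (- b) Dc bp'.
      have -> : A (a, - b) = conjHC (A (a, b)) := sA _ Dab.
      have -> : F (a, - b) = conjHC (F (a, b)) := sF _ Dab.
      have -> : B (a, - b) = - conjHC (B (a, b)) := sB _ Dab.
      rewrite /conjHC /= invrN !mulrN scaleNr scalerN !opprK => -[-> e2]; split => //.
      by apply/eqP; rewrite -oppr_eq0 opprD e2.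
    exact: pos.
  rewrite {}b0 in Dab *.
  pose x : H := a%:A.
  have px : pol x = (a, 0).
    have := pol_polar a 0 (imag_units_qbasis (isT : (1 : 'I_4) != 0)).
    by rewrite scale0r mulr0 addr0 normr0.
  have nx : imnorm x = 0 by move: px => [_].
  have Dx : D (pol x) by rewrite px.
  have Ox : circularization D x by apply/circularizationP.
  have := h x Ox; rewrite (cr_fueter_real oD cD sF hF nx Dx) px.
  by move=> /half/eqP; rewrite subr_eq0 => /eqP.
- move=> x /(circularizationP _ cD) Dx.
  have [h1 h2] := h _ Dx.
  have [r0|r0] := eqVneq (imnorm x) 0.
    by rewrite (cr_fueter_real oD cD sF hF r0 Dx) h2// subrr scaler0.
  have [e1 e2] := h1 r0.
  rewrite (cr_fueter_nonreal r0 (dF _ Dx) (dF' _ Dx)).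
  by rewrite e1 e2 mulr0 addr0 scaler0.
Qed.

Lemma near_pol D x : open D -> D (pol x) -> \forall y \near x, D (pol y).
Proof. by move=> oD Dx; exact: (@continuous_pol _ x _ (open_nbhs_nbhs (conj oD Dx))). Qed.

(** Only F and A are known to be C^1, not B = dF/dbeta. The two monogenic equations eliminate B: B_1
    = -A_2 and B_2 = A_1 - 2F_2/beta, after which [axial_second] applies. *)
Lemma mono_second_nonreal D F A B A' B' x : open D ->
  stem_C1 D F A B -> mono_stem D F A B -> stem_C1 D A A' B' -> mono_stem D A A' B' ->
  D (pol x) -> imnorm x != 0 ->
  (forall n, n != 0 -> derivable (slice_fun F) x (qbasis n) /\
                       derivable (partial n (slice_fun F)) x (qbasis n)) /\
  laplacian3 (slice_fun F) x = - slice_fun A' x.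
Proof.
move=> oD hF mF hA mA Dx r0.
pose a z := (F z).1; pose b z := z.2^-1 *: (F z).2.
pose a1 z := - (z.2^-1 *: (A z).2).
(* The beta-derivative of F_2/beta is B_2/beta - F_2/beta^2 = A_1/beta - 3F_2/beta^2, here divided
   by beta. *)
pose b1 z := z.2 ^- 2 *: (A z).1 - (3 * z.2 ^- 3) *: (F z).2.
have nD : \forall z \near pol x, D z /\ z.2 != 0.
  have c2 : {for pol x, continuous (fun z : C => z.2)} by exact: cvg_snd.
  have n2 : \forall z \near pol x, z.2 != 0.
    have : \forall u \near imnorm x, u != 0 by apply: open_nbhs_nbhs; split => //; exact: open_neq.
    exact: c2.
  by apply: filterS2 (open_nbhs_nbhs (conj oD Dx)) n2.
have nf : \forall y \near x, slice_fun F y = axial a b y.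
  by apply: (@filterS _ (nbhs x) _ setT) => [y _|]; [rewrite slice_fun_axial|exact: filterT].
have na : \forall z \near pol x, is_derive (z : C) (0, 1) a (z.2 *: a1 z).
  apply: filterS nD => z [Dz z0]; have [_ /is_derive_pairP[d _] _ _] := hF z Dz.
  have [[//|_ e2] _] := mF z Dz.
  rewrite (_ : z.2 *: a1 z = (B z).1)//.
  by rewrite /a1 scalerN scalerA divff// scale1r; apply/eqP; rewrite eq_sym -addr_eq0 addrC e2.
have nb : \forall z \near pol x, is_derive (z : C) (0, 1) b (z.2 *: b1 z).
  apply: filterS nD => z [Dz z0]; have [_ d _ _] := hF z Dz.
  have [[//|e1 _] _] := mF z Dz.
  have := is_derive_quot z0 d; congr is_derive.
  have -> : (B z).2 = (A z).1 - (2 / z.2) *: (F z).2.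
    by apply/eqP; rewrite eq_sym -subr_eq0 addrAC e1.
  rewrite /b1; move: (A z).1 (F z).2 => u w.
  by apply/rowP => k; rewrite !mxE; field.
have [_ dA2 _ _] := hA _ Dx; have [_ dF2 _ _] := hF _ Dx.
have [eF1 eF2] := (mF _ Dx).1 r0; have [eA1 eA2] := (mA _ Dx).1 r0.
have da1 : is_derive (pol x) (0, 1) a1
   (- ((pol x).2^-1 *: (B' (pol x)).2 - (pol x).2 ^- 2 *: (A (pol x)).2)).
  exact: (is_deriveN (@is_derive_quot _ A B' (pol x) r0 dA2)).
have db1 : is_derive (pol x) (0, 1) b1
   ((- 2 * (pol x).2 ^- 3) *: (A (pol x)).1 + (pol x).2 ^- 2 *: (B' (pol x)).1 +
    (9 * (pol x).2 ^- 4) *: (F (pol x)).2 - (3 * (pol x).2 ^- 3) *: (B (pol x)).2).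
  apply/is_derive_sectionr.
  case/is_derive_pairP : dA2 => /is_derive_sectionr dA1 _.
  case/is_derive_pairP : dF2 => _ /is_derive_sectionr dF2.
  set r := (pol x).2 in r0 dA1 dF2 *.
  have dI : is_derive r 1 (fun s : R => s^-1) (- r ^- 2 *: 1) by exact: is_deriveV.
  have d2 : is_derive r 1 (fun s : R => s ^- 2) (- 2 * r ^- 3).
    rewrite (_ : (fun s => _) = (fun s : R => s^-1 * s^-1)); last first.
      by apply/funext => s; rewrite expr2 invfM.
    by apply: is_derive_eq; rewrite !scalE; field.
  have d3 : is_derive r 1 (fun s : R => 3 * s ^- 3) (- 9 * r ^- 4).
    rewrite (_ : (fun s => _) = (fun s : R => 3 * (s ^- 2 * s^-1))); last first.
      by apply/funext => s; rewrite -invfM -exprSr.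
    by apply: is_derive_eq; rewrite !scalE; field.
  have := is_deriveB (is_derive_qscale d2 dA1) (is_derive_qscale d3 dF2).
  congr is_derive; rewrite /b1 /=.
  move: (A _).1 (B' _).1 (F _).2 (B _).2 => u1 u2 u3 u4.
  by apply/rowP => k; rewrite !mxE; ring.
have [h1 ->] := axial_second r0 nf na nb da1 db1; split => //.
rewrite slice_fun_pol /a1 /b1 /dirq.
have -> : (A' (pol x)).1 = (B' (pol x)).2 + (2 / imnorm x) *: (A (pol x)).2.
  by apply/eqP; rewrite -subr_eq0 opprD addrA eA1.
have -> : (A' (pol x)).2 = - (B' (pol x)).1 by apply/eqP; rewrite -addr_eq0 eA2.
have -> : (B (pol x)).2 = (A (pol x)).1 - (2 / imnorm x) *: (F (pol x)).2.
  by apply/eqP; rewrite eq_sym -subr_eq0 addrAC eF1.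
rewrite /=; move: (B' _) (A _) (F _) => [u1 u2] [v1 v2] [w1 w2] /=.
rewrite -scalerAl mulrN scalerN.
rewrite (_ : 5 *: _ + _ = (imnorm x)^-1 *: u1); last by apply/rowP => k; rewrite !mxE; field.
rewrite -scalerAr; move: (imq x * u1) => u.
by apply/rowP => k; rewrite !mxE; field.
Qed.

End MonogenicStems.

(** * Harmonicity on the real axis; sums and right multiples of stems *)

Section Yukawa.
Context {R : realType}.
Local Notation H := (quat R).
Local Notation C := (R * R)%type.
Implicit Types (D : set C) (F A B : C -> H * H) (f : H -> H) (x : H) (z : C).

Lemma open_box D (a b : R) : open D -> D (a, b) ->
  exists2 e : R, 0 < e & forall z, ball ((a, b) : C) e z -> D z.
Proof.
by move=> oD Da; have /nbhs_ballP[e e0 eD] := open_nbhs_nbhs (conj oD Da); exists e.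
Qed.

Lemma continuous_pair_coord F z : {for z, continuous F} ->
  (forall k, {for z, continuous (fun z => (F z).1 0 k)}) /\
  (forall k, {for z, continuous (fun z => (F z).2 0 k)}).
Proof.
move=> cF.
have c1 : {for z, continuous (fun z => (F z).1)} by apply: (continuous_comp cF); exact: cvg_fst.
have c2 : {for z, continuous (fun z => (F z).2)} by apply: (continuous_comp cF); exact: cvg_snd.
by move/continuous_coordP : c1 => c1; move/continuous_coordP : c2 => c2.
Qed.

Lemma is_derive_pair_coord F z v dF : is_derive z v F dF ->
  (forall k, is_derive z v (fun z => (F z).1 0 k) (dF.1 0 k)) /\
  (forall k, is_derive z v (fun z => (F z).2 0 k) (dF.2 0 k)).
Proof. by move=> /is_derive_pairP[/is_derive_coordP ? /is_derive_coordP ?]. Qed.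

Lemma continuous_vertical (U : topologicalType) (u : C -> U) (a b : R) :
  {for (a, b), continuous u} -> {for b, continuous (fun s => u (a, s))}.
Proof.
move=> cu; apply: (@continuous_comp _ _ _ (fun s => (a, s)) u) => //.
by apply: continuous_pairing; [exact: cvg_cst|exact: cvg_id].
Qed.

(* On the real axis B2 is even in beta and differentiable: B2 = A1 - 2 F2/beta with
   F2/beta an average of A1. *)
Lemma mono_derive_axis D F A B A' B' (a : R) : open D -> conj_closed D ->
  stem D F -> stem_C1 D F A B -> mono_stem D F A B -> stem D A -> stem_C1 D A A' B' ->
  D (a, 0) -> is_derive (0 : R) 1 (fun s : R => (B (a, s)).2) 0.
Proof.
move=> oD cD sF hF mF sA hA Da; apply/is_derive_coordP => k; rewrite quat0E.
have [e e0 eD] := open_box oD Da.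
have near0 : \forall s \near (0 : R), ball ((a, 0) : C) e (a, s).
  have : \forall s \near (0 : R), ball 0 e s by exact: nbhsx_ballx.
  by apply: filterS => s Bs; split => //=; exact: ballxx.
pose w z := (A z).1 0 k; pose w' z := (B' z).1 0 k.
have hw z : ball ((a, 0) : C) e z ->
    {for z, continuous w} /\ {for z, continuous w'} /\ is_derive z (0, 1) w (w' z).
  move=> /eD Dz; have [_ _ cA _] := hF z Dz; have [_ dA _ cB'] := hA z Dz.
  split; first exact: (continuous_pair_coord cA).1.
  split; first exact: (continuous_pair_coord cB').1.
  exact: (is_derive_pair_coord dA).1.
pose v z := (F z).2 0 k; pose v' z := (B z).2 0 k.
have vE z : ball ((a, 0) : C) e z -> v z = z.2 * axis_avg 2 w z.
  (* Weight 2, since the first monogenic equation reads beta dF_2/dbeta = beta A_1 - 2F_2. *)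
  apply: (@axis_quotient _ 2 v w v' a e).
  - move=> y By; split; first by have [] := hw y By.
    have [_ dB _ _] := hF y (eD y By).
    exact: (is_derive_pair_coord dB).2.
  - move=> [y1 y2] By /= y0; rewrite y0 in By *.
    by rewrite /v (stem_real sF (eD _ By)) quat0E.
  - move=> y By y0; have [[//|e1 _] _] := mF y (eD y By).
    have -> : v' y = w y - 2 / y.2 * v y.
      have := congr1 (fun q : H => q 0 k) e1; rewrite !qE => /eqP.
      by rewrite addrAC subr_eq0 => /eqP.
    by field.
have BE (s : R) : ball ((a, 0) : C) e (a, s) -> s != 0 -> v' (a, s) = w (a, s) - 2 * axis_avg 2 w (a, s).
  move=> Bs s0; have [[//|e1 _] _] := mF _ (eD _ Bs).
  have -> : v' (a, s) = w (a, s) - 2 / s * v (a, s).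
    have := congr1 (fun q : H => q 0 k) e1; rewrite !qE => /eqP.
    by rewrite addrAC subr_eq0 => /eqP.
  by rewrite (vE _ Bs) /= mulrA divfK.
have Ba : ball ((a, 0) : C) e (a, 0) by exact: ballxx.
have davg := @axis_avg_deriver _ 2 w w' a e hw _ Ba.
have [_ [_ dw]] := hw _ Ba.
(* The derivative is w' - 2 times an average of w', taken at beta = 0, where w' = dA_1/dbeta
   vanishes because A_1 is even in beta. *)
have dg : is_derive (0 : R) 1 (fun s : R => w (a, s) - 2 * axis_avg 2 w (a, s)) 0.
  have w'0 : w' (a, 0) = 0.
    rewrite /w' (stem_beta_real oD cD sA _ Da) ?quat0E// => z Dz.
    by have [] := hA z Dz.
  have avg0 : axis_avg 3 w' (a, 0) = 0.
    rewrite /axis_avg /= (_ : (fun t => _) = cst 0).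
      by rewrite Rintegral_cst// mul0r.
    by apply/funext => t; rewrite mulr0 w'0 mulr0.
  move/is_derive_sectionr : dw => dw; move/is_derive_sectionr : davg => davg.
  have := is_deriveB dw (is_deriveZ 2 davg); congr is_derive.
  by rewrite w'0 avg0 scaler0 subr0.
(* The formula for B_2 was derived with a division by beta; at beta = 0 it holds by continuity. *)
have ev0 : v' (a, 0) = w (a, 0) - 2 * axis_avg 2 w (a, 0).
  apply: (@continuous_punctured_eq R R (fun s => v' (a, s)) (fun s => w (a, s) - 2 * axis_avg 2 w (a, s))).
  - apply: continuous_vertical; have [_ _ _ cB] := hF _ Da.
    exact: (continuous_pair_coord cB).2.
  - by apply: differentiable_continuous; apply/derivable1_diffP; have [] := dg.
  - by apply: filterS near0 => s Bs s0; exact: BE.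
apply: near_eq_is_derive dg.
apply: filterS near0 => s Bs; have [->|s0] := eqVneq s 0; first by rewrite -ev0.
by rewrite -BE.
Qed.

(** Along x + s e_n the first derivative is -A_2 + e_n B_2. At s = 0 the second summand has
    derivative 0, so each direction gives -dA_2/dbeta, and three of them make -A'_1 by the axis
    equation for A. *)
Lemma mono_second_real D F A B A' B' x : open D -> conj_closed D ->
  stem D F -> stem_C1 D F A B -> mono_stem D F A B -> stem D A -> stem_C1 D A A' B' ->
  mono_stem D A A' B' ->
  D (pol x) -> imnorm x = 0 ->
  (forall n, n != 0 -> derivable (slice_fun F) x (qbasis n) /\
                       derivable (partial n (slice_fun F)) x (qbasis n)) /\
  laplacian3 (slice_fun F) x = - slice_fun A' x.
Proof.
move=> oD cD sF hF mF sA hA mA Dx r0.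
have pE : pol x = (x 0 0, 0) by rewrite /pol r0.
rewrite pE in Dx.
have near0 : \forall s \near (0 : R), D (x 0 0, s).
  have c : {for 0, continuous (fun t : R => (x 0 0, t))}.
    by apply: continuous_pairing; [exact: cvg_cst|exact: cvg_id].
  exact: (c _ (open_nbhs_nbhs (conj oD Dx))).
have d1 (s : R) (n : 'I_4) : D (x 0 0, s) -> n != 0 ->
    is_derive (s *: qbasis n + x) (qbasis n) (slice_fun F)
      ((B (x 0 0, s)).1 + qbasis n * (B (x 0 0, s)).2).
  by move=> Ds n0; apply: (partial_real oD sF Ds n0 r0); have [] := hF _ Ds.
have BA (s : R) : D (x 0 0, s) -> (B (x 0 0, s)).1 = - (A (x 0 0, s)).2.
  move=> Ds; have [s0|s0] := eqVneq s 0; last first.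
    by have [[//|_ /eqP]] := mF _ Ds; rewrite addrC addr_eq0 => /eqP.
  rewrite s0 in Ds *; rewrite (stem_real sA Ds) oppr0.
  by apply: (stem_beta_real oD cD sF) Ds => z /hF[].
have d2 (n : 'I_4) : n != 0 -> is_derive x (qbasis n) (partial n (slice_fun F)) (- (B' (x 0 0, 0)).2).
  move=> n0; apply/is_derive_line0.
  have nE : \forall s \near (0 : R), - (A (x 0 0, s)).2 + qbasis n * (B (x 0 0, s)).2 =
      partial n (slice_fun F) (s *: qbasis n + x).
    by apply: filterS near0 => s Ds; rewrite -BA//; have [_ <-] := d1 s n Ds n0.
  apply: near_eq_is_derive nE _.
  have [_ /is_derive_pairP[_ /is_derive_sectionr dA] _ _] := hA _ Dx.
  have dB := mono_derive_axis oD cD sF hF mF sA hA Dx.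
  have := is_deriveD (is_deriveN dA) (is_derive_qmul (@is_derive_cst _ R H (qbasis n) 0 1) dB).
  by congr is_derive; rewrite mul0r mulr0 !addr0.
split.
  move=> n n0; split; last by have [] := d2 n n0.
  by have [] := d1 0 n Dx n0; rewrite scale0r add0r.
have -> : laplacian3 (slice_fun F) x =
  \sum_(n < 4 | n != 0) 'D_(qbasis n) (partial n (slice_fun F)) x by [].
rewrite (eq_bigr _ (fun n n0 => @derive_val _ _ _ _ _ _ _ (d2 n n0))) sum_imag.
rewrite slice_fun_pol pE /dirq imnorm_eq0// scaler0 mul0r addr0.
rewrite (mA _ Dx).2//; move: (B' _).2 => u.
by apply/rowP => k; rewrite !mxE; ring.
Qed.

(** Right multiplication commutes with J, with iota and with real scalars, hence preserves all the
    structures on stems. *)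
Definition stem_mulr F (q : H) z : H * H := ((F z).1 * q, (F z).2 * q).

Lemma slice_fun_mulr F q x : slice_fun (stem_mulr F q) x = slice_fun F x * q.
Proof. by rewrite !slice_fun_pol /= mulrDl mulrA. Qed.

Lemma slice_funD F A x : slice_fun (fun z => F z + A z) x = slice_fun F x + slice_fun A x.
Proof. by rewrite !slice_fun_pol /= mulrDr addrACA. Qed.

Lemma stem_mulr_stem D F q : stem D F -> stem D (stem_mulr F q).
Proof. by move=> sF z /sF E; rewrite /stem_mulr E /conjHC /= mulNr. Qed.

Lemma stemD D F A : stem D F -> stem D A -> stem D (fun z => F z + A z).
Proof. by move=> sF sA z Dz; rewrite sF// sA// /conjHC /= opprD. Qed.

Lemma is_derive_mulr F z v dF q : is_derive z v F dF ->
  is_derive z v (stem_mulr F q) (dF.1 * q, dF.2 * q).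
Proof.
move=> /is_derive_pairP[h1 h2]; apply/is_derive_pairP; split.
  have := is_derive_qmul h1 (@is_derive_cst _ _ _ q z v).
  by congr is_derive; rewrite mulr0 addr0.
have := is_derive_qmul h2 (@is_derive_cst _ _ _ q z v).
by congr is_derive; rewrite mulr0 addr0.
Qed.

Lemma continuous_mulr F z q : {for z, continuous F} -> {for z, continuous (stem_mulr F q)}.
Proof.
move=> cF; apply: continuous_pairing; apply: continuous_qmulr; apply: (continuous_comp cF).
  exact: cvg_fst.
exact: cvg_snd.
Qed.

Lemma stem_C1_mulr D F A B q : stem_C1 D F A B ->
  stem_C1 D (stem_mulr F q) (stem_mulr A q) (stem_mulr B q).
Proof.
move=> h z /h[d1 d2 c1 c2]; split.
- exact: (is_derive_mulr q d1).
- exact: (is_derive_mulr q d2).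
- by apply: continuous_mulr; exact: c1.
- by apply: continuous_mulr; exact: c2.
Qed.

Lemma stem_C1D D F A B F2 A2 B2 : stem_C1 D F A B -> stem_C1 D F2 A2 B2 ->
  stem_C1 D (fun z => F z + F2 z) (fun z => A z + A2 z) (fun z => B z + B2 z).
Proof.
move=> h h2 z Dz; have [d1 d2 c1 c2] := h z Dz; have [d3 d4 c3 c4] := h2 z Dz.
split; [exact: (is_deriveD d1 d3)|exact: (is_deriveD d2 d4)|exact: (continuousD c1 c3)|].
exact: (continuousD c2 c4).
Qed.

Lemma mono_stemD D F A B F2 A2 B2 : mono_stem D F A B -> mono_stem D F2 A2 B2 ->
  mono_stem D (fun z => F z + F2 z) (fun z => A z + A2 z) (fun z => B z + B2 z).
Proof.
move=> h h2 z Dz; have [h3 h4] := h z Dz; have [h5 h6] := h2 z Dz; split => z0 /=.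
  have [e1 e2] := h3 z0; have [e3 e4] := h5 z0.
  split; last by rewrite addrACA e2 e4 addr0.
  rewrite -[RHS]addr0 -[X in _ = X + _]e1 -[X in _ = _ + X]e3 scalerDr !opprD.
  by rewrite [RHS]addrACA; congr (_ + _); rewrite [RHS]addrACA.
by rewrite h4// h6// scalerDr.
Qed.

Lemma mono_stem_mulr D F A B q : mono_stem D F A B ->
  mono_stem D (stem_mulr F q) (stem_mulr A q) (stem_mulr B q).
Proof.
move=> h z Dz; have [h3 h4] := h z Dz; split => z0 /=.
  have [e1 e2] := h3 z0.
  by rewrite scalerAl -!mulrBl -mulrDl e1 e2 mul0r.
by rewrite scalerAl h4.
Qed.

End Yukawa.

(** * The product of two operators L and the Yukawa equation *)

Section MonogenicFunctions.
Context {R : realType}.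
Local Notation H := (quat R).
Local Notation C := (R * R)%type.
Implicit Types (D : set C) (F A B : C -> H * H) (f : H -> H) (x q : H) (z : C).

Lemma near_circularization D x : open D -> conj_closed D -> circularization D x ->
  \forall y \near x, circularization D y.
Proof.
move=> oD cD /(circularizationP _ cD) Dx; have := near_pol oD Dx.
by apply: filterS => y Dy; apply/(circularizationP _ cD).
Qed.

Lemma near_slice_fun D F f x : open D -> conj_closed D -> stem D F -> induces D F f ->
  circularization D x -> \forall y \near x, f y = slice_fun F y.
Proof.
move=> oD cD sF iF Ox; have := near_circularization oD cD Ox.
by apply: filterS => y; exact: induces_slice_fun.
Qed.

Lemma induces_congr D F f g : induces D F f ->
  (forall x, circularization D x -> f x = g x) -> induces D F g.
Proof.
by move=> iF fg a b J Dz uJ; rewrite -fg ?iF//; exists a, b, J.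
Qed.

(** Exchanges a function with arbitrary values outside Omega for stem data with named
    derivatives. *)
Lemma axially_monogenicP D f : open D -> conj_closed D ->
  axially_monogenic D f <-> exists F A B,
    [/\ stem D F, stem_C1 D F A B, induces D F f & mono_stem D F A B].
Proof.
move=> oD cD; split=> [[[F [sF cF iF]] h]|[F [A [B [sF hF iF mF]]]]].
  have hF := C1_on_stem cF.
  exists F, (d_alpha F), (d_beta F); split => //.
  apply/(mono_stemP oD cD sF hF) => x Ox; rewrite -(h x Ox); apply: near_cr_fueter.
  by apply: filterS (near_slice_fun oD cD sF iF Ox) => y ->.
split; first by exists F; split; [exact: sF|exact: stem_C1_on hF|exact: iF].
move=> x Ox; rewrite (near_cr_fueter (near_slice_fun oD cD sF iF Ox)).
by move: x Ox; apply/(mono_stemP oD cD sF hF).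
Qed.

Lemma partial0_induced D F A B f x : open D -> conj_closed D -> stem D F ->
  stem_C1 D F A B -> induces D F f -> circularization D x ->
  is_derive x (qbasis 0) f (slice_fun A x).
Proof.
move=> oD cD sF hF iF Ox; have := near_slice_fun oD cD sF iF Ox => nE.
have nE' : \forall y \near x, slice_fun F y = f y by apply: filterS nE => y ->.
apply: near_eq_is_derive nE' _; apply: partial0_slice_fun.
by have [] := hF _ ((circularizationP x cD).1 Ox).
Qed.

Lemma Lop_monogenic D F A B f q x : open D -> conj_closed D -> stem D F ->
  stem_C1 D F A B -> induces D F f -> mono_stem D F A B -> circularization D x ->
  Lop q f x = slice_fun A x - f x * q.
Proof.
move=> oD cD sF hF iF mF Ox; rewrite /Lop; congr (_ - _).
rewrite conj_cr_fueter_monogenic.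
  by have [_ <-] := partial0_induced oD cD sF hF iF Ox.
have [_ h] : axially_monogenic D f by apply/axially_monogenicP => //; exists F, A, B.
exact: h.
Qed.

Lemma imag_sqr (l : R) (I : H) : imag_units I -> (l *: I) * (l *: I) = - (l ^+ 2)%:A.
Proof.
by move=> uI; rewrite -scalerAl -scalerAr uI !scalerN scalerA expr2.
Qed.

(** The stem of L_{-q} f is A + Fq. As L_{-q} f is axially monogenic, this stem is C^1 and satisfies
    the monogenic equations, and subtracting Fq gives the same for A. This supplies the second
    derivatives of f and its harmonicity. *)
Lemma Lop_Lop_monogenic D (l : R) (I : H) f : open D -> conj_closed D -> imag_units I ->
  axially_monogenic D f -> axially_monogenic D (Lop (- (l *: I)) f) ->
  forall x, circularization D x ->
  (forall n, n != 0 -> derivable f x (qbasis n) /\ derivable (partial n f) x (qbasis n)) /\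
  Lop (l *: I) (Lop (- (l *: I)) f) x = l ^+ 2 *: f x - laplacian3 f x.
Proof.
move=> oD cD uI /(axially_monogenicP _ oD cD)[F [A [B [sF hF iF mF]]]].
set q := l *: I; set k := Lop (- q) f.
move=> /(axially_monogenicP _ oD cD)[G [GA [GB [sG hG iG mG]]]] x Ox.
have sA : stem D A by apply: stem_alpha oD cD sF _ => z /hF[].
have kE y : circularization D y -> k y = slice_fun A y + f y * q.
  by move=> Oy; rewrite /k (Lop_monogenic _ oD cD sF hF iF mF Oy) mulrN opprK.
have iA : induces D (fun z => A z + stem_mulr F q z) k.
  apply: (@induces_congr _ _ (slice_fun (fun z => A z + stem_mulr F q z))).
    by apply: slice_funE; exact: stemD sA (stem_mulr_stem _ sF).
  move=> y Oy; rewrite slice_funD slice_fun_mulr kE// (induces_slice_fun sF iF Oy)//.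
(* The stem [G] provided for L_{-q} f must be A + Fq. *)
have GE := stem_unique cD sG (stemD sA (stem_mulr_stem q sF)) iG iA.
have AE z : D z -> G z + stem_mulr F (- q) z = A z.
  move=> Dz; rewrite GE// -addrA -[RHS]addr0; congr (_ + _).
  by rewrite /stem_mulr; congr pair; rewrite /= mulrN subrr.
have hA := stem_C1_eq oD (stem_C1D hG (stem_C1_mulr (- q) hF)) AE.
have mA' := mono_stemD mG (mono_stem_mulr (- q) mF).
set A' := fun z => GA z + _ in hA mA'; set B' := fun z => GB z + _ in hA mA'.
have mA : mono_stem D A A' B'.
  move=> z Dz; have := mA' z Dz; rewrite (_ : ((fun z => G z + stem_mulr F (- q) z) z) = A z)//.
  exact: AE.
have Dx := (circularizationP x cD).1 Ox.
have nE := near_slice_fun oD cD sF iF Ox.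
have [h1 h2] : (forall n, n != 0 -> derivable (slice_fun F) x (qbasis n) /\
                       derivable (partial n (slice_fun F)) x (qbasis n)) /\
  laplacian3 (slice_fun F) x = - slice_fun A' x.
  have [r0|r0] := eqVneq (imnorm x) 0; first exact: (mono_second_real oD cD sF hF mF sA hA mA Dx r0).
  exact: (mono_second_nonreal oD hF mF hA mA Dx r0).
split.
  move=> n n0; have [d1 d2] := h1 n n0.
  have nE' : \forall y \near x, slice_fun F y = f y by apply: filterS nE => y ->.
  split; first exact: near_eq_derivable nE' d1.
  exact: near_eq_derivable (near_partial nE' n) d2.
rewrite (near_laplacian3 nE) h2 opprK.
rewrite (Lop_monogenic _ oD cD sG hG iG mG Ox) kE// mulrDl.
(* With GA = A' + Aq, the expression GA - (A + Fq)q loses its cross terms and becomes A' - F q^2,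
   where q^2 = -lambda^2. *)
have -> : slice_fun A' x = slice_fun GA x + slice_fun A x * - q.
  by rewrite slice_funD slice_fun_mulr.
have -> : f x * q * q = - (l ^+ 2 *: f x).
  by rewrite -mulrA imag_sqr// mulrN -scalerAr mulr1.
by rewrite mulrN opprD opprK addrA addrC.
Qed.

Lemma Lop_Lop_yukawa D (l : R) (I : H) f (g : H -> H) : open D -> conj_closed D -> imag_units I ->
  axially_monogenic D f -> axially_monogenic D (Lop (- (l *: I)) f) ->
  (forall x, circularization D x -> Lop (l *: I) (Lop (- (l *: I)) f) x = g x) <->
  yukawa_solution D l (fun x => - g x) f.
Proof.
move=> oD cD uI mf mk; have key := Lop_Lop_monogenic oD cD uI mf mk.
split=> h x Ox; have [d E] := key x Ox.
  split => //; have := h x Ox; rewrite E => <-.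
  by rewrite opprB.
have [_ e] := h x Ox.
by rewrite E -[RHS]opprK -e opprB.
Qed.

End MonogenicFunctions.

(** * Slice-regular functions and the Laplacian of a holomorphic stem *)

Section SliceRegular.
Context {R : realType}.
Local Notation H := (quat R).
Local Notation C := (R * R)%type.
Implicit Types (D : set C) (F A B : C -> H * H) (f : H -> H) (x q : H) (z : C).

(** The Cauchy-Riemann equation dF/dalpha + iota dF/dbeta = 0 solved for dF/dbeta, with F' =
    dF/dalpha. *)
Definition hol_stem D F F' := stem_C1 D F F' (fun z => iotaM (F' z)).

Lemma iotaMK (w : H * H) : iotaM (iotaM w) = - w.
Proof. by case: w => a b. Qed.

Lemma iotaMN (w : H * H) : iotaM (- w) = - iotaM w.
Proof. by case: w => a b. Qed.

Lemma continuous_iotaM F z : {for z, continuous F} -> {for z, continuous (fun z => iotaM (F z))}.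
Proof.
move=> cF; apply: continuous_pairing.
  by apply: continuousN; apply: (continuous_comp cF); exact: cvg_snd.
by apply: (continuous_comp cF); exact: cvg_fst.
Qed.

Lemma slice_regularP D f : open D ->
  slice_regular D f <-> exists F F', [/\ stem D F, hol_stem D F F' & induces D F f].
Proof.
move=> oD; split=> [[F [sF cF zF iF]]|[F [F' [sF hF iF]]]].
  exists F, (d_alpha F); split; [exact: sF| |exact: iF].
  move=> z Dz; have [d1 d2 c1 c2] := C1_on_stem cF Dz.
  have E : d_beta F z = iotaM (d_alpha F z).
    have /eqP := zF z Dz; rewrite /d_zbar scaler_eq0 invr_eq0 pnatr_eq0 /= addr_eq0 => /eqP ->.
    by rewrite iotaMN iotaMK opprK.
  split; [exact: d1|by rewrite -E|exact: c1|exact: continuous_iotaM].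
exists F; split; [exact: sF|exact: stem_C1_on hF| |exact: iF].
move=> z Dz; have [[_ e1] [_ e2] _ _] := hF z Dz.
rewrite /d_zbar; have -> : d_alpha F z = F' z := e1; have -> : d_beta F z = iotaM (F' z) := e2.
by rewrite iotaMK subrr scaler0.
Qed.

Lemma continuous_pairP (F : C -> H * H) z :
  (forall k, {for z, continuous (fun z => (F z).1 0 k)}) ->
  (forall k, {for z, continuous (fun z => (F z).2 0 k)}) -> {for z, continuous F}.
Proof.
move=> c1 c2.
rewrite (_ : F = (fun z => ((F z).1, (F z).2))); last by apply/funext => w; rewrite -surjective_pairing.
by apply: continuous_pairing; apply/continuous_coordP.
Qed.

Lemma stem_C1_continuous D F A B z : open D -> stem_C1 D F A B -> D z -> {for z, continuous F}.
Proof.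
move=> oD hF Dz.
have nD : \forall w \near z, D w by exact: open_nbhs_nbhs.
have [_ _ cA cB] := hF z Dz.
have c (u p q : C -> R) : (\forall w \near z, is_derive (w : C) (1, 0) u (p w)) ->
   (\forall w \near z, is_derive (w : C) (0, 1) u (q w)) ->
   {for z, continuous p} -> {for z, continuous q} -> {for z, continuous u}.
  by move=> h1 h2 h3 h4; apply: differentiable_continuous; have [] := C1_is_diff h1 h2 h3 h4.
have [cA1 cA2] := continuous_pair_coord cA; have [cB1 cB2] := continuous_pair_coord cB.
apply: continuous_pairP => k.
  apply: c (cA1 k) (cB1 k); apply: filterS nD => w /hF[d1 d2 _ _].
    exact: (is_derive_pair_coord d1).1.
  exact: (is_derive_pair_coord d2).1.
apply: c (cA2 k) (cB2 k); apply: filterS nD => w /hF[d1 d2 _ _].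
  exact: (is_derive_pair_coord d1).2.
exact: (is_derive_pair_coord d2).2.
Qed.

(** iota acts on the complex factor only, so each of the four real coordinates of (F_1, F_2) is a
    scalar holomorphic function. *)
Lemma hol_stem_coord D F F' (k : 'I_4) : hol_stem D F F' ->
  holo D (fun z => (F z).1 0 k) (fun z => (F z).2 0 k)
         (fun z => (F' z).1 0 k) (fun z => (F' z).2 0 k).
Proof.
move=> hF z Dz; have [d1 d2 c1 _] := hF z Dz.
have [a1 a2] := is_derive_pair_coord d1; have [b1 b2] := is_derive_pair_coord d2.
have [k1 k2] := continuous_pair_coord c1.
split; last by split; [exact: k1|exact: k2].
split; [exact: a1| |exact: a2|exact: b2].
by have := b1 k; rewrite /= quatNE.
Qed.

Lemma hol_stem_derive D F F' : open D -> hol_stem D F F' -> exists F'', hol_stem D F' F''.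
Proof.
move=> oD hF.
pose F'' z : H * H := (\row_k 'D_((1, 0) : C) (fun z => (F' z).1 0 k) z,
                       \row_k 'D_((1, 0) : C) (fun z => (F' z).2 0 k) z).
exists F'' => z Dz.
have hk k := holo_derive oD (hol_stem_coord k hF) Dz.
have cF'' : {for z, continuous F''}.
  apply: continuous_pairP => k; have [_ [c1 c2]] := hk k.
    by apply: near_eq_continuous c1; apply: (@filterS _ (nbhs z) _ setT) => [w _|]; [rewrite mxE|exact: filterT].
  by apply: near_eq_continuous c2; apply: (@filterS _ (nbhs z) _ setT) => [w _|]; [rewrite mxE|exact: filterT].
split; [| |exact: cF''|exact: continuous_iotaM].
  apply/is_derive_pairP; split; apply/is_derive_coordP => k /=; rewrite mxE;
    by have [[d1 d2 d3 d4] _] := hk k.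
apply/is_derive_pairP; split; apply/is_derive_coordP => k /=; rewrite ?quatNE mxE;
  by have [[d1 d2 d3 d4] _] := hk k.
Qed.

Lemma stem_hol_derive D F F' : open D -> conj_closed D -> stem D F -> hol_stem D F F' -> stem D F'.
Proof. by move=> oD cD sF hF; apply: stem_alpha oD cD sF _ => z /hF[]. Qed.

(* The stem function of Delta_4 I(F), for F holomorphic with derivatives F' and F''. *)
Definition lap_stem F F' F'' z : H * H :=
  if z.2 == 0 then (- 2 *: (F'' z).1, 0)
  else ((- 2 / z.2) *: (F' z).2, (2 / z.2) *: (F' z).1 - (2 / z.2 ^+ 2) *: (F z).2).

(** The subtracted I(F'') is the second derivative in x_0. Here dF_1/dbeta = -F'_2 and dF_2/dbeta =
    F'_1 provide the functions [a1] and [b1] for [axial_second]. *)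
Lemma laplacian3_nonreal D F F' F'' x : open D -> hol_stem D F F' -> hol_stem D F' F'' ->
  D (pol x) -> imnorm x != 0 ->
  laplacian3 (slice_fun F) x = slice_fun (lap_stem F F' F'') x - slice_fun F'' x.
Proof.
move=> oD hF hF' Dx r0.
pose a z := (F z).1; pose b z := z.2^-1 *: (F z).2.
pose a1 z := - (z.2^-1 *: (F' z).2).
pose b1 z := z.2 ^- 2 *: (F' z).1 - (z.2 ^- 3) *: (F z).2.
have nD : \forall z \near pol x, D z /\ z.2 != 0.
  have c2 : {for pol x, continuous (fun z : C => z.2)} by exact: cvg_snd.
  have n2 : \forall z \near pol x, z.2 != 0.
    have : \forall u \near imnorm x, u != 0 by apply: open_nbhs_nbhs; split => //; exact: open_neq.
    exact: c2.
  by apply: filterS2 (open_nbhs_nbhs (conj oD Dx)) n2.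
have nf : \forall y \near x, slice_fun F y = axial a b y.
  by apply: (@filterS _ (nbhs x) _ setT) => [y _|]; [rewrite slice_fun_axial|exact: filterT].
have na : \forall z \near pol x, is_derive (z : C) (0, 1) a (z.2 *: a1 z).
  apply: filterS nD => z [Dz z0]; have [_ /is_derive_pairP[d _] _ _] := hF z Dz.
  by rewrite (_ : z.2 *: a1 z = (iotaM (F' z)).1)// /a1 scalerN scalerA divff// scale1r.
have nb : \forall z \near pol x, is_derive (z : C) (0, 1) b (z.2 *: b1 z).
  apply: filterS nD => z [Dz z0]; have [_ d _ _] := hF z Dz.
  have := @is_derive_quot _ F (fun z => iotaM (F' z)) z z0 d; congr is_derive.
  rewrite /b1 /=; move: (F' z).1 (F z).2 => u w.
  by apply/rowP => k; rewrite !mxE; field.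
have [_ dA2 _ _] := hF' _ Dx; have [_ dF2 _ _] := hF _ Dx.
have da1 : is_derive (pol x) (0, 1) a1
   (- ((pol x).2^-1 *: (F'' (pol x)).1 - (pol x).2 ^- 2 *: (F' (pol x)).2)).
  exact: (is_deriveN (@is_derive_quot _ F' (fun z => iotaM (F'' z)) (pol x) r0 dA2)).
have db1 : is_derive (pol x) (0, 1) b1
   ((- 2 * (pol x).2 ^- 3) *: (F' (pol x)).1 - (pol x).2 ^- 2 *: (F'' (pol x)).2 +
    (3 * (pol x).2 ^- 4) *: (F (pol x)).2 - ((pol x).2 ^- 3) *: (F' (pol x)).1).
  apply/is_derive_sectionr.
  case/is_derive_pairP : dA2 => /is_derive_sectionr dA1 _.
  case/is_derive_pairP : dF2 => _ /is_derive_sectionr dF2.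
  set r := (pol x).2 in r0 dA1 dF2 *.
  have dI : is_derive r 1 (fun s : R => s^-1) (- r ^- 2 *: 1) by exact: is_deriveV.
  have d2 : is_derive r 1 (fun s : R => s ^- 2) (- 2 * r ^- 3).
    rewrite (_ : (fun s => _) = (fun s : R => s^-1 * s^-1)); last first.
      by apply/funext => s; rewrite expr2 invfM.
    by apply: is_derive_eq; rewrite !scalE; field.
  have d3 : is_derive r 1 (fun s : R => s ^- 3) (- 3 * r ^- 4).
    rewrite (_ : (fun s => _) = (fun s : R => (s ^- 2 * s^-1))); last first.
      by apply/funext => s; rewrite -invfM -exprSr.
    by apply: is_derive_eq; rewrite !scalE; field.
  have := is_deriveB (is_derive_qscale d2 dA1) (is_derive_qscale d3 dF2).
  congr is_derive; rewrite /b1 /=.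
  move: (F' _).1 (F'' _).2 (F _).2 => u1 u2 u3.
  by apply/rowP => k; rewrite !mxE; ring.
have [_ ->] := axial_second r0 nf na nb da1 db1.
rewrite !slice_fun_pol /lap_stem /= (negbTE r0) /a1 /b1 /dirq /=.
move: (F'' _) (F' _) (F _) => [u1 u2] [v1 v2] [w1 w2] /=.
rewrite -!scalerAl.
set p := 5 *: _ + _; set p' := _ - _ *: w2.
have -> : imq x * p = imq x * ((imnorm x)^-1 *: p' - (imnorm x)^-1 *: u2).
  by congr (_ * _); rewrite /p /p'; apply/rowP => k; rewrite !mxE; field.
rewrite mulrBr -!scalerAr; move: (imq x * p') (imq x * u2) => c1 c2.
by apply/rowP => k; rewrite !mxE; field.
Qed.

(** Each imaginary direction gives -F''_1. The sum -3F''_1 is -2F''_1, the value of [lap_stem] on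
    the axis, minus F''_1. *)
Lemma laplacian3_real D F F' F'' x : open D -> conj_closed D -> stem D F ->
  hol_stem D F F' -> hol_stem D F' F'' ->
  D (pol x) -> imnorm x = 0 ->
  laplacian3 (slice_fun F) x = slice_fun (lap_stem F F' F'') x - slice_fun F'' x.
Proof.
move=> oD cD sF hF hF' Dx r0.
have pE : pol x = (x 0 0, 0) by rewrite /pol r0.
rewrite pE in Dx.
have sF' := stem_hol_derive oD cD sF hF.
have sF'' := stem_hol_derive oD cD sF' hF'.
have near0 : \forall s \near (0 : R), D (x 0 0, s).
  have c : {for 0, continuous (fun t : R => (x 0 0, t))}.
    by apply: continuous_pairing; [exact: cvg_cst|exact: cvg_id].
  exact: (c _ (open_nbhs_nbhs (conj oD Dx))).
have d2 (n : 'I_4) : n != 0 -> is_derive x (qbasis n) (partial n (slice_fun F)) (- (F'' (x 0 0, 0)).1).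
  move=> n0; apply/is_derive_line0.
  have nE : \forall s \near (0 : R), - (F' (x 0 0, s)).2 + qbasis n * (F' (x 0 0, s)).1 =
      partial n (slice_fun F) (s *: qbasis n + x).
    apply: filterS near0 => s Ds; have [_ dB _ _] := hF _ Ds.
    by have [_ <-] := @partial_real _ D F (fun z => iotaM (F' z)) x s n oD sF Ds n0 r0 dB.
  apply: near_eq_is_derive nE _.
  have [_ /is_derive_pairP[/is_derive_sectionr dA /is_derive_sectionr dB] _ _] := hF' _ Dx.
  have := is_deriveD (is_deriveN dB) (is_derive_qmul (@is_derive_cst _ R H (qbasis n) 0 1) dA).
  by congr is_derive; rewrite /= (stem_real sF'' Dx) mul0r oppr0 mulr0 !addr0.
have -> : laplacian3 (slice_fun F) x =
  \sum_(n < 4 | n != 0) 'D_(qbasis n) (partial n (slice_fun F)) x by [].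
rewrite (eq_bigr _ (fun n n0 => @derive_val _ _ _ _ _ _ _ (d2 n n0))) sum_imag.
rewrite !slice_fun_pol pE /dirq imnorm_eq0// scaler0 !mul0r !addr0 /lap_stem eqxx /=.
move: (F'' _).1 => u.
by apply/rowP => k; rewrite !mxE; ring.
Qed.

Lemma laplacian4_slice_fun D F F' F'' x : open D -> conj_closed D -> stem D F ->
  hol_stem D F F' -> hol_stem D F' F'' -> circularization D x ->
  laplacian4 (slice_fun F) x = slice_fun (lap_stem F F' F'') x.
Proof.
move=> oD cD sF hF hF' /(circularizationP _ cD) Dx.
have -> : laplacian4 (slice_fun F) x =
   partial 0 (partial 0 (slice_fun F)) x + laplacian3 (slice_fun F) x by exact: sum_quat.
have -> : laplacian3 (slice_fun F) x = slice_fun (lap_stem F F' F'') x - slice_fun F'' x.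
  have [r0|r0] := eqVneq (imnorm x) 0.
    exact: (laplacian3_real oD cD sF hF hF' Dx r0).
  exact: (laplacian3_nonreal oD hF hF' Dx r0).
have nE : \forall y \near x, slice_fun F' y = partial 0 (slice_fun F) y.
  apply: filterS (near_pol oD Dx) => y Dy; have [d _ _ _] := hF _ Dy.
  by have [_ <-] := partial0_slice_fun d.
have -> : partial 0 (partial 0 (slice_fun F)) x = slice_fun F'' x.
  have [d _ _ _] := hF' _ Dx.
  by have [_ <-] := near_eq_is_derive nE (partial0_slice_fun d).
by rewrite addrC subrK.
Qed.

End SliceRegular.

(** * Regularity of the stem of the Laplacian, and Fueter's theorem *)

Section LaplacianStem.
Context {R : realType}.
Local Notation H := (quat R).
Local Notation C := (R * R)%type.
Local Notation mu := (@lebesgue_measure R).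
Implicit Types (D : set C) (F A B : C -> H * H) (f : H -> H) (x q : H) (z : C).

Lemma lap_stem_stem D F F' F'' : open D -> conj_closed D -> stem D F ->
  hol_stem D F F' -> hol_stem D F' F'' -> stem D (lap_stem F F' F'').
Proof.
move=> oD cD sF hF hF' z Dz.
have sF' := stem_hol_derive oD cD sF hF; have sF'' := stem_hol_derive oD cD sF' hF'.
rewrite /lap_stem /= oppr_eq0 (sF _ Dz) (sF' _ Dz) (sF'' _ Dz) /conjHC.
have [_|z0] := eqVneq z.2 0; first by rewrite /= oppr0.
move: (F' z) (F z) => [v1 v2] [w1 w2] /=.
by congr pair; apply/rowP => k; rewrite !mxE; field.
Qed.

Definition nonreal_part D : set C := [set z | D z /\ z.2 != 0].

Lemma open_nonreal_part D : open D -> open (nonreal_part D).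
Proof.
move=> oD; apply: openI => //.
have c2 : continuous (fun z : C => z.2) by move=> z; exact: cvg_snd.
exact: (@open_comp _ _ _ (fun s : R => s != 0) (fun z _ => c2 z) (@open_neq R 0)).
Qed.

(** Obtained from the formula off the axis by the quotient rule, with the beta-derivatives of F and
    F' replaced by iota F' and iota F''. *)
Definition lap_stem_beta F F' F'' z : H * H :=
  ((- 2 / z.2) *: (F'' z).1 + (2 / z.2 ^+ 2) *: (F' z).2,
   (- 2 / z.2) *: (F'' z).2 - (4 / z.2 ^+ 2) *: (F' z).1 + (4 / z.2 ^+ 3) *: (F z).2).

Lemma continuous_scale (U : normedModType R) (c : C -> R) (g : C -> U) z :
  {for z, continuous c} -> {for z, continuous g} -> {for z, continuous (fun z => c z *: g z)}.
Proof. by move=> hc hg; exact: cvgZ. Qed.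

(** The coefficients of [lap_stem] depend on beta alone, so d/dalpha merely shifts F, F', F'' to F',
    F'', F'''. *)
Lemma lap_stem_nonreal D F F' F'' F''' : open D ->
  hol_stem D F F' -> hol_stem D F' F'' -> hol_stem D F'' F''' ->
  stem_C1 (nonreal_part D) (lap_stem F F' F'') (lap_stem F' F'' F''') (lap_stem_beta F F' F'').
Proof.
move=> oD hF hF' hF''.
have oN := open_nonreal_part oD.
pose K z : H * H := ((- 2 / z.2) *: (F' z).2, (2 / z.2) *: (F' z).1 - (2 / z.2 ^+ 2) *: (F z).2).
pose K' z : H * H := ((- 2 / z.2) *: (F'' z).2, (2 / z.2) *: (F'' z).1 - (2 / z.2 ^+ 2) *: (F' z).2).
apply: (@stem_C1_eq _ _ K _ _ _ oN); last first.
  by move=> z [Dz z0]; rewrite /lap_stem (negbTE z0).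
move=> z [Dz z0].
have [dF1 dF2 _ _] := hF z Dz; have [dF1' dF2' _ _] := hF' z Dz.
have cF := stem_C1_continuous oD hF Dz; have cF' := stem_C1_continuous oD hF' Dz.
have cF'' := stem_C1_continuous oD hF'' Dz.
have nN : \forall w \near z, nonreal_part D w by exact: open_nbhs_nbhs.
have comp1 (G : C -> H * H) : {for z, continuous G} -> {for z, continuous (fun z => (G z).1)}.
  by move=> cG; apply: (continuous_comp cG); exact: cvg_fst.
have comp2 (G : C -> H * H) : {for z, continuous G} -> {for z, continuous (fun z => (G z).2)}.
  by move=> cG; apply: (continuous_comp cG); exact: cvg_snd.
have cI : {for z, continuous (fun z : C => z.2^-1)}.
  by apply: (@continuous_comp _ _ _ (fun z : C => z.2) (fun s => s^-1)); [exact: cvg_snd|exact: inv_continuous].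
have cpow (c : R) n : {for z, continuous (fun z : C => c / z.2 ^+ n)}.
  apply: continuousM; first exact: cvg_cst.
  rewrite (_ : (fun z : C => (z.2 ^+ n)^-1) = (fun z => z.2^-1 ^+ n)); last first.
    by apply/funext => w; rewrite exprVn.
  exact: (continuous_comp cI (@exprn_continuous R n _)).
have cpow1 (c : R) : {for z, continuous (fun z : C => c / z.2)}.
  by apply: continuousM; [exact: cvg_cst|exact: cI].
split.
- rewrite (_ : lap_stem F' F'' F''' z = K' z); last by rewrite /lap_stem (negbTE z0).
  case: z {cF cF' cF'' nN comp1 comp2 cI cpow cpow1 Dz} z0 dF1 dF2 dF1' dF2' => a b /= b0.
  move=> /is_derive_pairP[/is_derive_sectionl h1 /is_derive_sectionl h2] _.
  move=> /is_derive_pairP[/is_derive_sectionl h1' /is_derive_sectionl h2'] _.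
  apply/is_derive_pairP; split; apply/is_derive_sectionl.
    exact: (@is_deriveZ _ _ _ (fun s => (F' (s, b)).2) (- 2 / b) _ _ _ h2').
  exact: (is_deriveB (@is_deriveZ _ _ _ (fun s => (F' (s, b)).1) (2 / b) _ _ _ h1')
         (@is_deriveZ _ _ _ (fun s => (F (s, b)).2) (2 / b ^+ 2) _ _ _ h2)).
- case: z {cF cF' cF'' nN comp1 comp2 cI cpow cpow1 Dz} z0 dF1 dF2 dF1' dF2' => a b /= b0.
  move=> _ /is_derive_pairP[/is_derive_sectionr h1 /is_derive_sectionr h2].
  move=> _ /is_derive_pairP[/is_derive_sectionr h1' /is_derive_sectionr h2'].
  have dI : is_derive b 1 (fun s : R => s^-1) (- b ^- 2 *: 1) by exact: is_deriveV.
  have d1 (c : R) : is_derive b 1 (fun s : R => c / s) (- c / b ^+ 2).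
    by apply: is_derive_eq; rewrite !scalE; field.
  have d2 : is_derive b 1 (fun s : R => 2 / s ^+ 2) (- 4 / b ^+ 3).
    rewrite (_ : (fun s => _) = (fun s : R => 2 * (s^-1 * s^-1))); last first.
      by apply/funext => s; rewrite expr2 invfM.
    by apply: is_derive_eq; rewrite !scalE; field.
  apply/is_derive_pairP; split; apply/is_derive_sectionr.
    have := is_derive_qscale (d1 (- 2)) h2'; congr is_derive => /=.
    by rewrite opprK addrC.
  have := is_deriveB (is_derive_qscale (d1 2) h1') (is_derive_qscale d2 h2); congr is_derive => /=.
  move: (F' _).1 (F'' _).2 (F _).2 => u1 u2 u3.
  by apply/rowP => k; rewrite !mxE; field.
- apply: (@near_eq_continuous _ _ K').
    by apply: filterS nN => w [_ w0]; rewrite /lap_stem (negbTE w0).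
  apply: continuous_pairing; first by apply: continuous_scale; [exact: cpow1|exact: comp2].
  apply: continuousB; apply: continuous_scale; [exact: cpow1|exact: comp1|exact: cpow|exact: comp2].
- apply: continuous_pairing.
    apply: continuousD; apply: continuous_scale; [exact: cpow1|exact: comp1|exact: cpow|exact: comp2].
  apply: continuousD; [apply: continuousB|]; apply: continuous_scale;
    [exact: cpow1|exact: comp2|exact: cpow|exact: comp1|exact: cpow|exact: comp2].
Qed.

Lemma axis_avg_real k (w : C -> R) (a : R) : w (a, 0) = 0 -> axis_avg k w (a, 0) = 0.
Proof.
move=> w0; rewrite /axis_avg /= (_ : (fun t => _) = cst 0); first by rewrite Rintegral_cst// mul0r.
by apply/funext => t; rewrite mulr0 w0 mulr0.
Qed.

Lemma axis_avg0_real (w : C -> R) (a : R) : axis_avg 0 w (a, 0) = w (a, 0).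
Proof.
rewrite /axis_avg /= (_ : (fun t => _) = cst (w (a, 0))).
  rewrite Rintegral_cst//.
  have -> : fine (mu `[0, 1]%classic) = 1 by rewrite lebesgue_measure_itv /= lte_fin ltr01 -EFinB subr0.
  by rewrite mulr1.
by apply/funext => t; rewrite mulr0 expr0 mul1r.
Qed.

(* Near the real axis F_2 = beta P, with P an average of F'_1, and the stem is (-2 dP/dalpha, 2 dP/dbeta). *)
Lemma lap_stem_axis D F F' F'' F''' (a : R) : open D -> conj_closed D -> stem D F ->
  hol_stem D F F' -> hol_stem D F' F'' -> hol_stem D F'' F''' -> D (a, 0) ->
  exists U EA EB, [/\ open U, U (a, 0) & stem_C1 U (lap_stem F F' F'') EA EB].
Proof.
move=> oD cD sF hF hF' hF'' Da.
have sF' := stem_hol_derive oD cD sF hF; have sF'' := stem_hol_derive oD cD sF' hF'.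
have [e e0 eD] := open_box oD Da.
pose U : set C := ball ((a, 0) : C) e.
have UD z : U z -> D z by move=> /eD.
pose w1 k z := (F'' z).1 0 k; pose w2 k z := (iotaM (F'' z)).1 0 k.
pose w1' k z := (F''' z).1 0 k; pose w2' k z := (iotaM (F''' z)).1 0 k.
pose w2'' k z := (iotaM (iotaM (F''' z))).1 0 k.
(* The derivatives of P taken under the integral: weight 0 for d/dalpha, weight 1 for d/dbeta. *)
pose E z : H * H := (\row_k (- 2 * axis_avg 0 (w1 k) z), \row_k (2 * axis_avg 1 (w2 k) z)).
pose EA z : H * H := (\row_k (- 2 * axis_avg 0 (w1' k) z), \row_k (2 * axis_avg 1 (w2' k) z)).
pose EB z : H * H := (\row_k (- 2 * axis_avg 1 (w2' k) z), \row_k (2 * axis_avg 2 (w2'' k) z)).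
have cw1 k z : U z -> {for z, continuous (w1 k)}.
  by move=> /UD Dz; exact: (continuous_pair_coord (stem_C1_continuous oD hF'' Dz)).1.
have cw2 k z : U z -> {for z, continuous (w2 k)}.
  by move=> /UD Dz; exact: (continuous_pair_coord (continuous_iotaM (stem_C1_continuous oD hF'' Dz))).1.
have cF''' z : U z -> {for z, continuous F'''} by move=> /UD /hF''[].
have cw1' k z : U z -> {for z, continuous (w1' k)}.
  by move=> Uz; exact: (continuous_pair_coord (cF''' z Uz)).1.
have cw2' k z : U z -> {for z, continuous (w2' k)}.
  by move=> Uz; exact: (continuous_pair_coord (continuous_iotaM (cF''' z Uz))).1.
have cw2'' k z : U z -> {for z, continuous (w2'' k)}.
  by move=> Uz; exact: (continuous_pair_coord (continuous_iotaM (continuous_iotaM (cF''' z Uz)))).1.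
have dw1 k z : U z -> is_derive z (1, 0) (w1 k) (w1' k z) /\ is_derive z (0, 1) (w1 k) (w2' k z).
  move=> /UD /hF''[d1 d2 _ _]; split; first exact: (is_derive_pair_coord d1).1.
  exact: (is_derive_pair_coord d2).1.
have dw2 k z : U z -> is_derive z (1, 0) (w2 k) (w2' k z) /\ is_derive z (0, 1) (w2 k) (w2'' k z).
  move=> /UD /hF''[d1 d2 _ _]; split; first exact: (is_derive_pair_coord (is_derive_iotaM d1)).1.
  exact: (is_derive_pair_coord (is_derive_iotaM d2)).1.
have oU : open U by exact: ball_open.
have Ua : U (a, 0) by exact: ballxx.
have C1E : stem_C1 U E EA EB.
  move=> z Uz; split.
  - apply/is_derive_pairP; split; apply/is_derive_coordP => k /=; rewrite mxE;
      (under [fun y => _]funext do rewrite mxE).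
      apply: is_deriveZ; apply: (@axis_avg_derivel _ 0 (w1 k) (w1' k) a e) => // y Uy.
      by have [d _] := dw1 k y Uy; split; [exact: cw1|split; [exact: cw1'|exact: d]].
    apply: is_deriveZ; apply: (@axis_avg_derivel _ 1 (w2 k) (w2' k) a e) => // y Uy.
    by have [d _] := dw2 k y Uy; split; [exact: cw2|split; [exact: cw2'|exact: d]].
  - apply/is_derive_pairP; split; apply/is_derive_coordP => k /=; rewrite mxE;
      (under [fun y => _]funext do rewrite mxE).
      apply: is_deriveZ; apply: (@axis_avg_deriver _ 0 (w1 k) (w2' k) a e) => // y Uy.
      by have [_ d] := dw1 k y Uy; split; [exact: cw1|split; [exact: cw2'|exact: d]].
    apply: is_deriveZ; apply: (@axis_avg_deriver _ 1 (w2 k) (w2'' k) a e) => // y Uy.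
    by have [_ d] := dw2 k y Uy; split; [exact: cw2|split; [exact: cw2''|exact: d]].
  - apply: continuous_pairP => k.
      rewrite (_ : (fun z => (EA z).1 0 k) = (fun z => - 2 * axis_avg 0 (w1' k) z)).
        by apply: continuousM; [exact: cvg_cst|exact: (axis_avg_continuous (cw1' k))].
      by apply/funext => y; rewrite mxE.
    rewrite (_ : (fun z => (EA z).2 0 k) = (fun z => 2 * axis_avg 1 (w2' k) z)).
      by apply: continuousM; [exact: cvg_cst|exact: (axis_avg_continuous (cw2' k))].
    by apply/funext => y; rewrite mxE.
  - apply: continuous_pairP => k.
      rewrite (_ : (fun z => (EB z).1 0 k) = (fun z => - 2 * axis_avg 1 (w2' k) z)).
        by apply: continuousM; [exact: cvg_cst|exact: (axis_avg_continuous (cw2' k))].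
      by apply/funext => y; rewrite mxE.
    rewrite (_ : (fun z => (EB z).2 0 k) = (fun z => 2 * axis_avg 2 (w2'' k) z)).
      by apply: continuousM; [exact: cvg_cst|exact: (axis_avg_continuous (cw2'' k))].
    by apply/funext => y; rewrite mxE.
exists U, EA, EB; split; [exact: oU|exact: Ua|].
apply: (stem_C1_eq oU C1E) => z Uz.
have quot (G G' : C -> H * H) k y : stem D G -> hol_stem D G G' -> U y ->
   (G y).2 0 k = y.2 * axis_avg 0 (fun z => (G' z).1 0 k) y.
  move=> sG hG; apply: (@axis_quotient _ 0 (fun y => (G y).2 0 k) _ (fun y => (G' y).1 0 k) a e).
  - move=> t Ut; have [_ d c _] := hG t (UD t Ut).
    by split; [exact: (continuous_pair_coord c).1|exact: (is_derive_pair_coord d).2].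
  - move=> [t1 t2] Ut /= t0; rewrite t0 in Ut *.
    by rewrite (stem_real sG (UD _ Ut)) quat0E.
  - by move=> t _ _; rewrite mul0r subr0.
(* Differentiating F_2 = beta P gives F'_1 = P + beta dP/dbeta, so that 2F'_1/beta - 2F_2/beta^2
   loses its pole and equals 2 dP/dbeta. *)
have avgE k : (F' z).1 0 k = axis_avg 0 (fun z => (F' z).1 0 k) z + z.2 * axis_avg 1 (w2 k) z.
  have [_ d _ _] := hF z (UD z Uz); have d2 := (is_derive_pair_coord d).2 k.
  apply: (is_derive_unique d2).
  have nU : \forall y \near z, y.2 * axis_avg 0 (fun z => (F' z).1 0 k) y = (F y).2 0 k.
    by apply: filterS (open_nbhs_nbhs (conj oU Uz)) => y Uy; rewrite (quot F F').
  apply: near_eq_is_derive nU _.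
  have da := @axis_avg_deriver _ 0 (fun z => (F' z).1 0 k) (w2 k) a e _ z Uz.
  have {}da : is_derive z (0, 1) (axis_avg 0 (fun z => (F' z).1 0 k)) (axis_avg 1 (w2 k) z).
    apply: da => y Uy; have [_ dy _ _] := hF' y (UD y Uy).
    split; first exact: (continuous_pair_coord (stem_C1_continuous oD hF' (UD y Uy))).1.
    by split; [exact: cw2|exact: (is_derive_pair_coord dy).1].
  case: (z) da => z1 z2 /is_derive_sectionr da; apply/is_derive_sectionr.
  have := is_deriveM (@is_derive_id _ _ z2 1) da; congr is_derive.
  by rewrite !scalE mulr1 addrC.
rewrite /lap_stem; have [z0|z0] := eqVneq z.2 0.
  have zE : z = (z.1, 0) by rewrite [LHS]surjective_pairing z0.
  rewrite zE in Uz *; congr pair; apply/rowP => k; rewrite !mxE.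
    by rewrite axis_avg0_real.
  rewrite axis_avg_real ?mulr0// /w2 /= quatNE (stem_real sF'' (UD _ Uz)) quat0E oppr0 //.
congr pair; apply/rowP => k; rewrite !mxE.
  by rewrite (quot F' F'')// /w1; field.
rewrite avgE (quot F F')//; move: (axis_avg 0 _ z) (axis_avg 1 _ z) => u v.
by field.
Qed.

Lemma lap_stem_C1 D F F' F'' F''' : open D -> conj_closed D -> stem D F ->
  hol_stem D F F' -> hol_stem D F' F'' -> hol_stem D F'' F''' ->
  C1_on D (lap_stem F F' F'').
Proof.
move=> oD cD sF hF hF' hF'' [a b] Dz.
have [b0|b0] := eqVneq b 0.
  rewrite b0 in Dz *.
  have [U [EA [EB [oU Uz hU]]]] := lap_stem_axis oD cD sF hF hF' hF'' Dz.
  exact: (stem_C1_on oU hU Uz).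
have Nz : nonreal_part D (a, b) by split.
exact: (stem_C1_on (open_nonreal_part oD) (lap_stem_nonreal oD hF hF' hF'') Nz).
Qed.

(** At a real point the horizontal line stays on the axis, where the stem is (-2F''_1, 0) and can be
    differentiated directly. *)
Lemma d_alpha_lap_stem D F F' F'' F''' z : open D -> conj_closed D -> stem D F ->
  hol_stem D F F' -> hol_stem D F' F'' -> hol_stem D F'' F''' -> D z ->
  d_alpha (lap_stem F F' F'') z = lap_stem F' F'' F''' z.
Proof.
move=> oD cD sF hF hF' hF'' Dz.
have [z0|z0] := eqVneq z.2 0; last first.
  have Nz : nonreal_part D z by split.
  by have [[_ <-] _ _ _] := lap_stem_nonreal oD hF hF' hF'' Nz.
case: z z0 Dz => a b /= -> Dz.
have [d _ _ _] := hF'' _ Dz.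
suff [_ <-] : is_derive (a, 0) (1, 0) (lap_stem F F' F'') (lap_stem F' F'' F''' (a, 0)) by [].
apply/is_derive_sectionl.
rewrite (_ : (fun s => _) = (fun s => (- 2 *: (F'' (s, 0)).1, 0))); last first.
  by apply/funext => s; rewrite /lap_stem eqxx.
rewrite /lap_stem eqxx; apply/is_derive_pairP; split => /=; last exact: is_derive_cst.
case/is_derive_pairP : d => /is_derive_sectionl d _.
exact: (@is_deriveZ _ _ _ (fun s => (F'' (s, 0)).1) (- 2) _ _ _ d).
Qed.

(** As K_2 vanishes on the axis, K_2/beta is a difference quotient with limit dK_2/dbeta. The
    equation off the axis therefore tends to A_1 - B_2 = 2B_2. *)
Lemma mono_stem_axis D K KA KB : open D -> stem D K -> stem_C1 D K KA KB ->
  (forall z, D z -> z.2 != 0 ->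
    (KA z).1 - (KB z).2 - (2 / z.2) *: (K z).2 = 0) ->
  forall z, D z -> z.2 = 0 -> (KA z).1 = 3 *: (KB z).2.
Proof.
move=> oD sK hK h [a b] Dz /= b0; rewrite {}b0 in Dz *.
have [_ /is_derive_pairP[_ /is_derive_sectionr d] cA cB] := hK _ Dz.
have cL : {for (0 : R), continuous (fun s => (KA (a, s)).1 - (KB (a, s)).2)}.
  apply: continuousB.
    by apply: (continuous_comp (continuous_vertical cA)); exact: cvg_fst.
  by apply: (continuous_comp (continuous_vertical cB)); exact: cvg_snd.
have near0 : \forall s \near (0 : R), D (a, s).
  have c : {for 0, continuous (fun t : R => (a, t))}.
    by apply: continuous_pairing; [exact: cvg_cst|exact: cvg_id].
  exact: (c _ (open_nbhs_nbhs (conj oD Dz))).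
have c1 : (KA (a, s)).1 - (KB (a, s)).2 @[s --> 0^'] --> (KA (a, 0)).1 - (KB (a, 0)).2.
  by apply: cvg_trans cL; apply: cvg_app; exact: cvg_within.
have c2 : 2 *: (h^-1 *: (((fun s => (K (a, s)).2) \o shift 0) (h *: 1) - (K (a, 0)).2)) @[h --> 0^']
   --> 2 *: (KB (a, 0)).2.
  case: d => /cvg_ex [l cl] dE.
  have lE : l = (KB (a, 0)).2 by rewrite -dE; apply/esym/cvg_lim.
  by rewrite -lE; apply: cvgZr; exact: cl.
have c3 : 2 *: (h^-1 *: (((fun s => (K (a, s)).2) \o shift 0) (h *: 1) - (K (a, 0)).2)) @[h --> 0^']
   --> (KA (a, 0)).1 - (KB (a, 0)).2.
  apply: cvg_trans c1; apply: near_eq_cvg.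
  apply: filterS near0 => s Ds s0.
  have /eqP := h _ Ds s0; rewrite subr_eq0 => /eqP -> /=.
  by rewrite addr0 [s *: 1]mulr1 (stem_real sK Dz) subr0 scalerA.
have E : (KA (a, 0)).1 - (KB (a, 0)).2 = 2 *: (KB (a, 0)).2 by exact: (cvg_unique _ c3 c2).
rewrite -[LHS](subrK (KB (a, 0)).2) E; move: ((KB (a, 0)).2) => u.
by apply/rowP => k; rewrite !mxE; ring.
Qed.

(** Fueter's theorem for stems: off the axis it is a rational identity in beta, F, F' and F'', on
    the axis its limit. *)
Lemma lap_stem_mono D F F' F'' F''' : open D -> conj_closed D -> stem D F ->
  hol_stem D F F' -> hol_stem D F' F'' -> hol_stem D F'' F''' ->
  exists B, [/\ stem D (lap_stem F F' F''),
    stem_C1 D (lap_stem F F' F'') (lap_stem F' F'' F''') B &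
    mono_stem D (lap_stem F F' F'') (lap_stem F' F'' F''') B].
Proof.
move=> oD cD sF hF hF' hF''.
set K := lap_stem F F' F''.
have sK : stem D K := lap_stem_stem oD cD sF hF hF'.
have cK := lap_stem_C1 oD cD sF hF hF' hF''.
have AE z : D z -> d_alpha K z = lap_stem F' F'' F''' z.
  exact: d_alpha_lap_stem oD cD sF hF hF' hF''.
have hK : stem_C1 D K (lap_stem F' F'' F''') (d_beta K).
  move=> z Dz; have [d1 d2 c1 c2] := C1_on_stem cK Dz.
  split; [rewrite -(AE z Dz); exact: d1|exact: d2| |exact: c2].
  apply: near_eq_continuous c1.
  by apply: filterS (open_nbhs_nbhs (conj oD Dz)) => w Dw; rewrite AE.
have NR z : D z -> z.2 != 0 ->
   (lap_stem F' F'' F''' z).1 - (d_beta K z).2 - (2 / z.2) *: (K z).2 = 0 /\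
   (lap_stem F' F'' F''' z).2 + (d_beta K z).1 = 0.
  move=> Dz z0; have Nz : nonreal_part D z by split.
  have [_ [_ e] _ _] := lap_stem_nonreal oD hF hF' hF'' Nz.
  rewrite /K /d_beta e /lap_stem (negbTE z0) /lap_stem_beta /=.
  move: (F'' z) (F' z) (F z) => [u1 u2] [v1 v2] [w1 w2] /=.
  by split; apply/rowP => k; rewrite !mxE; field.
exists (d_beta K); split; [exact: sK|exact: hK|].
move=> z Dz; split=> z0; first exact: NR.
apply: (mono_stem_axis oD sK hK) Dz z0 => y Dy y0.
by have [] := NR y Dy y0.
Qed.

End LaplacianStem.

(** * Intertwining of D_mu and L_mu by the Laplacian *)

Section SliceOperators.
Context {R : realType}.
Local Notation H := (quat R).
Local Notation C := (R * R)%type.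
Implicit Types (D : set C) (F A B : C -> H * H) (f : H -> H) (x q : H) (z : C).

Lemma hol_stemD D F F' G G' : hol_stem D F F' -> hol_stem D G G' ->
  hol_stem D (fun z => F z + G z) (fun z => F' z + G' z).
Proof.
move=> hF hG; rewrite /hol_stem.
rewrite (_ : (fun z => iotaM _) = (fun z => iotaM (F' z) + iotaM (G' z))).
  exact: stem_C1D.
by apply/funext => z; congr pair; rewrite /= opprD.
Qed.

Lemma hol_stem_mulr D F F' q : hol_stem D F F' ->
  hol_stem D (stem_mulr F q) (stem_mulr F' q).
Proof.
move=> hF; rewrite /hol_stem.
rewrite (_ : (fun z => iotaM _) = stem_mulr (fun z => iotaM (F' z)) q).
  exact: stem_C1_mulr.
by apply/funext => z; congr pair; rewrite /= mulNr.
Qed.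

Lemma lap_stemD F F' F'' G G' G'' z :
  lap_stem (fun z => F z + G z) (fun z => F' z + G' z) (fun z => F'' z + G'' z) z =
  lap_stem F F' F'' z + lap_stem G G' G'' z.
Proof.
rewrite /lap_stem; case: eqP => _; congr pair; rewrite /= ?scalerDr ?addr0//.
by rewrite opprD addrACA.
Qed.

Lemma lap_stem_mulr F F' F'' q z :
  lap_stem (stem_mulr F q) (stem_mulr F' q) (stem_mulr F'' q) z =
  stem_mulr (lap_stem F F' F'') q z.
Proof.
rewrite /stem_mulr /lap_stem; case: eqP => _; congr pair; rewrite /= ?scalerAl ?mul0r//.
by rewrite mulrBl.
Qed.

Lemma inducesD D F G f g : induces D F f -> induces D G g ->
  induces D (fun z => F z + G z) (fun x => f x + g x).
Proof. by move=> iF iG a b J Dz uJ; rewrite iF// iG// /= mulrDr addrACA. Qed.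

Lemma induces_mulr D F f q : induces D F f ->
  induces D (stem_mulr F q) (fun x => f x * q).
Proof. by move=> iF a b J Dz uJ; rewrite iF// /= mulrDl mulrA. Qed.

Lemma laplacian4_induced D F F' F'' f x : open D -> conj_closed D -> stem D F ->
  hol_stem D F F' -> hol_stem D F' F'' -> induces D F f -> circularization D x ->
  laplacian4 f x = slice_fun (lap_stem F F' F'') x.
Proof.
move=> oD cD sF hF hF' iF Ox; rewrite (near_laplacian4 (near_slice_fun oD cD sF iF Ox)).
exact: (laplacian4_slice_fun oD cD sF hF hF' Ox).
Qed.

(** Linearity is read off [lap_stem]; slice-regularity stands in for the existence of the second
    partial derivatives. *)
Lemma laplacian4D D f g x : open D -> conj_closed D ->
  slice_regular D f -> slice_regular D g -> circularization D x ->
  laplacian4 (fun x => f x + g x) x = laplacian4 f x + laplacian4 g x.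
Proof.
move=> oD cD /(slice_regularP _ oD)[F [F' [sF hF iF]]] /(slice_regularP _ oD)[G [G' [sG hG iG]]] Ox.
have [F'' hF'] := hol_stem_derive oD hF; have [G'' hG'] := hol_stem_derive oD hG.
rewrite (laplacian4_induced oD cD sF hF hF' iF Ox) (laplacian4_induced oD cD sG hG hG' iG Ox).
rewrite (laplacian4_induced oD cD (stemD sF sG) (hol_stemD hF hG) (hol_stemD hF' hG') (inducesD iF iG) Ox).
by rewrite -slice_funD; congr slice_fun; apply/funext => z; exact: lap_stemD.
Qed.

Lemma laplacian4_mulr D f q x : open D -> conj_closed D ->
  slice_regular D f -> circularization D x ->
  laplacian4 (fun x => f x * q) x = laplacian4 f x * q.
Proof.
move=> oD cD /(slice_regularP _ oD)[F [F' [sF hF iF]]] Ox.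
have [F'' hF'] := hol_stem_derive oD hF.
rewrite (laplacian4_induced oD cD sF hF hF' iF Ox).
rewrite (laplacian4_induced oD cD (stem_mulr_stem q sF)
  (hol_stem_mulr q hF) (hol_stem_mulr q hF') (induces_mulr _ iF) Ox).
by rewrite -slice_fun_mulr; congr slice_fun; apply/funext => z; exact: lap_stem_mulr.
Qed.

(** [stem_of] is a choice, but on the open set [D] it coincides with F and so has the same
    derivatives. *)
Lemma slice_derivative_induced D F F' f x : open D -> conj_closed D -> stem D F ->
  hol_stem D F F' -> induces D F f -> circularization D x ->
  slice_derivative D f x = slice_fun F' x.
Proof.
move=> oD cD sF hF iF Ox; rewrite /slice_derivative.
have ex : exists G, [/\ stem D G, C1_on D G & induces D G f].
  by exists F; split; [exact: sF|exact: stem_C1_on hF|exact: iF].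
have [sG cG iG] : [/\ stem D (stem_of D f), C1_on D (stem_of D f) & induces D (stem_of D f) f].
  by rewrite /stem_of; have [G hG] := ex;
    exact: (@xgetPex _ (fun=> 0) [set F | [/\ stem D F, C1_on D F & induces D F f]] ex).
have GE := stem_unique cD sF sG iF iG.
have hG := stem_C1_eq oD hF GE.
have Dx := (circularizationP x cD).1 Ox.
have [[_ e1] [_ e2] _ _] := hG _ Dx.
rewrite !slice_fun_pol (_ : d_z (stem_of D f) (pol x) = F' (pol x))//.
rewrite /d_z; have -> : d_alpha (stem_of D f) (pol x) = F' (pol x) := e1.
have -> : d_beta (stem_of D f) (pol x) = iotaM (F' (pol x)) := e2.
rewrite iotaMK opprK; case: (F' _) => u1 u2.
by congr pair; apply/rowP => k; rewrite /= !mxE; field.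
Qed.

Lemma Dop_induced D F F' f q x : open D -> conj_closed D -> stem D F ->
  hol_stem D F F' -> induces D F f -> circularization D x ->
  Dop D q f x = slice_fun F' x - f x * q.
Proof. by move=> oD cD sF hF iF Ox; rewrite /Dop (slice_derivative_induced oD cD sF hF iF Ox). Qed.

Lemma axially_monogenic_laplacian4 D g : open D -> conj_closed D -> slice_regular D g ->
  axially_monogenic D (laplacian4 g).
Proof.
move=> oD cD /(slice_regularP _ oD)[F [F' [sF hF iF]]].
have [F'' hF'] := hol_stem_derive oD hF; have [F''' hF''] := hol_stem_derive oD hF'.
have [B [sK hK mK]] := lap_stem_mono oD cD sF hF hF' hF''.
apply/axially_monogenicP => //; exists (lap_stem F F' F''), (lap_stem F' F'' F'''), B.
split; [exact: sK|exact: hK| |exact: mK].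
apply: (induces_congr (slice_funE sK)) => x Ox.
by rewrite (laplacian4_induced oD cD sF hF hF' iF Ox).
Qed.

Lemma axially_monogenicN D f : open D -> conj_closed D -> axially_monogenic D f ->
  axially_monogenic D (fun x => - f x).
Proof.
move=> oD cD /(axially_monogenicP _ oD cD)[F [A [B [sF hF iF mF]]]].
apply/axially_monogenicP => //; exists (stem_mulr F (-1)), (stem_mulr A (-1)), (stem_mulr B (-1)).
split; [exact: stem_mulr_stem|exact: stem_C1_mulr| |exact: mono_stem_mulr].
by apply: (induces_congr (induces_mulr _ iF)) => x _; rewrite mulrN1.
Qed.

(** Both sides have the same stem K(F'' + lambda^2 F): on the left because K commutes with d/dalpha
    and right multiplication, on the right because F'' + lambda^2 F is a stem of g. *)
Lemma Dop_Dop_laplacian D (l : R) (I : H) (ft g : H -> H) : open D -> conj_closed D ->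
  imag_units I -> slice_regular D ft ->
  (forall x, circularization D x -> Dop D (l *: I) (Dop D (- (l *: I)) ft) x = g x) ->
  axially_monogenic D (Lop (- (l *: I)) (laplacian4 ft)) /\
  (forall x, circularization D x ->
     Lop (l *: I) (Lop (- (l *: I)) (laplacian4 ft)) x = laplacian4 g x).
Proof.
move=> oD cD uI /(slice_regularP _ oD)[F [F' [sF hF iF]]].
set q := l *: I => eg.
have [F'' hF'] := hol_stem_derive oD hF; have [F3 hF''] := hol_stem_derive oD hF'.
(* The stem of g contains F'', and its Laplacian takes two further derivatives. *)
have [F4 hF3] := hol_stem_derive oD hF''.
have sF' := stem_hol_derive oD cD sF hF; have sF'' := stem_hol_derive oD cD sF' hF'.
have qq y : y * q * q = - (y * (l ^+ 2)%:A) by rewrite -mulrA imag_sqr// mulrN.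
pose K := lap_stem F F' F''; pose K' := lap_stem F' F'' F3; pose K'' := lap_stem F'' F3 F4.
have [B [sK hK mK]] := lap_stem_mono oD cD sF hF hF' hF''.
have [B' [sK' hK' mK']] := lap_stem_mono oD cD sF' hF' hF'' hF3.
have iK : induces D K (laplacian4 ft).
  apply: (induces_congr (slice_funE sK)) => x Ox.
  by rewrite (laplacian4_induced oD cD sF hF hF' iF Ox).
pose G z := K' z + stem_mulr K q z.
have sG : stem D G := stemD sK' (stem_mulr_stem q sK).
have hG := stem_C1D hK' (stem_C1_mulr q hK).
have mG := mono_stemD mK' (mono_stem_mulr q mK).
have iG : induces D G (Lop (- q) (laplacian4 ft)).
  apply: (induces_congr (slice_funE sG)) => x Ox.
  rewrite (Lop_monogenic _ oD cD sK hK iK mK Ox) mulrN opprK slice_funD slice_fun_mulr.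
  by rewrite (induces_slice_fun sK iK Ox).
split.
  by apply/axially_monogenicP => //; eexists; eexists; eexists; split;
    [exact: sG|exact: hG|exact: iG|exact: mG].
move=> x Ox.
rewrite (Lop_monogenic q oD cD sG hG iG mG Ox) (induces_slice_fun sG iG Ox).
rewrite !slice_funD !slice_fun_mulr -/K' -/K''.
(* In (K'' + K'q) - (K' + Kq)q the terms K'q cancel and q^2 = -lambda^2. *)
rewrite (_ : _ - _ = slice_fun K'' x + slice_fun K x * (l ^+ 2)%:A); last first.
  move: (slice_fun K'' x) (slice_fun K' x) (slice_fun K x) => u v w.
  by rewrite mulrDl qq opprD opprK addrA addrK.
have iD : induces D (fun z => F' z + stem_mulr F q z) (Dop D (- q) ft).
  apply: (induces_congr (slice_funE (stemD sF' (stem_mulr_stem q sF)))) => y Oy.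
  by rewrite (Dop_induced _ oD cD sF hF iF Oy) mulrN opprK slice_funD slice_fun_mulr (induces_slice_fun sF iF Oy).
pose P z := F'' z + stem_mulr F (l ^+ 2)%:A z.
pose P' z := F3 z + stem_mulr F' (l ^+ 2)%:A z.
pose P'' z := F4 z + stem_mulr F'' (l ^+ 2)%:A z.
have sP : stem D P := stemD sF'' (stem_mulr_stem _ sF).
have hP : hol_stem D P P' := hol_stemD hF'' (hol_stem_mulr _ hF).
have hP' : hol_stem D P' P'' := hol_stemD hF3 (hol_stem_mulr _ hF').
have iP : induces D P g.
  apply: (induces_congr (slice_funE sP)) => y Oy; rewrite -eg//.
  rewrite (Dop_induced _ oD cD (stemD sF' (stem_mulr_stem q sF)) (hol_stemD hF' (hol_stem_mulr q hF)) iD Oy).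
  rewrite (Dop_induced _ oD cD sF hF iF Oy) (induces_slice_fun sF iF Oy).
  rewrite !slice_funD !slice_fun_mulr mulrN opprK.
  move: (slice_fun F'' y) (slice_fun F' y) (slice_fun F y) => u v w.
  by rewrite mulrDl qq opprD opprK addrA addrK.
rewrite (laplacian4_induced oD cD sP hP hP' iP Ox).
rewrite -slice_fun_mulr -slice_funD; congr slice_fun; apply/funext => z.
by rewrite /P /P' /P'' lap_stemD lap_stem_mulr.
Qed.

End SliceOperators.

(** * Polynomials with right coefficients and the operator S_mu *)

Section RightPolynomials.
Context {R : realType}.
Local Notation H := (quat R).
Local Notation C := (R * R)%type.
Implicit Types (D : set C) (F A B : C -> H * H) (f : H -> H) (x q : H) (z : C) (p : {poly H}).

Lemma right_evalE n p x : (size p <= n)%N -> right_eval p x = \sum_(i < n) x ^+ i * p`_i.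
Proof.
move=> pn; rewrite /right_eval (big_ord_widen_cond _ xpredT (fun i => x ^+ i * p`_i) pn) big_mkcond.
apply: eq_bigr => i _; case: ltnP => //= hi.
by rewrite nth_default// mulr0.
Qed.

Lemma right_eval0 x : right_eval 0 x = 0.
Proof. by rewrite /right_eval size_poly0 big_ord0. Qed.

Lemma right_evalD p r x : right_eval (p + r) x = right_eval p x + right_eval r x.
Proof.
rewrite (right_evalE x (leq_maxl (size p) (size r))) (right_evalE x (leq_maxr (size p) (size r))).
rewrite (right_evalE x (size_polyD p r)).
by rewrite -big_split; apply: eq_bigr => i _; rewrite coefD mulrDr.
Qed.

Lemma right_eval_mulC p q x : right_eval (p * q%:P) x = right_eval p x * q.
Proof.
rewrite (@right_evalE (size p)); last first.
  apply: (leq_trans (size_polyMleq _ _)).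
  by rewrite size_polyC; case: (q == 0); rewrite ?addn0 ?addn1 ?leq_pred.
by rewrite /right_eval mulr_suml; apply: eq_bigr => i _; rewrite coefMC mulrA.
Qed.

(** Powers of x stand left of the coefficients, so raising all exponents by one is left
    multiplication by x. *)
Lemma right_evalMX p x : right_eval (p * 'X) x = x * right_eval p x.
Proof.
rewrite (@right_evalE (size p).+1); last first.
  by apply: (leq_trans (size_polyMleq _ _)); rewrite size_polyX addn2.
rewrite big_ord_recl coefMX eqxx mulr0 add0r /right_eval mulr_sumr.
by apply: eq_bigr => i _; rewrite coefMX /= exprS mulrA.
Qed.

Lemma right_evalC q x : right_eval q%:P x = q.
Proof.
rewrite (@right_evalE 1) ?size_polyC ?leq_b1//.
by rewrite big_ord_recl big_ord0 coefC /= mul1r addr0.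
Qed.

(** The product of F with the central element alpha + iota beta; it induces x f(x). *)
Definition stem_mulz F z : H * H :=
  (z.1 *: (F z).1 - z.2 *: (F z).2, z.1 *: (F z).2 + z.2 *: (F z).1).

Lemma induces_mulz D F f : induces D F f -> induces D (stem_mulz F) (fun x => x * f x).
Proof.
move=> iF a b J Dz uJ; rewrite iF//=; case: (F (a, b)) => u v /=.
rewrite -scalerAr mulr1 mulrDl !mulrDr -!scalerAl !mul1r mulrA uJ mulN1r scalerN.
rewrite -!scalerAr; move: (J * u) (J * v) => s t.
by apply/rowP => k; rewrite !mxE; ring.
Qed.

Lemma stem_mulz_stem D F : stem D F -> stem D (stem_mulz F).
Proof.
move=> sF z Dz; rewrite /stem_mulz sF//=; case: (F z) => u v.
by congr pair; apply/rowP => k; rewrite /= !mxE; ring.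
Qed.

Lemma hol_stem_mulz D F F' : open D -> hol_stem D F F' ->
  hol_stem D (stem_mulz F) (fun z => F z + stem_mulz F' z).
Proof.
move=> oD hF [a b] Dz; have [dA dB cF' _] := hF _ Dz.
have cF := stem_C1_continuous oD hF Dz.
have cG : {for (a, b), continuous (fun z => F z + stem_mulz F' z)}.
  have c1 : {for (a, b), continuous (fun z => (F' z).1)} by apply: (continuous_comp cF'); exact: cvg_fst.
  have c2 : {for (a, b), continuous (fun z => (F' z).2)} by apply: (continuous_comp cF'); exact: cvg_snd.
  have p1 : {for (a, b), continuous (fun z : C => z.1)} by exact: cvg_fst.
  have p2 : {for (a, b), continuous (fun z : C => z.2)} by exact: cvg_snd.
  apply: continuousD; first exact: cF.
  apply: continuous_pairing.
    by apply: continuousB; apply: continuous_scale; [exact: p1|exact: c1|exact: p2|exact: c2].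
  by apply: continuousD; apply: continuous_scale; [exact: p1|exact: c2|exact: p2|exact: c1].
split; [| |exact: cG|exact: continuous_iotaM].
- case/is_derive_pairP : dA => /is_derive_sectionl d1 /is_derive_sectionl d2.
  apply/is_derive_pairP; split; apply/is_derive_sectionl => /=.
    have := is_deriveB (is_derive_qscale (@is_derive_id _ _ a 1) d1) (is_deriveZ b d2).
    by congr is_derive; rewrite /= scale1r addrA.
  have := is_deriveD (is_derive_qscale (@is_derive_id _ _ a 1) d2) (is_deriveZ b d1).
  by congr is_derive; rewrite /= scale1r addrA.
- case/is_derive_pairP : dB => /is_derive_sectionr d1 /is_derive_sectionr d2.
  apply/is_derive_pairP; split; apply/is_derive_sectionr => /=.
    have := is_deriveB (is_deriveZ a d1) (is_derive_qscale (@is_derive_id _ _ b 1) d2).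
    congr is_derive; rewrite /= scale1r; case: (F _) (F' _) => u1 u2 [v1 v2] /=.
    by apply/rowP => k; rewrite !mxE; ring.
  have := is_deriveD (is_deriveZ a d2) (is_derive_qscale (@is_derive_id _ _ b 1) d1).
  congr is_derive; rewrite /= scale1r; case: (F _) (F' _) => u1 u2 [v1 v2] /=.
  by apply/rowP => k; rewrite !mxE; ring.
Qed.

(** Induction along Horner's scheme. The claim about F' is carried along to identify the slice
    derivative of a polynomial with its formal derivative. *)
Lemma right_eval_stem D p : open D -> exists F F',
  [/\ stem D F, hol_stem D F F', induces D F (right_eval p) & induces D F' (right_eval p^`())].
Proof.
move=> oD; elim/poly_ind: p => [|p c [F [F' [sF hF iF iF']]]].
  exists (fun=> 0), (fun=> 0); split.
  - by move=> z _; rewrite /conjHC /= oppr0.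
  - move=> z _; have i0 : iotaM (0 : H * H) = 0 by rewrite /iotaM /= oppr0.
    rewrite i0; split; [exact: is_derive_cst|exact: is_derive_cst|exact: cvg_cst|exact: cvg_cst].
  - by move=> a b J _ _; rewrite right_eval0 mulr0 addr0.
  - by move=> a b J _ _; rewrite derivC right_eval0 mulr0 addr0.
have hc : hol_stem D (fun=> (c, 0)) (fun=> 0).
  move=> z _; have i0 : iotaM (0 : H * H) = 0 by rewrite /iotaM /= oppr0.
  rewrite i0; split; [exact: is_derive_cst|exact: is_derive_cst|exact: cvg_cst|exact: cvg_cst].
exists (fun z => stem_mulz F z + (c, 0)), (fun z => F z + stem_mulz F' z + 0).
split.
- apply: stemD; first exact: stem_mulz_stem.
  by move=> z _; rewrite /conjHC /= oppr0.
- exact: (hol_stemD (hol_stem_mulz oD hF) hc).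
- move=> a b J Dz uJ; rewrite right_evalD right_evalMX right_evalC.
  by have /= -> := induces_mulz iF Dz uJ; rewrite addr0 -addrA [_ + c]addrC addrA.
- move=> a b J Dz uJ; rewrite derivMXaddC right_evalD right_evalMX (iF _ _ _ Dz uJ).
  have /= -> := induces_mulz iF' Dz uJ.
  by rewrite /= !addr0 [in RHS]mulrDr; exact: addrACA.
Qed.

Lemma slice_regular_right_eval D p : open D -> slice_regular D (right_eval p).
Proof.
move=> oD; have [F [F' [sF hF iF _]]] := right_eval_stem p oD.
by apply/(slice_regularP _ oD); exists F, F'.
Qed.

Lemma Dop_right_eval D f p q x : open D -> conj_closed D ->
  (forall y, circularization D y -> right_eval p y = f y) -> circularization D x ->
  Dop D q f x = right_eval (p^`() - p * q%:P) x.
Proof.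
move=> oD cD pf Ox; have [F [F' [sF hF iF iF']]] := right_eval_stem p oD.
rewrite (Dop_induced q oD cD sF hF (induces_congr iF pf) Ox).
rewrite -(induces_slice_fun (stem_hol_derive oD cD sF hF) iF' Ox) -pf//.
have -> : p^`() - p * q%:P = p^`() + p * (- q)%:P by rewrite polyCN mulrN.
by rewrite right_evalD right_eval_mulC mulrN.
Qed.

Lemma coef_Sop q p k : (Sop q p)`_k =
  - \sum_(k <= n < size p) (n`!%:R / k`!%:R) *: (p`_n * q ^- (n.+1 - k)).
Proof.
rewrite coef_poly; case: ltnP => // kp.
by rewrite big_geq// oppr0.
Qed.

(** S_q p is the Neumann series - sum_j p^(j) q^(-j-1) for the equation s' - sq = p, finite because
    differentiation is nilpotent on polynomials of bounded degree. *)
Lemma Sop_deriv q p : q != 0 -> (Sop q p)^`() - Sop q p * q%:P = p.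
Proof.
move=> q0; have uq : q \is a GRing.unit by [].
apply/polyP => k; rewrite coefB coef_deriv coefMC !coef_Sop.
have [pk|kp] := leqP (size p) k.
  by rewrite !big_geq ?nth_default ?oppr0 ?mul0r ?mul0rn ?subrr// ltnW.
(* In degree k, the term n = k of -b_k q is a_k, and the terms n > k cancel against (k+1)
   b_{k+1}. *)
rewrite mulNr opprK mulNrn [X in _ + X * q]big_ltn// mulrDl.
rewrite divff ?pnatr_eq0 -?lt0n ?fact_gt0// scale1r subSnn expr1 divrK//.
rewrite addrCA -[RHS]addr0; congr (_ + _).
rewrite addrC mulr_suml -sumrMnl -sumrB big_nat big1// => n /andP[kn np].
rewrite subSS [(n.+1 - k)%N](_ : _ = (n - k).+1); last by rewrite subSn// ltnW.
rewrite -scalerAl exprS invrM ?unitrX// mulrA divrK//.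
rewrite -[_ *+ k.+1]scaler_nat scalerA -scalerBl factS natrM.
rewrite (_ : _ - _ = 0) ?scale0r//.
have k0 : k.+1%:R != 0 :> R by rewrite pnatr_eq0.
have f0 : k`!%:R != 0 :> R by rewrite pnatr_eq0 -lt0n fact_gt0.
move: (k.+1%:R : R) (k`!%:R : R) (n`!%:R : R) k0 f0 => c1 c2 c3 k0 f0.
by field; rewrite k0 f0.
Qed.

Lemma right_eval_monomial n q x : right_eval (q%:P * 'X^n) x = x ^+ n * q.
Proof.
elim: n => [|n IH]; first by rewrite expr0 mulr1 right_evalC mul1r.
by rewrite exprSr mulrA right_evalMX IH exprS mulrA.
Qed.

Lemma laplacian4_right_eval_sum D n (P : nat -> {poly H}) x : open D -> conj_closed D ->
  circularization D x ->
  laplacian4 (right_eval (\sum_(i < n) P i)) x = \sum_(i < n) laplacian4 (right_eval (P i)) x.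
Proof.
move=> oD cD Ox; elim: n => [|n IH].
  (* The zero function is written as a right multiple by 0, so that its Laplacian vanishes by
     [laplacian4_mulr]. *)
  rewrite !big_ord0 (_ : right_eval 0 = (fun y => right_eval 0 y * 0)).
    by rewrite (laplacian4_mulr _ oD cD (slice_regular_right_eval 0 oD) Ox) mulr0.
  by apply/funext => y; rewrite right_eval0 mulr0.
rewrite !big_ord_recr -IH /=.
rewrite (_ : right_eval (_ + P n) = (fun y => right_eval (\sum_(i < n) P i) y + right_eval (P n) y)).
  by rewrite (laplacian4D oD cD (slice_regular_right_eval _ oD) (slice_regular_right_eval _ oD) Ox).
by apply/funext => y; exact: right_evalD.
Qed.

(** The real factor -1/4 can be moved from the coefficients of [lap_tilde] to the monomials x^{n+2},
    where it forms [axial_monomial]. *)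
Lemma laplacian4_lap_tilde D (a : {poly H}) x : open D -> conj_closed D ->
  circularization D x -> laplacian4 (right_eval (lap_tilde a)) x = axial_eval a x.
Proof.
move=> oD cD Ox.
rewrite (laplacian4_right_eval_sum (size a) (fun n => (- 4^-1 *: a`_n)%:P * 'X^(n.+2)) oD cD Ox).
apply: eq_bigr => n _; rewrite /axial_monomial.
pose m := (1%:P * 'X^(n.+2) : {poly H}).
have mE : right_eval m = (fun y => y ^+ n.+2).
  by apply/funext => y; rewrite right_eval_monomial mulr1.
rewrite (_ : right_eval _ = (fun y => right_eval m y * (- 4^-1 *: a`_n))).
  rewrite (laplacian4_mulr _ oD cD (slice_regular_right_eval m oD) Ox) mE.
  by rewrite -scalerAr -scalerAl.
by apply/funext => y; rewrite mE right_eval_monomial.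
Qed.

Lemma yukawa_solution_congr D (l : R) h h' f f' : open D -> conj_closed D ->
  (forall x, circularization D x -> f x = f' x) ->
  (forall x, circularization D x -> h x = h' x) ->
  yukawa_solution D l h f -> yukawa_solution D l h' f'.
Proof.
move=> oD cD ff hh Y x Ox; have [d e] := Y x Ox.
have nE : \forall y \near x, f y = f' y.
  by apply: filterS (near_circularization oD cD Ox) => y; exact: ff.
split.
  move=> n n0; have [d1 d2] := d n n0; split; first exact: near_eq_derivable nE d1.
  exact: near_eq_derivable (near_partial nE n) d2.
by rewrite -(near_laplacian3 nE) -ff// -hh.
Qed.

Lemma axially_monogenic_congr D f f' : open D -> conj_closed D ->
  (forall x, circularization D x -> f x = f' x) ->
  axially_monogenic D f -> axially_monogenic D f'.
Proof.
move=> oD cD ff /(axially_monogenicP _ oD cD)[F [A [B [sF hF iF mF]]]].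
apply/axially_monogenicP => //; exists F, A, B.
by split; [exact: sF|exact: hF|exact: induces_congr iF ff|exact: mF].
Qed.

End RightPolynomials.

Theorem mainTheorem18 (R : realType) (D : set (R * R))
    (hD : axially_symmetric_domain D)
    (lambda : R) (I : quat R) (hI : imag_units I) :
  let Omega := circularization D in
  (forall g : quat R -> quat R, slice_regular D g ->
    let h := fun x => - laplacian4 g x in
    [/\ axially_monogenic D h,
        (forall f : quat R -> quat R,
          axially_monogenic D f ->
          axially_monogenic D (Lop (- (lambda *: I)) f) ->
          ((forall x, Omega x ->
              Lop (lambda *: I) (Lop (- (lambda *: I)) f) x = laplacian4 g x)
           <-> yukawa_solution D lambda h f))
      & (forall ft : quat R -> quat R, slice_regular D ft ->
          (forall x, Omega x ->
             Dop D (lambda *: I) (Dop D (- (lambda *: I)) ft) x = g x) ->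
          let f := laplacian4 ft in
          [/\ axially_monogenic D f,
              axially_monogenic D (Lop (- (lambda *: I)) f),
              (forall x, Omega x ->
                 Lop (lambda *: I) (Lop (- (lambda *: I)) f) x = laplacian4 g x)
            & yukawa_solution D lambda h f])]) /\
  (lambda != 0 -> forall a : {poly quat R},
    let h := axial_eval a in
    let f := fun x =>
      - laplacian4 (right_eval (Sop (- (lambda *: I)) (Sop (lambda *: I) (lap_tilde a)))) x in
    axially_monogenic D f /\ yukawa_solution D lambda h f).
Proof.
case: hD => oD cD _ _ Omega.
have dop g ft : slice_regular D ft ->
    (forall x, Omega x -> Dop D (lambda *: I) (Dop D (- (lambda *: I)) ft) x = g x) ->
    let f := laplacian4 ft in
    [/\ axially_monogenic D f, axially_monogenic D (Lop (- (lambda *: I)) f),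
        (forall x, Omega x ->
           Lop (lambda *: I) (Lop (- (lambda *: I)) f) x = laplacian4 g x)
      & yukawa_solution D lambda (fun x => - laplacian4 g x) f].
  move=> rft eg f.
  have mf : axially_monogenic D f := axially_monogenic_laplacian4 oD cD rft.
  have [mL eL] := Dop_Dop_laplacian oD cD hI rft eg.
  by split; [exact: mf|exact: mL|exact: eL|apply/(Lop_Lop_yukawa _ oD cD hI mf mL)].
split=> [g rg h|l0 a h f].
  split; last by move=> ft; exact: dop.
    exact: (axially_monogenicN oD cD (axially_monogenic_laplacian4 oD cD rg)).
  by move=> f mf mL; exact: (Lop_Lop_yukawa _ oD cD hI mf mL).
set q := lambda *: I in f *.
have q0 : q != 0 by rewrite scaler_eq0 negb_or l0 imag_unit_neq0.
pose p := lap_tilde a; pose s1 := Sop q p; pose s := Sop (- q) s1.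
(* Since h = Delta_4 p while the first part produces -Delta_4 g, the source must be g = -p, hence
   the solution -s. The sign is a right factor -1, which commutes with all the operators. *)
pose ft := right_eval (s * (-1)%:P).
have mulN (r : {poly quat R}) x : Omega x ->
    laplacian4 (right_eval (r * (-1)%:P)) x = - laplacian4 (right_eval r) x.
  move=> Ox; rewrite (_ : right_eval _ = (fun y => right_eval r y * -1)).
    by rewrite (laplacian4_mulr _ oD cD (slice_regular_right_eval r oD) Ox) mulrN1.
  by apply/funext => y; exact: right_eval_mulC.
have ftE x : Omega x -> laplacian4 ft x = f x by exact: mulN.
(* D_{-q} undoes the outer S_{-q} and leaves -s1; then D_q undoes S_q and leaves -p. *)
have eg x : Omega x -> Dop D q (Dop D (- q) ft) x = right_eval (p * (-1)%:P) x.
  move=> Ox.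
  have com (r : {poly quat R}) c : r * (-1)%:P * c%:P = r * c%:P * (-1)%:P.
    by rewrite -!mulrA -!polyCM mulN1r mulrN1.
  have der (r : {poly quat R}) : (r * (-1)%:P)^`() = r^`() * (-1)%:P.
    by rewrite !polyCN !mulrN !mulr1 derivN.
  rewrite (@Dop_right_eval _ D _ (s1 * (-1)%:P) q x oD cD)//; last first.
    move=> y Oy; rewrite (@Dop_right_eval _ D _ (s * (-1)%:P) (- q) y oD cD)//.
    by rewrite der com -mulrBl Sop_deriv ?oppr_eq0.
  by rewrite der com -mulrBl Sop_deriv.
have [mf _ _ Y] := dop _ _ (slice_regular_right_eval _ oD) eg.
split; first exact: axially_monogenic_congr mf.
apply: (yukawa_solution_congr oD cD ftE) Y => x Ox.
by rewrite mulN// opprK (laplacian4_lap_tilde a oD cD Ox).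
Qed.
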